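(* Let $n\geqslant1$ and $\delta>0$ be fixed. For $0<\tau\ll1$, let $\psi=\psi(t,x)$ be the solution to the MGT equation $$\begin{cases}\tau\psi_{ttt}+\psi_{tt}-\Delta\psi-(\delta+\tau)\Delta\psi_t=0, & x\in\mathbb{R}^n,\ t>0,\\ \psi(0,x)=\psi_0(x),\ \psi_t(0,x)=\psi_1(x),\ \psi_{tt}(0,x)=\psi_2(x), & x\in\mathbb{R}^n,\end{cases}$$ and let $\varphi=\varphi(t,x)$ be the solution to the linearized Kuznetsov's equation $$\varphi_{tt}-\Delta\varphi-\delta\Delta\varphi_t=0,\quad x\in\mathbb{R}^n,\ t>0,\qquad \varphi(0,x)=\psi_0(x),\ \varphi_t(0,x)=\psi_1(x),$$ where the data satisfy $\psi_2=\Delta\psi_0+\delta\Delta\psi_1$. Then there is a constant $C>0$ independent of $\tau$ such that, for all $0<\tau\ll1$, $$\sup_{t\in[0,\infty)}\|\psi(t,\cdot)-\varphi(t,\cdot)\|_{L^2}\leqslant\tau C\left(\|\psi_0\|_{H^4\cap L^1}+\|\psi_1\|_{H^3\cap L^1}\right),$$ and, for $s_0>n+2$, $$\sup_{t\in[0,\infty)}\|\psi(t,\cdot)-\varphi(t,\cdot)\|_{L^\infty}\leqslant\tau C\left(\|\langle D\rangle^{s_0+2}\psi_0\|_{L^1}+\|\langle D\rangle^{s_0+1}\psi_1\|_{L^1}\right).$$ Consequently, if the right-hand sides are finite, $\psi\to\varphi$ in $L^\infty([0,\infty),L^p)$ for all $2\leqslant p\leqslant\infty$ as $\tau\downarrow0$,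 with the convergence rate $\tau$.
   Context: $\langle D\rangle^{r}$ is the Fourier multiplier with symbol $(1+|\xi|^2)^{r/2}$. ''$0<\tau\ll1$'' means $0<\tau\leqslant\tau_0$ for some sufficiently small $\tau_0>0$. The constant $C$ is independent of $\tau$, $t$ and the data (it may depend on $n,\delta,s_0$). The data $\psi_0,\psi_1$ are independent of $\tau$. *)

(* Defs.v *)
From HB Require Import structures.
From mathcomp Require Import all_boot all_order all_algebra.
From mathcomp Require Import all_classical all_reals all_analysis.
From mathcomp Require Import complex.

Set Implicit Arguments.
Unset Strict Implicit.
Unset Printing Implicit Defensive.

Import Order.TTheory GRing.Theory Num.Theory.
Import numFieldNormedType.Exports.

Local Open Scope classical_set_scope.
Local Open Scope ring_scope.

Section rV_measurable.
Context (R : realType) (n : nat).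

Definition coord_rV (i : 'I_n) (x : 'rV[R]_n) : measurableTypeR R := x ord0 i.

Let rV_set0 : g_sigma_preimage coord_rV set0.
Proof. exact: sigma_algebra0. Qed.

Let rV_setC A : g_sigma_preimage coord_rV A -> g_sigma_preimage coord_rV (~` A).
Proof. exact: sigma_algebraC. Qed.

Let rV_bigcup (F : _^nat) : (forall i, g_sigma_preimage coord_rV (F i)) ->
  g_sigma_preimage coord_rV (\bigcup_i (F i)).
Proof. exact: sigma_algebra_bigcup. Qed.

(* R^n carries the product sigma-algebra, i.e. its Borel sets. *)
HB.instance Definition _ := @isMeasurable.Build
  (measure_tuple_display default_measure_display)
  'rV[R]_n (g_sigma_preimage coord_rV) rV_set0 rV_setC rV_bigcup.

End rV_measurable.

Section rV_measurable_lemmas.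
Context (R : realType).

Lemma measurable_coord_rV n (i : 'I_n) :
  measurable_fun [set: 'rV[R]_n] (coord_rV i).
Proof.
move=> _ Y mY; rewrite setTI; apply: sub_sigma_algebra => /=.
rewrite -bigcup_seq/=; exists i => /=; first by rewrite mem_index_enum.
by exists Y => //; rewrite setTI.
Qed.

Lemma measurable_fun_coord_rV d (T : measurableType d) n (f : T -> 'rV[R]_n) :
  (forall i, measurable_fun [set: T] (coord_rV i \o f)) ->
  measurable_fun [set: T] f.
Proof.
move=> mf.
suff h : measurable `<=` image_set_system [set: T] f measurable.
  by move=> _ A mA; exact: h.
apply: smallest_sub; first exact/sigma_algebra_image/sigma_algebra_measurable.
rewrite -bigcup_seq => A [i _ [B mB <-]] /=.
rewrite /image_set_system/= !setTI -comp_preimage.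
by rewrite -[X in measurable X]setTI; exact: mf.
Qed.

Definition cons_rV n (p : R * 'rV[R]_n) : 'rV[R]_n.+1 :=
  \row_i oapp (fun j => p.2 ord0 j) p.1 (unlift ord0 i).

Definition uncons_rV n (x : 'rV[R]_n.+1) : R * 'rV[R]_n :=
  (x ord0 ord0, \row_j x ord0 (lift ord0 j)).

Lemma cons_rVK n : cancel (@cons_rV n) (@uncons_rV n).
Proof.
move=> [a x]; rewrite /uncons_rV /cons_rV mxE unlift_none /=; congr pair.
by apply/rowP => j; rewrite !mxE liftK.
Qed.

Lemma measurable_cons_rV n : measurable_fun [set: R * 'rV[R]_n] (@cons_rV n).
Proof.
apply: measurable_fun_coord_rV => i.
case: (unliftP ord0 i) => [j ->|->].
  rewrite (_ : _ \o _ = coord_rV j \o snd).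
    by apply: measurableT_comp; [exact: measurable_coord_rV|exact: measurable_snd].
  by apply/funext => p; rewrite /coord_rV/= mxE liftK.
rewrite (_ : _ \o _ = fst); first exact: measurable_fst.
by apply/funext => p; rewrite /coord_rV/= mxE unlift_none.
Qed.

Lemma measurable_uncons_rV n :
  measurable_fun [set: 'rV[R]_n.+1] (@uncons_rV n).
Proof.
apply/measurable_fun_pair => /=; first exact: (measurable_coord_rV ord0).
apply: measurable_fun_coord_rV => i.
rewrite (_ : _ \o _ = coord_rV (lift ord0 i)); first exact: measurable_coord_rV.
by apply/funext => x; rewrite /coord_rV/= mxE.
Qed.

End rV_measurable_lemmas.

Section lebesgue_rV.
Context (R : realType).

Section step.
Variables (n : nat) (mu : {sigma_finite_measure set 'rV[R]_n -> \bar R}).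

Definition lebesgue_step : set 'rV[R]_n.+1 -> \bar R :=
  pushforward (lebesgue_measure \x mu)%E (@cons_rV R n).

Let preimage_cons_rV (A : set 'rV[R]_n.+1) :
  measurable A -> measurable (@cons_rV R n @^-1` A).
Proof.
by move=> mA; rewrite -[X in measurable X]setTI; exact: measurable_cons_rV.
Qed.

Let step0 : lebesgue_step set0 = 0%E.
Proof. by rewrite /lebesgue_step /pushforward preimage_set0 measure0. Qed.

Let step_ge0 A : (0 <= lebesgue_step A)%E.
Proof. exact: (measure_ge0 (lebesgue_measure \x mu)%E). Qed.

Let step_sigma_additive : semi_sigma_additive lebesgue_step.
Proof.
move=> F mF tF mUF; rewrite /lebesgue_step /pushforward preimage_bigcup.
apply: measure_semi_sigma_additive.
- by move=> k; exact: preimage_cons_rV.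
- apply/trivIsetP => /= i j _ _ ij; rewrite -preimage_setI.
  by move/trivIsetP : tF => /(_ _ _ _ _ ij) ->//; rewrite preimage_set0.
- by rewrite -preimage_bigcup; exact: preimage_cons_rV.
Qed.

HB.instance Definition _ := isMeasure.Build _ _ _ lebesgue_step
  step0 step_ge0 step_sigma_additive.

Let step_sigma_finite : sigma_finite setT lebesgue_step.
Proof.
have /sigma_finiteP[F [FT ndF Foo]] := sigma_finiteT (@lebesgue_measure R).
have /sigma_finiteP[G [GT ndG Goo]] := sigma_finiteT mu.
exists (fun k => @uncons_rV R n @^-1` (F k `*` G k)).
  apply/esym; rewrite -subTset => x _.
  have : setT (uncons_rV x).1 by [].
  have : setT (uncons_rV x).2 by [].
  rewrite [in X in X -> _]GT [in X in _ -> X -> _]FT => -[k _ Gk] [l _ Fl].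
  exists (maxn k l) => //; split.
    by move: Fl; exact/subsetPset/ndF/leq_maxr.
  by move: Gk; exact/subsetPset/ndG/leq_maxl.
move=> k; have [mF Fk] := Foo k; have [mG Gk] := Goo k; split.
  rewrite -[X in measurable X]setTI.
  by apply: measurable_uncons_rV => //; exact: measurableX.
rewrite /lebesgue_step /pushforward -comp_preimage.
rewrite (_ : _ \o _ = id); last by apply/funext => p /=; rewrite cons_rVK.
by rewrite preimage_id product_measure1E// lte_mul_pinfty// ge0_fin_numE.
Qed.

HB.instance Definition _ := Measure_isSigmaFinite.Build _ _ _ lebesgue_step
  step_sigma_finite.

End step.

(* Iterated product of the Lebesgue measure on R; on R^0 it is the unit mass
   at the only point. *)
Fixpoint lebesgue_rV (n : nat) : {sigma_finite_measure set 'rV[R]_n -> \bar R} :=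
  match n with
  | 0 => dirac (0 : 'rV[R]_0)
  | m.+1 => lebesgue_step (lebesgue_rV m)
  end.

Lemma lebesgue_rV_box n (A : 'I_n -> set R) :
  (forall i, measurable (A i)) ->
  lebesgue_rV n [set x | forall i, A i (x ord0 i)] =
  (\prod_(i < n) lebesgue_measure (A i))%E.
Proof.
elim: n A => [|n IH] A mA.
  by rewrite big_ord0 /= diracE mem_set//=; case.
rewrite big_ord_recl -IH// -product_measure1E//.
- rewrite /= /lebesgue_step /pushforward; congr product_measure1.
  apply/seteqP; split => [[a x] /= h|[a x] /= [h1 h2] i].
    split => [|i]; first by have := h ord0; rewrite mxE unlift_none.
    by have := h (lift ord0 i); rewrite mxE liftK.
  by rewrite mxE; case: unliftP => [j|] ->.
- exact: mA.
- rewrite [X in measurable X](_ : _ =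
    \bigcap_(i in [set: 'I_n]) (coord_rV i @^-1` A (lift ord0 i))).
    apply: fin_bigcap_measurable => // i _.
    by rewrite -[X in measurable X]setTI; apply: measurable_coord_rV => //; exact: mA.
  by apply/seteqP; split => x h i; [move=> _; exact: (h i)|exact: (h i I)].
Qed.

End lebesgue_rV.

Local Open Scope complex_scope.

Section function_spaces.
Context (R : realType) (n : nat).
Local Notation V := 'rV[R]_n.
Local Notation mu := (lebesgue_rV R n).
Implicit Types (f g : V -> R) (u v : R -> V -> R).

Definition Lp_norm (p : \bar R) f : \bar R := 'N[mu]_p[EFin \o f]%E.

Definition in_L2 f : Prop := f \in Lfun mu 2%:E.

Definition dotp (x y : V) : R := \sum_i x ord0 i * y ord0 i.

(* (2 pi)^(-n/2) \int f(x) e^(- i x.xi) dx; meaningful for f in L^1 only. *)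
Definition fourier f (xi : V) : R[i] :=
  ((2 * pi) `^ (- (n%:R / 2)))%:C *
  ((\int[mu]_x (f x * cos (dotp x xi))) -i*
   (\int[mu]_x (f x * sin (dotp x xi)))).

Definition japanese_bracket (xi : V) : R := Num.sqrt (1 + dotp xi xi).

(* g = <D>^r f, for integrable f and g. *)
Definition bessel_potential (r : R) f g : Prop :=
  [/\ mu.-integrable setT (EFin \o f), mu.-integrable setT (EFin \o g) &
      forall xi, fourier g xi = (japanese_bracket xi `^ r)%:C * fourier f xi].

(* ||<D>^r f||_{L^1}, equal to +oo (the infimum of the empty set) when <D>^r f
   is not integrable.  For r > 0, which is the only case in which it is used,
   <D>^r f in L^1 forces f in L^1, because <D>^(-r) is the convolution with an
   integrable kernel; hence no f is lost by requiring f in L^1 above. *)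
Definition bessel_L1_norm (r : R) f : \bar R :=
  ereal_inf [set Lp_norm 1%:E g | g in [set g | bessel_potential r f g]].

(* ||f||_{H^s \cap L^1} = ||f||_{H^s} + ||f||_{L^1} for a measurable f, where
   ||f||_{H^s} = ||<xi>^s fourier f||_{L^2}.  The integral defining fourier f
   is only relevant for f in L^1, since the second term is +oo otherwise. *)
Definition HsL1_norm (s : R) f : \bar R :=
  (Lp_norm 2%:E (fun xi => japanese_bracket xi `^ s *
                           ComplexField.Normc.normc (fourier f xi))%R
   + Lp_norm 1%:E f)%E.

Definition partial (i : 'I_n) f : V -> R := fun x => 'D_(delta_mx 0 i) f x.

(* All iterated partial derivatives exist and are (Frechet) differentiable,
   i.e. f is C^oo. *)
Definition smooth f : Prop :=
  forall (s : seq 'I_n) (x : V), differentiable (foldr partial f s) x.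

Definition test_function f : Prop :=
  smooth f /\ compact (closure [set x | f x != 0]).

Definition laplacian f : V -> R := fun x => \sum_i partial i (partial i f) x.

(* g = Delta f in the sense of distributions, with f and g in L^2. *)
Definition weak_laplacian f g : Prop :=
  [/\ in_L2 f, in_L2 g &
      forall chi, test_function chi ->
        \int[mu]_x (f x * laplacian chi x) = \int[mu]_x (g x * chi x)].

(* v(t) is the derivative at t of u : [0,+oo[ -> L^2 (one-sided at t = 0). *)
Definition is_L2_derive u v (t : R) : Prop :=
  Lp_norm 2%:E (fun x => h^-1 * (u (t + h) x - u t x) - v t x)
    @[h --> within [set h | 0 <= t + h] 0^'] --> 0%E.

(* Strong L^2 solutions: L^2-valued functions of t that are differentiable in
   time up to the order of the equation, and that satisfy it almost everywhere
   in x, the Laplacian being the distributional one. *)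
Definition MGT_solution (tau delta : R) (psi0 psi1 psi2 : V -> R)
    (psi : R -> V -> R) : Prop :=
  exists psi_t psi_tt psi_ttt lap_psi lap_psi_t : R -> V -> R,
  [/\ forall t, 0 <= t ->
        [/\ in_L2 (psi t), in_L2 (psi_t t), in_L2 (psi_tt t)
          & in_L2 (psi_ttt t)],
      forall t, 0 <= t ->
        [/\ is_L2_derive psi psi_t t, is_L2_derive psi_t psi_tt t
          & is_L2_derive psi_tt psi_ttt t],
      forall t, 0 < t ->
        weak_laplacian (psi t) (lap_psi t) /\
        weak_laplacian (psi_t t) (lap_psi_t t),
      forall t, 0 < t -> {ae mu, forall x,
        tau * psi_ttt t x + psi_tt t x - lap_psi t x
        - (delta + tau) * lap_psi_t t x = 0}
    & [/\ {ae mu, forall x, psi 0 x = psi0 x},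
          {ae mu, forall x, psi_t 0 x = psi1 x}
        & {ae mu, forall x, psi_tt 0 x = psi2 x}]].

Definition Kuznetsov_solution (delta : R) (phi0 phi1 : V -> R)
    (phi : R -> V -> R) : Prop :=
  exists phi_t phi_tt lap_phi lap_phi_t : R -> V -> R,
  [/\ forall t, 0 <= t ->
        [/\ in_L2 (phi t), in_L2 (phi_t t) & in_L2 (phi_tt t)],
      forall t, 0 <= t ->
        is_L2_derive phi phi_t t /\ is_L2_derive phi_t phi_tt t,
      forall t, 0 < t ->
        weak_laplacian (phi t) (lap_phi t) /\
        weak_laplacian (phi_t t) (lap_phi_t t),
      forall t, 0 < t -> {ae mu, forall x,
        phi_tt t x - lap_phi t x - delta * lap_phi_t t x = 0}
    & {ae mu, forall x, phi 0 x = phi0 x} /\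
      {ae mu, forall x, phi_t 0 x = phi1 x}].

Definition compatible_data (delta : R) (psi0 psi1 psi2 : V -> R) : Prop :=
  exists lap0 lap1 : V -> R,
  [/\ weak_laplacian psi0 lap0, weak_laplacian psi1 lap1
    & {ae mu, forall x, psi2 x = lap0 x + delta * lap1 x}].

Definition sup_Lp_dist (p : \bar R) u v : \bar R :=
  ereal_sup [set Lp_norm p (fun x => u t x - v t x) | t in `[0, +oo[].

End function_spaces.

(* Main.v *)
Require Import Defs.
From mathcomp Require Import all_boot all_order all_algebra.
From mathcomp Require Import all_classical all_reals all_analysis.
From mathcomp Require Import measurable_realfun ess_sup_inf complex ring lra.
Import Order.TTheory GRing.Theory Num.Theory.
Import numFieldNormedType.Exports.
Local Open Scope classical_set_scope.
Local Open Scope ring_scope.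
Set Implicit Arguments.
Unset Strict Implicit.
Unset Printing Implicit Defensive.

(* In frequency, the difference w of the two solutions satisfies, for each xi, a linear ODE in
   time whose source is tau times time derivatives of phi.  A quadratic energy in w, its
   first two time derivatives and those of phi is nonincreasing for tau <= 1; it dominates
   |xi|^2 w^2 and, since the data are compatible, its initial value is of order tau^2.  As the
   solutions are only L2-valued curves, the energy is integrated over frequencies
   1/k <= |xi|^2 <= k with an arbitrary weight, and k tends to infinity.  The constant weight
   gives the L2 bound by Plancherel.  A weight of the form <xi>^s gives, by Cauchy-Schwarz, a
   bound in L1 of the transform of w, hence on the supremum of w; the other exponents follow by
   interpolation.
   The Hartley transform, whose kernel is cos + sin, replaces the Fourier transform: it is real,
   equal to its inverse, and diagonalizes the Laplacian in the same way. *)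

(** * Square-integrable functions *)

(** Fix xi and put a = |xi|^2. Differentiating the equation of phi in time turns the source in the
    equation of w into tau * delta * a * phi_tt. The natural energy of w leaves products with w_tt,
    for which there is no dissipation; a third square, in w_t - tau * phi_tt, cancels them exactly.
    The rest is absorbed by the dissipation of w_t and by that of two energies of phi, in (phi_tt,
    phi_t) and in (phi_ttt, phi_tt), weighted by tau^2. Compatibility makes w, w_t, w_tt vanish at
    time 0, so that initially only these tau^2 terms are left. They carry the factor a, as does the
    lower bound of the energy; dividing it out avoids any loss at low frequencies. Since phi is only
    twice differentiable in time, phi_tt is rewritten through the equation: after the cutoff a is a
    bounded multiplier, and further derivatives are inherited from phi and phi_t. The Laplacian is
    known only through compactly supported tests, hence the explicit bumps. Inversion is obtained by
    testing against boxes, where everything factors into one-dimensional arctangents. *)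

Section square_integrable.
Context d (T : measurableType d) (R : realType).
Variable mu : {measure set T -> \bar R}.
Implicit Types (f g h c : T -> R).

Definition integ f := mu.-integrable setT (EFin \o f).
Local Notation L2 := (Lfun mu 2%:E).

Lemma integ_measurable f : integ f -> measurable_fun setT f.
Proof. by move=> /measurable_int/measurable_EFinP. Qed.

Lemma integD f g : integ f -> integ g -> integ (fun x => f x + g x).
Proof. by move=> If Ig; apply: eq_integrable (integrableD measurableT If Ig). Qed.

Lemma integZ k f : integ f -> integ (fun x => k * f x).
Proof. by move=> If; apply: eq_integrable (integrableZl measurableT k If). Qed.

Lemma integB f g : integ f -> integ g -> integ (fun x => f x - g x).
Proof. by move=> If Ig; apply: eq_integrable (integrableB measurableT If Ig). Qed.

Lemma integ0 : integ (fun=> 0).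
Proof. exact: integrable0. Qed.

Lemma integ_abs f : integ f -> integ (fun x => `|f x|).
Proof. by move=> If; apply: eq_integrable (integrable_abse If). Qed.

Lemma le_integ f g : measurable_fun setT f -> (forall x, `|f x| <= g x) ->
  integ g -> integ f.
Proof.
move=> mf fg Ig; apply: (le_integrable measurableT _ _ Ig).
- exact/measurable_EFinP.
- move=> x _ /=; rewrite lee_fin (le_trans (fg x))//; exact: ler_norm.
Qed.

Lemma integM_bounded M c f : measurable_fun setT c -> (forall x, `|c x| <= M) ->
  integ f -> integ (fun x => c x * f x).
Proof.
move=> mc cM If; apply: (@le_integ _ (fun x => M * `|f x|)).
- by apply: measurable_funM => //; exact: integ_measurable.
- by move=> x; rewrite normrM ler_wpM2r.
- exact/integZ/integ_abs.
Qed.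

Lemma integ_fin_num f : integ f -> (\int[mu]_x (f x)%:E)%E \is a fin_num.
Proof. exact: integrable_fin_num. Qed.

Lemma Rintegral_EFin f : integ f -> (\int[mu]_x f x)%:E = (\int[mu]_x (f x)%:E)%E.
Proof. by move=> If; rewrite fineK//; exact: integ_fin_num. Qed.

Lemma ge0_integP f : measurable_fun setT f -> (forall x, 0 <= f x) ->
  integ f <-> (\int[mu]_x (f x)%:E < +oo)%E.
Proof.
move=> mf f0; split=> [/integrableP[_]|]; first
  by under eq_integral do rewrite /= ger0_norm//.
move=> h; apply/integrableP; split; first exact/measurable_EFinP.
by under eq_integral do rewrite /= ger0_norm//.
Qed.

Lemma ge0_integ_le f r : measurable_fun setT f -> (forall x, 0 <= f x) ->
  (\int[mu]_x (f x)%:E <= r%:E)%E -> integ f /\ \int[mu]_x f x <= r.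
Proof.
move=> mf f0 h; have If : integ f.
  by apply/ge0_integP => //; rewrite (le_lt_trans h)// ltry.
by split=> //; rewrite -lee_fin Rintegral_EFin.
Qed.

Lemma ler_Rintegral f g : integ f -> integ g -> (forall x, f x <= g x) ->
  \int[mu]_x f x <= \int[mu]_x g x.
Proof. by move=> If Ig fg; apply: le_Rintegral. Qed.

Lemma ae_eq_Rintegral f g : measurable_fun setT f -> measurable_fun setT g ->
  {ae mu, forall x, f x = g x} -> \int[mu]_x f x = \int[mu]_x g x.
Proof.
move=> mf mg fg; rewrite /Rintegral; congr fine.
apply: ae_eq_integral => //; try exact/measurable_EFinP.
by apply: filterS fg => x /= -> _.
Qed.

Lemma ae_le_Rintegral f g : integ f -> integ g ->
  {ae mu, forall x, f x <= g x} -> \int[mu]_x f x <= \int[mu]_x g x.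
Proof.
move=> If Ig fg; have mf := integ_measurable If; have mg := integ_measurable Ig.
(* Replacing [f] by the minimum of [f] and [g], equal to [f] almost everywhere, makes the inequality
   hold everywhere. *)
have Im : integ (fun x => Num.min (f x) (g x)).
  apply: (@le_integ _ (fun x => `|f x| + `|g x|)).
  - exact: measurable_minr.
  - move=> x; rewrite /Num.min; case: ifP => _; first by rewrite lerDl.
    by rewrite lerDr.
  - by apply: integD; exact: integ_abs.
rewrite (@ae_eq_Rintegral f (fun x => Num.min (f x) (g x)))//.
- by apply: ler_Rintegral => // x; rewrite ge_min lexx orbT.
- exact: measurable_minr.
- by apply: filterS fg => x fgx; rewrite min_l.
Qed.

Lemma ae_ge0_Rintegral_eq0 f : integ f -> (forall x, 0 <= f x) ->
  \int[mu]_x f x = 0 -> {ae mu, forall x, f x = 0}.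
Proof.
move=> If f0 h; have := Rintegral_EFin If; rewrite h => h2.
have := @ae_eq_integral_abs _ _ _ mu setT measurableT (EFin \o f).
move=> [|+ _]; first exact/measurable_EFinP/integ_measurable.
under eq_integral do rewrite /= ger0_norm//.
by rewrite -h2 => /(_ erefl); apply: filterS => x /= /(_ I) [].
Qed.

Lemma L2P f : f \in L2 <->
  measurable_fun setT f /\ integ (fun x => f x ^+ 2).
Proof.
split=> [f2|[mf If]].
  split; last exact: Lfun2_integrable_sqr.
  by move: f2; rewrite inE => /andP[]; rewrite inE.
rewrite inE; apply/andP; split; rewrite inE//=.
rewrite /finite_norm unlock /Lnorm poweR_lty//.
move/integrableP : If => [_]; apply: le_lt_trans.
apply: ge0_le_integral => //.
- move=> x _; rewrite poweR_ge0//.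
- apply: (measurableT_comp (measurable_poweR 2)) => //.
  by apply: measurableT_comp => //; exact/measurable_EFinP.
- by do 2 apply: measurableT_comp => //; exact: measurable_funX.
- by move=> x _ /=; rewrite lee_fin normrX powR_mulrn.
Qed.

Lemma L2_measurable f : f \in L2 -> measurable_fun setT f.
Proof. by move/L2P => []. Qed.

Lemma L2_sqr f : f \in L2 -> integ (fun x => f x ^+ 2).
Proof. by move/L2P => []. Qed.

Lemma L2M f g : f \in L2 -> g \in L2 -> integ (fun x => f x * g x).
Proof. by move=> f2 g2; apply/Lfun1_integrable; exact: Lfun2_mul_Lfun1. Qed.

Let le12 : (1 <= 2%:E :> \bar R)%E. Proof. by rewrite lee_fin ler1n. Qed.

Lemma L2D f g : f \in L2 -> g \in L2 -> (fun x => f x + g x) \in L2.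
Proof. exact: (Lfun_addr_closed mu le12).2. Qed.

Lemma L2M_bounded M c f : measurable_fun setT c -> (forall x, `|c x| <= M) ->
  f \in L2 -> (fun x => c x * f x) \in L2.
Proof.
move=> mc cM f2; apply/L2P; split.
  by apply: measurable_funM => //; exact: L2_measurable.
rewrite (_ : (fun _ => _) = (fun x => c x ^+ 2 * f x ^+ 2)); last first.
  by apply/funext => x; rewrite exprMn.
apply: (@integM_bounded (M ^+ 2)).
- exact: measurable_funX.
- by move=> x; rewrite normrX lerXn2r ?nnegrE// (le_trans _ (cM x)).
- exact: L2_sqr.
Qed.

Lemma L2Z k f : f \in L2 -> (fun x => k * f x) \in L2.
Proof. by move=> f2; apply: (@L2M_bounded `|k|). Qed.

Lemma L2B f g : f \in L2 -> g \in L2 -> (fun x => f x - g x) \in L2.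
Proof.
move=> f2 g2; rewrite (_ : (fun _ => _) = (fun x => f x + (-1) * g x)).
  by apply: L2D => //; exact: L2Z.
by apply/funext => x; rewrite mulN1r.
Qed.

Lemma L2_0 : (fun=> 0) \in L2.
Proof. exact: (Lfun_addr_closed mu le12).1. Qed.

Lemma L2_ae f g : f \in L2 -> measurable_fun setT g ->
  {ae mu, forall x, f x = g x} -> g \in L2.
Proof.
move=> f2 mg fg; apply/L2P; split=> //; apply/ge0_integP.
- exact: measurable_funX.
- by move=> x; exact: sqr_ge0.
rewrite [X in (X < _)%E](_ : _ = (\int[mu]_x (f x ^+ 2)%:E)%E).
  by rewrite -Rintegral_EFin ?ltry//; exact: L2_sqr.
apply: ge0_ae_eq_integral => //.
- by apply/measurable_EFinP; exact: measurable_funX.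
- by apply/measurable_EFinP; apply: measurable_funX; exact: L2_measurable.
- by move=> x _; rewrite lee_fin sqr_ge0.
- by move=> x _; rewrite lee_fin sqr_ge0.
- by apply: filterS fg => x /= ->.
Qed.

(** [Rintegral] returns 0 on an infinite integral, so these are an inner product and a norm on L2
    only. *)
Definition dotL2 f g : R := \int[mu]_x (f x * g x).
Definition nrmL2 f : R := Num.sqrt (dotL2 f f).

Lemma dotL2C f g : dotL2 f g = dotL2 g f.
Proof. by rewrite /dotL2; under eq_Rintegral do rewrite mulrC. Qed.

Lemma dotL2Dl f g h : f \in L2 -> g \in L2 -> h \in L2 ->
  dotL2 (fun x => f x + g x) h = dotL2 f h + dotL2 g h.
Proof.
move=> f2 g2 h2; rewrite /dotL2; under eq_Rintegral do rewrite mulrDl.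
by rewrite RintegralD//; exact: L2M.
Qed.

Lemma dotL2Zl k f g : f \in L2 -> g \in L2 ->
  dotL2 (fun x => k * f x) g = k * dotL2 f g.
Proof.
move=> f2 g2; rewrite /dotL2; under eq_Rintegral do rewrite -mulrA.
by rewrite RintegralZl//; exact: L2M.
Qed.

Lemma dotL2Bl f g h : f \in L2 -> g \in L2 -> h \in L2 ->
  dotL2 (fun x => f x - g x) h = dotL2 f h - dotL2 g h.
Proof.
move=> f2 g2 h2; rewrite /dotL2; under eq_Rintegral do rewrite mulrBl.
by rewrite RintegralB//; exact: L2M.
Qed.

Lemma dotL2Br f g h : f \in L2 -> g \in L2 -> h \in L2 ->
  dotL2 h (fun x => f x - g x) = dotL2 h f - dotL2 h g.
Proof. by move=> f2 g2 h2; rewrite dotL2C dotL2Bl// !(dotL2C h). Qed.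

Lemma dotL2Zr k f g : f \in L2 -> g \in L2 ->
  dotL2 g (fun x => k * f x) = k * dotL2 g f.
Proof. by move=> f2 g2; rewrite dotL2C dotL2Zl// (dotL2C g). Qed.

Lemma dotL2_ge0 f : 0 <= dotL2 f f.
Proof. by apply: Rintegral_ge0 => x _; rewrite -expr2 sqr_ge0. Qed.

Lemma dotL2_sqr f : dotL2 f f = \int[mu]_x (f x ^+ 2).
Proof. by rewrite /dotL2; apply: eq_Rintegral => x _; rewrite expr2. Qed.

Lemma nrmL2_ge0 f : 0 <= nrmL2 f.
Proof. exact: sqrtr_ge0. Qed.

Lemma nrmL2_sqr f : nrmL2 f ^+ 2 = dotL2 f f.
Proof. by rewrite sqr_sqrtr// dotL2_ge0. Qed.

Lemma Lnorm2E f : f \in L2 -> 'N[mu]_2%:E[EFin \o f]%E = (nrmL2 f)%:E.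
Proof.
move=> f2; rewrite unlock /Lnorm.
under eq_integral do rewrite /= -[X in (`|_| `^ X)%:E]/(2%:R) powR_mulrn// -normrX ger0_norm ?sqr_ge0//.
rewrite -Rintegral_EFin; last exact: L2_sqr.
by rewrite -dotL2_sqr poweR_EFin /nrmL2 powR12_sqrt// dotL2_ge0.
Qed.

Lemma cauchy_schwarz f g : f \in L2 -> g \in L2 ->
  `|dotL2 f g| <= nrmL2 f * nrmL2 g.
Proof.
move=> f2 g2; have Ifg := L2M f2 g2.
apply: (le_trans (le_normr_Rintegral measurableT Ifg)).
rewrite -lee_fin Rintegral_EFin ?EFinM; last exact: integ_abs.
rewrite -!Lnorm2E//; apply: le_trans (hoelder mu _ _ _ _ _); rewrite ?Lnorm1//.
- exact: L2_measurable.
- exact: L2_measurable.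
- by lra.
Qed.

Lemma nrmL2D f g : f \in L2 -> g \in L2 ->
  nrmL2 (fun x => f x + g x) <= nrmL2 f + nrmL2 g.
Proof.
move=> f2 g2; rewrite -lee_fin EFinD -!Lnorm2E//; last exact: L2D.
by apply: minkowski_EFin; rewrite ?ler1n//; exact: L2_measurable.
Qed.

Lemma nrmL2Z k f : f \in L2 -> nrmL2 (fun x => k * f x) = `|k| * nrmL2 f.
Proof.
move=> f2; rewrite /nrmL2 dotL2Zl ?L2Z// dotL2Zr// mulrA -expr2.
by rewrite sqrtrM ?sqr_ge0// sqrtr_sqr.
Qed.

Lemma nrmL2B f g : f \in L2 -> g \in L2 ->
  nrmL2 (fun x => f x - g x) <= nrmL2 f + nrmL2 g.
Proof.
move=> f2 g2; have := nrmL2D f2 (L2Z (-1) g2).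
rewrite nrmL2Z// normrN1 mul1r; under eq_fun do rewrite mulN1r.
by [].
Qed.

Lemma nrmL2_bounded M c f : measurable_fun setT c -> (forall x, `|c x| <= M) ->
  f \in L2 -> nrmL2 (fun x => c x * f x) <= M * nrmL2 f.
Proof.
move=> mc cM f2; have M0 : 0 <= M by rewrite (le_trans _ (cM point)).
rewrite -[X in X * _](ger0_norm M0) -nrmL2Z// ler_wsqrtr// !dotL2_sqr.
apply: ler_Rintegral.
- exact: (L2_sqr (L2M_bounded mc cM f2)).
- exact: (L2_sqr (L2Z M f2)).
- move=> x; rewrite !exprMn ler_wpM2r ?sqr_ge0//.
  by rewrite -[c x ^+ 2]ger0_norm ?sqr_ge0// normrX lerXn2r ?nnegrE.
Qed.

Lemma nrmL2_ae f g : f \in L2 -> measurable_fun setT g ->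
  {ae mu, forall x, f x = g x} -> nrmL2 f = nrmL2 g.
Proof.
move=> f2 mg fg; rewrite /nrmL2 !dotL2_sqr; congr Num.sqrt.
apply: ae_eq_Rintegral; try apply: measurable_funX => //.
  exact: L2_measurable.
by apply: filterS fg => x ->.
Qed.

(** Outside L2 both sides are infinite. This lets membership in L2 be read off from a finite
    norm. *)
Lemma Lnorm2_sqr f : measurable_fun setT f ->
  ('N[mu]_2%:E[EFin \o f] ^+ 2 = \int[mu]_x (f x ^+ 2)%:E)%E.
Proof.
move=> mf; have [f2|f2] := boolP (f \in L2).
  rewrite Lnorm2E// -EFin_expe -Rintegral_EFin ?nrmL2_sqr ?dotL2_sqr//.
  exact: L2_sqr.
have H : (\int[mu]_x (f x ^+ 2)%:E = +oo)%E.
  apply/eqP; rewrite -leye_eq leNgt; apply/negP => h; move/negP: f2; apply.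
  apply/L2P; split=> //; apply/ge0_integP => //.
  - exact: measurable_funX.
  - by move=> x; exact: sqr_ge0.
rewrite H unlock /Lnorm.
under eq_integral do rewrite /= -[X in (`|_| `^ X)%:E]/(2%:R) powR_mulrn// -normrX ger0_norm ?sqr_ge0//.
by rewrite H poweRyr ?invr_eq0// expe2 mulyy.
Qed.

End square_integrable.

(** * Passage to the limit and completeness of L2 *)

Section limit_theorems.
Context d (T : measurableType d) (R : realType).
Variable mu : {measure set T -> \bar R}.
Local Notation L2 := (Lfun mu 2%:E).

(** The form in which estimates are passed to the limit below: integrability of the limit is part of
    the conclusion, so a uniform bound on the integrals suffices. *)
Lemma fatou_le (f_ : nat -> T -> R) (f : T -> R) (r : R) :
  (forall n, integ mu (f_ n)) -> measurable_fun setT f ->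
  (forall n x, 0 <= f_ n x) -> (forall x, 0 <= f x) ->
  {ae mu, forall x, f_ ^~ x @ \oo --> f x} ->
  (forall n, \int[mu]_x f_ n x <= r) ->
  integ mu f /\ \int[mu]_x f x <= r.
Proof.
move=> if_ mf f0_ f0 f_f fr; apply: ge0_integ_le => //.
have mf_ n : measurable_fun setT (EFin \o f_ n).
  by apply/measurable_EFinP; exact: integ_measurable (if_ n).
have -> : (\int[mu]_x (f x)%:E = \int[mu]_x limn_einf (fun n => (f_ n x)%:E))%E.
  apply: ge0_ae_eq_integral => //.
  - exact/measurable_EFinP.
  - rewrite (_ : (fun _ => _) = fun x => (- limn_esup (fun n => (- f_ n x)%:E))%E).
      apply: measurableT_comp => //; apply: measurable_fun_limn_esup => n.
      by apply/measurable_EFinP; apply: measurableT_comp => //; exact: integ_measurable (if_ n).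
    by apply/funext => x.
  - by move=> x _; rewrite lee_fin.
  - move=> x _; rewrite limn_einf_lim; apply: lime_ge; first exact: is_cvg_einfs.
    by apply: nearW => n; apply: le_ereal_inf_tmp => _ [k _ <-]; rewrite lee_fin.
  - apply: filterS f_f => x fx _; apply/esym.
    by apply: (cvg_limn_einf_sup _).1; apply: cvg_EFin => //; exact: nearW.
apply: (le_trans (fatou mu measurableT mf_ _)).
  by move=> n x _; rewrite /= lee_fin.
rewrite limn_einf_lim; apply: lime_le; first exact: is_cvg_einfs.
apply: nearW => n; apply: (@le_trans _ _ (\int[mu]_x (f_ n x)%:E)%E).
  by apply: ereal_inf_lbound; exists n => /=.
by rewrite -Rintegral_EFin// lee_fin.
Qed.

Lemma dct (f_ : nat -> T -> R) (f g : T -> R) :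
  (forall n, measurable_fun setT (f_ n)) -> measurable_fun setT f ->
  {ae mu, forall x, f_ ^~ x @ \oo --> f x} -> integ mu g ->
  (forall n x, `|f_ n x| <= g x) ->
  integ mu f /\ \int[mu]_x f_ n x @[n --> \oo] --> \int[mu]_x f x.
Proof.
move=> mf_ mf f_f ig fg.
have [] := @dominated_convergence _ _ _ mu setT measurableT
  (fun n => EFin \o f_ n) (EFin \o f) (EFin \o g).
- by move=> n; exact/measurable_EFinP.
- exact/measurable_EFinP.
- by apply: filterS f_f => x fx _; apply: cvg_EFin => //; exact: nearW.
- exact: ig.
- by apply: nearW => x n _; rewrite /= lee_fin.
- move=> fi _ h; split=> //.
  move: h; rewrite -[X in _ --> X -> _]fineK; last exact: integ_fin_num.
  by move=> /fine_cvgP[].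
Qed.

(** The measure may be infinite, so the terms need not be integrable, but their squares are: the sum
    of 2^k d_k^2 has integral at most the sum of 2^-k, hence is finite almost everywhere, and it
    controls the sum of |d_k|. *)
Lemma ae_bounded_series (d_ : nat -> T -> R) :
  (forall k, d_ k \in L2) -> (forall k, nrmL2 mu (d_ k) <= 2^-1 ^+ k) ->
  {ae mu, forall x, exists M : R, forall n, \sum_(0 <= k < n) `|d_ k x| <= M}.
Proof.
move=> d2 dk.
have geom (m : nat) : \sum_(0 <= k < m) (2^-1 : R) ^+ k <= 2 - 2 * 2^-1 ^+ m.
  elim: m => [|m IH]; first by rewrite big_geq// expr0; lra.
  by rewrite big_nat_recr//= exprS; move: IH; lra.
pose f n (x : T) := ((2 ^+ n * d_ n x ^+ 2)%R)%:E.
have mf n : measurable_fun setT (f n).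
  apply/measurable_EFinP; apply: measurable_funM => //.
  by apply: measurable_funX; exact: L2_measurable (d2 n).
have f0 n x : (0 <= f n x)%E.
  by rewrite /f lee_fin; apply: mulr_ge0; [exact: exprn_ge0|exact: sqr_ge0].
have intf : (\int[mu]_x (\sum_(n <oo) f n x) <= 2%:E)%E.
  rewrite integral_nneseries//; apply: lime_le.
    by apply: is_cvg_nneseries => n _ _; exact: integral_ge0.
  apply: nearW => n; apply: (@le_trans _ _ (\sum_(0 <= k < n) ((2^-1 : R) ^+ k)%:E)%E).
    apply: lee_sum => k _; rewrite /f -Rintegral_EFin; last exact/integZ/L2_sqr.
    rewrite lee_fin RintegralZl//; last exact: L2_sqr.
    rewrite -dotL2_sqr -nrmL2_sqr.
    have : nrmL2 mu (d_ k) ^+ 2 <= (2^-1 ^+ k) ^+ 2.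
      by rewrite lerXn2r ?nnegrE ?nrmL2_ge0.
    move=> /(ler_wpM2l (exprn_ge0 k (ler0n R 2))) /le_trans; apply.
    by rewrite expr2 mulrA -exprMn divff// expr1n mul1r.
  rewrite sumEFin lee_fin.
  by rewrite (le_trans (geom n))// gerBl mulr_ge0 ?exprn_ge0.
have mS : measurable_fun setT (fun x => \sum_(n <oo) f n x)%E.
  by apply: ge0_emeasurable_sum => // n x _ _; exact: f0.
have intS : mu.-integrable setT (fun x => \sum_(n <oo) f n x)%E.
  apply/integrableP; split=> //.
  under eq_integral => x _ do rewrite gee0_abs ?nneseries_ge0//.
  by rewrite (le_lt_trans intf)// ltry.
have := integrable_ae measurableT intS; apply: filterS => x /(_ I) Sfin.
exists (fine (\sum_(n <oo) f n x)%E + 2) => n.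
have h1 : \sum_(0 <= k < n) (2 ^+ k * d_ k x ^+ 2) <= fine (\sum_(n <oo) f n x)%E.
  rewrite -lee_fin fineK// -sumEFin.
  exact: (@nneseries_lim_ge _ (f^~ x) xpredT 0 n).
have h2 := geom n.
(* AM-GM: [|d| <= 2^k d^2 + 2^-k] *)
have h3 : \sum_(0 <= k < n) `|d_ k x| <=
   \sum_(0 <= k < n) (2 ^+ k * d_ k x ^+ 2) + \sum_(0 <= k < n) (2^-1 : R) ^+ k.
  rewrite -big_split/=; apply: ler_sum => k _.
  set a := 2 ^+ k; have a0 : 0 < a by rewrite /a exprn_gt0.
  rewrite exprVn -/a -[d_ k x ^+ 2]ger0_norm ?sqr_ge0// normrX.
  have y0 := normr_ge0 (d_ k x); set y := `|_| in y0 *.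
  have : 0 <= a^-1 * (a * y - 1) ^+ 2 + y by rewrite addr_ge0// mulr_ge0 ?invr_ge0 ?(ltW a0)// sqr_ge0.
  have -> : a^-1 * (a * y - 1) ^+ 2 + y = a * y ^+ 2 + a^-1 - y; last by lra.
  by field; rewrite gt_eqF.
have : 0 <= (2^-1 : R) ^+ n by apply: exprn_ge0; rewrite invr_ge0.
lra.
Qed.

(** The bound is the exact geometric sum; keeping the subtracted term is what closes the
    induction. *)
Lemma nrmL2_telescope (u : nat -> T -> R) : (forall k, u k \in L2) ->
  (forall k, nrmL2 mu (fun x => u k.+1 x - u k x) <= 2^-1 ^+ k) ->
  forall k m, nrmL2 mu (fun x => u (k + m)%N x - u k x) <=
    2 * 2^-1 ^+ k - 2 * 2^-1 ^+ (k + m).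
Proof.
move=> u2 uk k; elim=> [|m IH].
  rewrite addn0 subrr (_ : (fun x => _) = fun x => 0 * u k x).
    by rewrite nrmL2Z// normr0 mul0r.
  by apply/funext => x; rewrite subrr mul0r.
rewrite (_ : (fun x => _) = (fun x => (u (k + m).+1 x - u (k + m)%N x) + (u (k + m)%N x - u k x))); last first.
  by apply/funext => x; rewrite addnS addrA subrK.
have := nrmL2D (L2B (u2 (k + m).+1) (u2 (k + m)%N)) (L2B (u2 (k + m)%N) (u2 k)).
have := uk (k + m)%N; rewrite addnS exprS; lra.
Qed.

(** Riesz-Fischer for a sequence that is already fast: the increments are summable almost
    everywhere, which gives a pointwise limit, and Fatou's lemma transfers the telescoped bound to
    it. *)
Lemma L2_complete (u : nat -> T -> R) : (forall k, u k \in L2) ->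
  (forall k, nrmL2 mu (fun x => u k.+1 x - u k x) <= 2^-1 ^+ k) ->
  exists2 g, g \in L2 &
    forall k, nrmL2 mu (fun x => g x - u k x) <= 2 * 2^-1 ^+ k.
Proof.
move=> u2 uk.
(* The upper limit is measurable as it stands, with no null set to remove; almost everywhere it is
   the limit. *)
pose g x := fine (limn_esup (fun n => (u n x)%:E)).
have mg : measurable_fun setT g.
  apply: measurableT_comp => //; apply: measurable_fun_limn_esup => n.
  by apply/measurable_EFinP; exact: L2_measurable (u2 n).
have ug : {ae mu, forall x, u ^~ x @ \oo --> g x}.
  have := ae_bounded_series (fun k => L2B (u2 k.+1) (u2 k)) uk.
  apply: filterS => x [M hM].
  have cs : cvgn (series (fun k => u k.+1 x - u k x)).
    apply: normed_cvg; apply: nondecreasing_is_cvgn.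
      by apply: nondecreasing_series => n _ _; exact: normr_ge0.
    by exists M => _ [n _ <-]; exact: hM.
  have cu : cvgn (u ^~ x).
    rewrite (_ : u^~ x = fun n => series (fun k => u k.+1 x - u k x) n + u 0%N x).
      by apply: is_cvgD => //; exact: is_cvg_cst.
    by apply/funext => n; rewrite seriesEnat/= telescope_sumr// subrK.
  have : (fun n => (u n x)%:E) @ \oo --> (limn (u ^~ x))%:E.
    by apply: cvg_EFin => //; exact: nearW.
  by rewrite /g => /cvg_limn_einf_sup[_ ->].
have H k : integ mu (fun x => (g x - u k x) ^+ 2) /\
    \int[mu]_x (g x - u k x) ^+ 2 <= (2 * 2^-1 ^+ k) ^+ 2.
  apply: (@fatou_le (fun n x => (u (k + n)%N x - u k x) ^+ 2)) => //.
  - by move=> n; apply: L2_sqr; exact: L2B.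
  - by apply: measurable_funX; apply: measurable_funB => //; exact: L2_measurable.
  - by move=> n x; exact: sqr_ge0.
  - by move=> x; exact: sqr_ge0.
  - apply: filterS ug => x ux; rewrite [in X in _ --> X]expr2; under eq_fun do rewrite expr2.
    have h : u (k + n)%N x - u k x @[n --> \oo] --> g x - u k x.
      apply: cvgB; last exact: cvg_cst.
      by under eq_fun do rewrite addnC; move: ux; rewrite -(cvg_shiftn k).
    exact: cvgM.
  - move=> n; rewrite -dotL2_sqr -nrmL2_sqr lerXn2r ?nnegrE ?nrmL2_ge0 ?mulr_ge0 ?exprn_ge0//.
    apply: (le_trans (nrmL2_telescope u2 uk k n)).
    by rewrite gerBl mulr_ge0// exprn_ge0.
have g2 : g \in L2.
  rewrite (_ : g = fun x => (g x - u 0%N x) + u 0%N x); last first.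
    by apply/funext => x; rewrite subrK.
  apply: L2D => //; apply/L2P; split; last exact: (H 0%N).1.
  by apply: measurable_funB => //; exact: L2_measurable.
exists g => // k; rewrite -(@ler_pXn2r _ 2)// ?nnegrE ?nrmL2_ge0 ?mulr_ge0 ?exprn_ge0//.
by rewrite nrmL2_sqr dotL2_sqr; exact: (H k).2.
Qed.

End limit_theorems.

(** * Fubini's theorem for real-valued integrals *)

Section product_integrals.
Context d1 d2 (T1 : measurableType d1) (T2 : measurableType d2) (R : realType).
Variable m1 : {sigma_finite_measure set T1 -> \bar R}.
Variable m2 : {sigma_finite_measure set T2 -> \bar R}.

(** Integrability of every slice, and not only of almost every one, makes the inner integral finite
    everywhere, so that it may be taken as a real number. *)
Lemma Rfubini1 (f : T1 * T2 -> R) : integ (m1 \x m2)%E f ->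
  (forall x, integ m2 (fun y => f (x, y))) ->
  integ m1 (fun x => \int[m2]_y f (x, y)) /\
  \int[m1]_x \int[m2]_y f (x, y) = \int[(m1 \x m2)%E]_z f z.
Proof.
move=> If If2.
have E : fubini_F m2 (EFin \o f) = EFin \o (fun x => \int[m2]_y f (x, y)).
  by apply/funext => x; rewrite /fubini_F /= Rintegral_EFin.
have I1 : integ m1 (fun x => \int[m2]_y f (x, y)).
  by rewrite /integ -E; exact: integrable_fubini_F.
split=> //; rewrite /Rintegral -(integral12_prod_meas1 If) -/(fubini_F _ _); congr fine.
by rewrite E.
Qed.

Lemma Rfubini2 (f : T1 * T2 -> R) : integ (m1 \x m2)%E f ->
  (forall y, integ m1 (fun x => f (x, y))) ->
  integ m2 (fun y => \int[m1]_x f (x, y)) /\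
  \int[m2]_y \int[m1]_x f (x, y) = \int[(m1 \x m2)%E]_z f z.
Proof.
move=> If If2.
have E : fubini_G m1 (EFin \o f) = EFin \o (fun y => \int[m1]_x f (x, y)).
  by apply/funext => y; rewrite /fubini_G /= Rintegral_EFin.
have I1 : integ m2 (fun y => \int[m1]_x f (x, y)).
  apply/integrableP; split; first by rewrite -E; exact: (@measurable_fubini_G _ _ _ _ _ m1 m2 _ If).
  have := (integrable21ltyP m1 m2 (measurable_int _ If)).1 If; apply: le_lt_trans.
  apply: ge0_le_integral => //.
  - by apply: measurableT_comp => //; rewrite -E; exact: (@measurable_fubini_G _ _ _ _ _ m1 m2 _ If).
  - apply: (@measurable_fun_fubini_tonelli_G _ _ _ _ _ m1 (abse \o (EFin \o f))) => //; last by move=> x; exact: abse_ge0.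
    by apply: measurableT_comp => //; exact: measurable_int If.
  - move=> y _; rewrite -E /fubini_G; apply: le_abse_integral => //.
    by apply/measurable_EFinP; exact: integ_measurable (If2 y).
split=> //; rewrite /Rintegral -(integral21_prod_meas1 If) -/(fubini_G _ _); congr fine.
by rewrite E.
Qed.

Lemma integ_tensor (f : T1 -> R) (g : T2 -> R) : integ m1 f -> integ m2 g ->
  integ (m1 \x m2)%E (fun z => f z.1 * g z.2) /\
  \int[(m1 \x m2)%E]_z (f z.1 * g z.2) = (\int[m1]_x f x) * (\int[m2]_y g y).
Proof.
move=> If Ig.
have mfg : measurable_fun setT (fun z : T1 * T2 => f z.1 * g z.2).
  apply: measurable_funM.
  - by apply: (measurableT_comp (integ_measurable If)).
  - by apply: (measurableT_comp (integ_measurable Ig)).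
have Ifg : integ (m1 \x m2)%E (fun z => f z.1 * g z.2).
  apply/integrable12ltyP; first exact/measurable_EFinP.
  rewrite /fubini_F /=.
  under eq_integral do under eq_integral do rewrite /= normrM EFinM.
  under eq_integral => x _.
    rewrite (ge0_integralZl_EFin m2) ?normr_ge0//; last first.
    - by apply/measurable_EFinP; apply: measurableT_comp => //; exact: integ_measurable Ig.
    over.
  rewrite ge0_integralZr//; last exact: integral_ge0.
    rewrite lte_mul_pinfty//; first exact: integral_ge0.
      by have /integrableP[_] := integ_abs If; rewrite ge0_fin_numE ?integral_ge0//; under eq_integral do rewrite /= normr_id.
    by have /integrableP[_] := Ig.
  by apply/measurable_EFinP; apply: measurableT_comp => //; exact: integ_measurable If.
split=> //; rewrite -(Rfubini1 Ifg _).2 /=; last by move=> x; exact: integZ.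
under eq_Rintegral do rewrite RintegralZl//.
by rewrite RintegralZr.
Qed.

End product_integrals.

(** * Integrals of product functions over R^n *)

Section rV_integrals.
Context (R : realType).
Local Notation lam := (@lebesgue_measure R).

(** [lebesgue_rV] is built as an image measure under [cons_rV], so this is a change of variables; it
    provides the induction step on the dimension. *)
Lemma Rintegral_rVS n (f : 'rV[R]_n.+1 -> R) : measurable_fun setT f ->
  integ (lam \x lebesgue_rV R n)%E (f \o @cons_rV R n) ->
  integ (lebesgue_rV R n.+1) f /\
  \int[lebesgue_rV R n.+1]_x f x = \int[(lam \x lebesgue_rV R n)%E]_z f (cons_rV z).
Proof.
move=> mf If; split.
  by apply: integrable_pushforward => //; [exact: measurable_cons_rV|exact/measurable_EFinP].
rewrite /Rintegral; congr fine.
have mEf : measurable_fun setT (EFin \o f) by exact/measurable_EFinP.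
have mphi : measurable_fun setT (@cons_rV R n : measurableTypeR R * 'rV[R]_n -> 'rV[R]_n.+1).
  exact: measurable_cons_rV.
have H := integral_pushforward mphi mEf If measurableT.
rewrite preimage_setT in H.
exact: H.
Qed.

Lemma measurable_coord n (i : 'I_n) : measurable_fun setT (fun x : 'rV[R]_n => x ord0 i).
Proof. exact: (@measurable_coord_rV R n i). Qed.

Lemma measurable_dotp2 n : measurable_fun setT
  (fun z : 'rV[R]_n * 'rV[R]_n => dotp z.1 z.2).
Proof.
rewrite /dotp; apply: measurable_sum => i; apply: measurable_funM.
- exact: (measurableT_comp (measurable_coord i) measurable_fst).
- exact: (measurableT_comp (measurable_coord i) measurable_snd).
Qed.

Lemma measurable_dotp n (y : 'rV[R]_n) : measurable_fun setT (fun x : 'rV[R]_n => dotp x y).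
Proof.
rewrite /dotp; apply: measurable_sum => i; apply: measurable_funM => //.
exact: measurable_coord.
Qed.

Lemma measurable_normsq n : measurable_fun setT (fun x : 'rV[R]_n => dotp x x).
Proof.
by rewrite /dotp; apply: measurable_sum => i; apply: measurable_funM; exact: measurable_coord.
Qed.

Lemma measurable_cosT : measurable_fun setT (@cos R).
Proof. by apply: continuous_measurable_fun; exact: continuous_cos. Qed.

Lemma measurable_sinT : measurable_fun setT (@sin R).
Proof. by apply: continuous_measurable_fun; exact: continuous_sin. Qed.

Lemma dotp_cons n (a : R) (x : 'rV[R]_n) (xi : 'rV[R]_n.+1) :
  dotp (cons_rV (a, x)) xi = a * xi ord0 ord0 + dotp x (\row_j xi ord0 (lift ord0 j)).
Proof.
rewrite /dotp big_ord_recl mxE unlift_none /=; congr (_ + _).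
by apply: eq_bigr => i _; rewrite !mxE liftK.
Qed.

Lemma measurable_prod_coord n (g : 'I_n -> R -> R) :
  (forall i, measurable_fun setT (g i)) ->
  measurable_fun setT (fun x : 'rV[R]_n => \prod_i g i (x ord0 i)).
Proof.
move=> mg; apply: measurable_prod => i _.
exact: (measurableT_comp (mg i) (measurable_coord i)).
Qed.

Lemma integ_cos d (T : measurableType d) (mu : {measure set T -> \bar R}) (f t : T -> R) :
  integ mu f -> measurable_fun setT t -> integ mu (fun x => f x * cos (t x)).
Proof.
move=> If mt; under eq_fun do rewrite mulrC; apply: (@integM_bounded _ _ _ _ 1) => //.
- exact: (measurableT_comp measurable_cosT).
- by move=> x; rewrite ler_norml cos_geN1 cos_le1.
Qed.

Lemma integ_sin d (T : measurableType d) (mu : {measure set T -> \bar R}) (f t : T -> R) :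
  integ mu f -> measurable_fun setT t -> integ mu (fun x => f x * sin (t x)).
Proof.
move=> If mt; under eq_fun do rewrite mulrC; apply: (@integM_bounded _ _ _ _ 1) => //.
- exact: (measurableT_comp measurable_sinT).
- by move=> x; rewrite ler_norml sin_geN1 sin_le1.
Qed.

(** These are the real and imaginary parts of the product of the A_i exp(i t_i). With each
    one-dimensional transform given by an amplitude and a phase, amplitudes multiply and phases add,
    and the addition formulas for cos and sin carry out the induction without complex numbers. *)
Lemma fourier_tensor n (g : 'I_n -> R -> R) (xi : 'rV[R]_n) (A t : 'I_n -> R) :
  (forall i, integ lam (g i)) ->
  (forall i, \int[lam]_a (g i a * cos (a * xi ord0 i)) = A i * cos (t i)) ->
  (forall i, \int[lam]_a (g i a * sin (a * xi ord0 i)) = A i * sin (t i)) ->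
  [/\ integ (lebesgue_rV R n) (fun x => \prod_i g i (x ord0 i)),
   \int[lebesgue_rV R n]_x ((\prod_i g i (x ord0 i)) * cos (dotp x xi)) =
     (\prod_i A i) * cos (\sum_i t i) &
   \int[lebesgue_rV R n]_x ((\prod_i g i (x ord0 i)) * sin (dotp x xi)) =
     (\prod_i A i) * sin (\sum_i t i)].
Proof.
elim: n g xi A t => [|n IH] g xi A t Ig Hc Hs.
  (* R^0 is a single point of mass 1, so integrals there are evaluations. *)
  have D f : measurable_fun setT f -> \int[lebesgue_rV R 0]_x f x = f 0.
    move=> mf; rewrite /Rintegral /= integral_dirac//; last exact/measurable_EFinP.
    by rewrite diracT mul1e.
  have dotp0 (x : 'rV[R]_0) : dotp x xi = 0 by rewrite /dotp big_ord0.
  have P0 : (fun x : 'rV[R]_0 => \prod_i g i (x ord0 i)) = fun=> 1.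
    by apply/funext => x; rewrite big_ord0.
  split.
  - rewrite P0; apply/integrableP; split; first exact/measurable_EFinP.
    by rewrite /= integral_dirac// diracT mul1e normr1 ltry.
  - rewrite (_ : (fun x => _) = fun=> 1) ?D ?big_ord0 ?cos0 ?mulr1//.
    by apply/funext => x; rewrite big_ord0 dotp0 cos0 mulr1.
  - rewrite (_ : (fun x => _) = fun=> 0) ?D ?big_ord0 ?sin0 ?mulr0//.
    by apply/funext => x; rewrite big_ord0 dotp0 sin0 mulr0.
pose g' i := g (lift ord0 i); pose xi' := \row_j xi ord0 (lift ord0 j).
have [I' C' S'] := IH g' xi' (A \o lift ord0) (t \o lift ord0)
  (fun i => Ig _) ltac:(by move=> i; rewrite mxE Hc) ltac:(by move=> i; rewrite mxE Hs).
have prodE z : \prod_i g i (cons_rV z ord0 i) = g ord0 z.1 * \prod_i g' i (z.2 ord0 i).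
  rewrite big_ord_recl mxE unlift_none /=; congr (_ * _).
  by apply: eq_bigr => i _; rewrite !mxE liftK.
have mP : measurable_fun setT (fun x : 'rV[R]_n.+1 => \prod_i g i (x ord0 i)).
  by apply: measurable_prod_coord => i; exact: integ_measurable (Ig i).
have mt x0 : measurable_fun setT (fun a : R => a * x0) by exact: measurable_funM.
have Ic0 := integ_cos (Ig ord0) (mt (xi ord0 ord0)).
have Is0 := integ_sin (Ig ord0) (mt (xi ord0 ord0)).
have Ic' := integ_cos I' (measurable_dotp xi').
have Is' := integ_sin I' (measurable_dotp xi').
have [CC1 CC2] := integ_tensor Ic0 Ic'.
have [SS1 SS2] := integ_tensor Is0 Is'.
have [CS1 CS2] := integ_tensor Ic0 Is'.
have [SC1 SC2] := integ_tensor Is0 Ic'.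
have I : integ (lebesgue_rV R n.+1) (fun x => \prod_i g i (x ord0 i)).
  apply: (Rintegral_rVS mP _).1; rewrite /comp; under eq_fun do rewrite prodE.
  by have [] := integ_tensor (Ig ord0) I'.
split=> //.
- have E : (fun z => (\prod_i g i (cons_rV z ord0 i)) * cos (dotp (cons_rV z) xi)) =
    fun z => (g ord0 z.1 * cos (z.1 * xi ord0 ord0)) * ((\prod_i g' i (z.2 ord0 i)) * cos (dotp z.2 xi')) -
      (g ord0 z.1 * sin (z.1 * xi ord0 ord0)) * ((\prod_i g' i (z.2 ord0 i)) * sin (dotp z.2 xi')).
    by apply/funext => -[a x]; rewrite prodE dotp_cons cosD /=; ring.
  rewrite (Rintegral_rVS _ _).2.
  + rewrite E RintegralB// CC2 SS2 Hc Hs C' S' !big_ord_recl cosD /=; ring.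
  + by apply: integ_measurable; exact: integ_cos I (measurable_dotp xi).
  + by rewrite /comp E; exact: integB.
- have E : (fun z => (\prod_i g i (cons_rV z ord0 i)) * sin (dotp (cons_rV z) xi)) =
    fun z => (g ord0 z.1 * sin (z.1 * xi ord0 ord0)) * ((\prod_i g' i (z.2 ord0 i)) * cos (dotp z.2 xi')) +
      (g ord0 z.1 * cos (z.1 * xi ord0 ord0)) * ((\prod_i g' i (z.2 ord0 i)) * sin (dotp z.2 xi')).
    by apply/funext => -[a x]; rewrite prodE dotp_cons sinD /=; ring.
  rewrite (Rintegral_rVS _ _).2.
  + rewrite E RintegralD// SC2 CS2 Hc Hs C' S' !big_ord_recl sinD /=; ring.
  + by apply: integ_measurable; exact: integ_sin I (measurable_dotp xi).
  + by rewrite /comp E; exact: integD.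
Qed.

Lemma Rintegral_tensor n (g : 'I_n -> R -> R) : (forall i, integ lam (g i)) ->
  integ (lebesgue_rV R n) (fun x => \prod_i g i (x ord0 i)) /\
  \int[lebesgue_rV R n]_x (\prod_i g i (x ord0 i)) = \prod_i \int[lam]_a g i a.
Proof.
move=> Ig.
(* At frequency 0, with all phases 0, the cosine formula is the product formula for integrals. *)
have [] := @fourier_tensor n g 0 (fun i => \int[lam]_a g i a) (fun=> 0) Ig.
- by move=> i; under eq_Rintegral do rewrite mxE mulr0 cos0 mulr1; rewrite cos0 mulr1.
- by move=> i; under eq_Rintegral do rewrite mxE mulr0 sin0 mulr0; rewrite sin0 mulr0 /Rintegral integral0.
- move=> I0 + _; rewrite sumr_const mul0rn cos0 mulr1 => <-; split=> //.
  apply: eq_Rintegral => x _; rewrite (_ : dotp x 0 = 0) ?cos0 ?mulr1//.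
  by rewrite /dotp big1// => i _; rewrite mxE mulr0.
Qed.

End rV_integrals.

(** * Approximate identities on the line *)

Section one_dim.
Context (R : realType).
Local Notation lam := (@lebesgue_measure R).
Implicit Types (f F : R -> R) (e t : R).

Lemma is_derive_congr F (x a b : R) : is_derive x (1 : R) F a -> a = b ->
  is_derive x (1 : R) F b.
Proof. by move=> h <-. Qed.

Lemma is_derive_compM (f : R -> R) (c x a : R) : is_derive (c * x) (1 : R) f a ->
  is_derive x (1 : R) (fun y => f (c * y)) (c * a).
Proof.
move=> df; have dM : is_derive x (1 : R) (fun y : R => c * y) c.
  by apply: is_derive_eq; rewrite /GRing.scale/= mulr1.
by apply: (is_derive_congr (@is_derive1_comp R f (fun y => c * y) x _ _ df dM)); rewrite mulrC.
Qed.

Lemma is_derive_expRM (c x : R) : is_derive x 1 (fun y => expR (c * y)) (c * expR (c * x)).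
Proof. exact: is_derive_compM. Qed.

Lemma is_derive_sinM (c x : R) : is_derive x 1 (fun y => sin (c * y)) (c * cos (c * x)).
Proof. exact: is_derive_compM. Qed.

Lemma is_derive_cosM (c x : R) : is_derive x 1 (fun y => cos (c * y)) (- (c * sin (c * x))).
Proof. by rewrite -mulrN; apply: is_derive_compM. Qed.

Lemma is_derive_continuous F f : (forall x : R, is_derive x (1 : R) F (f x)) -> continuous F.
Proof.
by move=> dF x; apply/differentiable_continuous/derivable1_diffP; by case: (dF x).
Qed.

Lemma FTC_itv f F (a b : R) : a < b -> continuous f ->
  (forall x : R, is_derive x (1 : R) F (f x)) ->
  (\int[lam]_(x in `[a, b]) (f x)%:E = (F b - F a)%:E)%E.
Proof.
move=> ab cf dF; have cF := is_derive_continuous dF.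
rewrite EFinB; apply: continuous_FTC2 => //.
- exact: continuous_subspaceT.
- split; [by move=> x _; by case: (dF x)| |].
  + by apply: cvg_at_right_filter; exact: cF.
  + by apply: cvg_at_left_filter; exact: cF.
- by move=> x _; rewrite derive1E derive_val.
Qed.

Lemma FTC_line f F (l : R) : (forall x, 0 <= f x) -> continuous f ->
  (forall x : R, is_derive x (1 : R) F (f x)) ->
  F n%:R - F (- n%:R) @[n --> \oo] --> l ->
  integ lam f /\ \int[lam]_x f x = l.
Proof.
move=> f0 cf dF Fl.
have mf : measurable_fun setT f by exact: continuous_measurable_fun.
(* Taking [n.+1] keeps the interval nondegenerate for n = 0, as [FTC_itv] requires. *)
pose D (n : nat) : set (measurableTypeR R) := `[- n.+1%:R, n.+1%:R]%classic.
have UD : \bigcup_n D n = setT.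
  apply/seteqP; split=> // x _; exists (Num.truncn `|x|) => //=.
  rewrite /D/= in_itv/= -ler_norml; apply/ltW.
  exact: truncnS_gt.
have E : (\int[lam]_x (f x)%:E = l%:E)%E.
  rewrite -UD; transitivity (limn (fun i => (\int[lam]_(x in D i) (EFin \o f) x)%E)).
    apply/esym/cvg_lim => //; apply: ge0_nondecreasing_set_cvg_integral.
    - move=> m n mn; apply/subsetPset => x; rewrite /D/= !in_itv/= => /andP[h1 h2].
      have h : (m.+1%:R : R) <= n.+1%:R by rewrite ler_nat.
      by rewrite (le_trans _ h1) ?lerN2// (le_trans h2).
    - by move=> n; exact: measurable_itv.
    - by move=> n; apply/measurable_EFinP; exact: measurable_funTS.
    - by move=> n x _; rewrite lee_fin.
  apply/cvg_lim => //.
  have -> : (fun i => (\int[lam]_(x in D i) (EFin \o f) x)%E) =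
      fun i => (F i.+1%:R - F (- i.+1%:R))%:E.
    by apply/funext => n; rewrite /D (FTC_itv _ cf dF)// gtrN.
  apply: cvg_EFin; first exact: nearW.
  by move: Fl; rewrite -(cvg_shiftS (fun n => F n%:R - F (- n%:R))).
have [If _] := @ge0_integ_le _ _ _ lam f l mf f0 ltac:(by rewrite E).
split=> //; apply: EFin_inj; by rewrite Rintegral_EFin.
Qed.

(** The image of Lebesgue measure under the reflection gives ]a, b] the length of [c - b, c - a[,
    and agreement on such intervals determines the measure. *)
Lemma integ_reflect (f : R -> R) (c : R) : integ lam f ->
  integ lam (fun x : R => f (c - x)) /\ \int[lam]_x f (c - (x : R)) = \int[lam]_x f x.
Proof.
move=> If; have mf := integ_measurable If.
have mN : measurable_fun setT ((fun x : R => c - x) : measurableTypeR R -> measurableTypeR R).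
  by apply: measurable_funB.
have mfN : measurable_fun setT (fun x : R => f (c - x)) by exact: (measurableT_comp mf mN).
have LE (A : set R) : measurable A ->
    pushforward lam ((fun x : R => c - x) : measurableTypeR R -> measurableTypeR R) A = lam A.
  move=> mA; apply/esym/lebesgue_measure_unique => //= _ [[a b]] _ <-.
  rewrite /pushforward.
  have -> : (fun x : R => c - x) @^-1` `]a, b]%classic = `[c - b, c - a[%classic.
    by apply/seteqP; split=> x /=; rewrite !in_itv/= => /andP[h1 h2]; apply/andP; split; lra.
  rewrite !lebesgue_measure_itv/= !lte_fin ltrD2l ltrN2.
  by case: ifP => // _; rewrite -!EFinB; congr EFin; ring.
have E (g : R -> \bar R) : measurable_fun setT g -> (forall x, 0 <= g x)%E ->
    (\int[lam]_x g (c - (x : R))%R = \int[lam]_x g x)%E.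
  move=> mg g0; have h := @ge0_integral_pushforward _ _ _ _ R _ mN lam setT g measurableT
    ltac:(exact: measurable_funS mg) ltac:(by move=> x _; exact: g0).
  rewrite preimage_setT in h; rewrite -[LHS]h.
  by apply: eq_measure_integral => //= A mA AS; exact: LE.
have IfN : integ lam (fun x : R => f (c - x)).
  apply/integrableP; split; first exact/measurable_EFinP.
  move/integrableP : If => [_]; rewrite -(E (fun x => `|(f x)%:E|%E))//.
  by apply: measurableT_comp => //; exact/measurable_EFinP.
split=> //.
have mEf : measurable_fun setT (EFin \o f) by exact/measurable_EFinP.
have h := @integral_pushforward _ _ _ _ R _ mN lam setT (EFin \o f) mEf IfN measurableT.
rewrite preimage_setT in h; rewrite /Rintegral; congr fine; rewrite -[LHS]h.
by apply: eq_measure_integral => //= A mA AS; exact: LE.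
Qed.

Lemma integ_opp f : integ lam f ->
  integ lam (fun x : R => f (- x)) /\ \int[lam]_x f (- (x : R)) = \int[lam]_x f x.
Proof.
move=> /(integ_reflect 0)[I <-]; split; last by apply: eq_Rintegral => x _; rewrite sub0r.
by move: I; under eq_fun do rewrite sub0r.
Qed.

(** The factor of Abel summation. Its transform is a multiple of a Cauchy kernel, and both are
    reached by explicit primitives. *)
Definition expabs e (x : R) := expR (- (e * `|x|)).

Lemma expabs_gt0 e x : 0 < expabs e x. Proof. exact: expR_gt0. Qed.

Lemma expabs_le1 e x : 0 <= e -> expabs e x <= 1.
Proof. by move=> e0; rewrite /expabs -expR0 ler_expR oppr_le0 mulr_ge0. Qed.

Lemma continuous_expabs e : continuous (expabs e).
Proof.
move=> x; apply: continuous_comp; last exact: continuous_expR.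
apply: cvgN; apply: cvgM; first exact: cvg_cst.
exact: norm_continuous.
Qed.

Lemma cvg_expR_bounded e (b : R -> R) (M : R) : 0 < e -> (forall x, `|b x| <= M) ->
  expR (- e * x) * b x @[x --> +oo] --> 0.
Proof.
move=> e0 bM.
have h : expR (- e * x) * M @[x --> +oo] --> 0 * M.
  apply: cvgM; last exact: cvg_cst.
  under eq_fun do rewrite mulNr; apply: (@cvg_comp _ _ _ (fun x => e * x) (fun x => expR (- x)) _ +oo).
    exact: gt0_cvgMry.
  exact: cvgr_expR.
rewrite mul0r in h.
apply: norm_cvg0; apply: (squeeze_cvgr _ (cvg_cst (0 : R)) h).
apply: nearW => x; rewrite normr_ge0/= normrM ger0_norm ?expR_ge0//.
by rewrite ler_wpM2l ?expR_ge0.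
Qed.

(** Adding 1 to the cosine makes the integrand nonnegative, so that the fundamental theorem on a
    half-line applies without prior knowledge of integrability; the contribution of the 1 is
    subtracted in [integral_expabs]. *)
Lemma integral_expabs_halfline e t : 0 < e ->
  (\int[lam]_(x in `[0%R, +oo[) (expR (- e * x) * (1 + cos (t * x)))%:E =
   (e^-1 + e / (e ^+ 2 + t ^+ 2))%:E)%E.
Proof.
move=> e0; have et0 : e ^+ 2 + t ^+ 2 != 0.
  by rewrite gt_eqF// ltr_pwDl ?sqr_ge0// exprn_gt0.
pose F x := expR (- e * x) * (- e^-1 + (t * sin (t * x) - e * cos (t * x)) / (e ^+ 2 + t ^+ 2)).
have dF (x : R) : is_derive x (1 : R) F (expR (- e * x) * (1 + cos (t * x))).
  have h1 := is_derive_expRM (- e) x.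
  have h2 := is_derive_sinM t x.
  have h3 := is_derive_cosM t x.
  have h4 : is_derive x (1 : R) (fun x : R => - e^-1 + (t * sin (t * x) - e * cos (t * x)) / (e ^+ 2 + t ^+ 2))
    ((t * (t * cos (t * x)) + e * (t * sin (t * x))) / (e ^+ 2 + t ^+ 2)).
    have h5 : is_derive x (1 : R) (fun x : R => t * sin (t * x) - e * cos (t * x)) (t * (t * cos (t * x)) + e * (t * sin (t * x))).
      have h6 := @is_deriveZ _ _ _ _ t x 1 _ h2.
      have h7 := @is_deriveZ _ _ _ _ e x 1 _ h3.
      have := @is_deriveB _ _ _ _ _ x 1 _ _ h6 h7.
      move=> h; apply: (is_derive_congr h).
      by rewrite /GRing.scale/=; ring.
    have h8 := @is_deriveZ _ _ _ _ (e ^+ 2 + t ^+ 2)^-1 x 1 _ h5.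
    have h9 := @is_deriveD _ _ _ _ _ x 1 _ _ (is_derive_cst (- e^-1) x 1) h8.
    rewrite (_ : (fun _ => _) = (cst (- e^-1) + (e ^+ 2 + t ^+ 2)^-1 \*: (fun x => t * sin (t * x) - e * cos (t * x)))).
      by apply: (is_derive_congr h9); rewrite /GRing.scale/= add0r mulrC.
    by apply/funext => y; rewrite /= /GRing.scale/= fctE mulrC.
  have h := is_deriveM h1 h4.
  apply: (is_derive_congr h).
  by rewrite /GRing.scale/=; field; rewrite et0 gt_eqF.
have cF := is_derive_continuous dF.
rewrite (@ge0_continuous_FTC2y R _ F 0 0).
- rewrite sub0e /F -EFinN !mulr0 expR0 sin0 cos0 mul1r; congr EFin.
  by field; rewrite et0 gt_eqF.
- move=> x _; rewrite mulr_ge0 ?expR_ge0//; have := cos_geN1 (t * x); lra.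
- apply: continuous_subspaceT => x; apply: cvgM.
    exact: (is_derive_continuous (is_derive_expRM (- e))).
  apply: cvgD; first exact: cvg_cst.
  exact: (is_derive_continuous (is_derive_cosM t)).
- apply: (@cvg_expR_bounded _ _ (e^-1 + (`|t| + e) / (e ^+ 2 + t ^+ 2))) => // x.
  have d0 : 0 < (e ^+ 2 + t ^+ 2) by rewrite lt0r et0 addr_ge0 ?sqr_ge0.
  rewrite (le_trans (ler_normD _ _))// lerD//.
    by rewrite normrN ger0_norm// invr_ge0 ltW.
  rewrite normrM [`|_^-1|]ger0_norm ?invr_ge0 ?(ltW d0)// ler_wpM2r ?invr_ge0 ?(ltW d0)//.
  rewrite (le_trans (ler_normB _ _))// !normrM (gtr0_norm e0) lerD//.
    by rewrite ler_piMr// ler_norml sin_geN1 sin_le1.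
  by rewrite ler_piMr ?(ltW e0)// ler_norml cos_geN1 cos_le1.
- by move=> x _; by case: (dF x).
- by apply: cvg_at_right_filter; exact: cF.
- by move=> x _; rewrite derive1E derive_val.
Qed.

Lemma integral_expabs e t : 0 < e ->
  [/\ integ lam (expabs e),
   \int[lam]_x (expabs e x * cos (x * t)) = 2 * e / (e ^+ 2 + t ^+ 2) &
   \int[lam]_x (expabs e x * sin (x * t)) = 0].
Proof.
move=> e0.
have H s : integ lam (fun x => expabs e x * (1 + cos (s * x))) /\
    \int[lam]_x (expabs e x * (1 + cos (s * x))) = 2 * (e^-1 + e / (e ^+ 2 + s ^+ 2)).
  have c : continuous (fun x => expabs e x * (1 + cos (s * x))).
    move=> x; apply: cvgM; first exact: continuous_expabs.
    apply: cvgD; first exact: cvg_cst.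
    exact: (is_derive_continuous (is_derive_cosM s)).
  have p x : 0 <= expabs e x * (1 + cos (s * x)).
    by rewrite mulr_ge0 ?(ltW (expabs_gt0 _ _))//; have := cos_geN1 (s * x); lra.
  have E : (\int[lam]_x (expabs e x * (1 + cos (s * x)))%:E = (2 * (e^-1 + e / (e ^+ 2 + s ^+ 2)))%:E)%E.
    rewrite ge0_symfun_integralT//; last first.
      by move=> x; rewrite /= /expabs normrN mulrN cosN.
    rewrite -set_itvcy EFinM.
    rewrite -(integral_expabs_halfline s e0); apply: f_equal.
    apply: eq_integral => x; rewrite inE/= in_itv/= andbT => x0.
    by rewrite /expabs ger0_norm// mulNr.
  have mf : measurable_fun setT (fun x => expabs e x * (1 + cos (s * x))).
    exact: continuous_measurable_fun.
  have [I1 _] := @ge0_integ_le _ _ _ lam _ (2 * (e^-1 + e / (e ^+ 2 + s ^+ 2))) mf p ltac:(by rewrite E).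
  by split=> //; apply: EFin_inj; rewrite Rintegral_EFin.
(* At frequency 0 the integrand is twice [expabs e]. *)
have [I0 E0] := H 0.
have e00 : e != 0 by rewrite gt_eqF.
have I1 : integ lam (expabs e).
  have := integZ (2^-1) I0; congr integ; apply/funext => x.
  by rewrite mul0r cos0; field.
have E1 : \int[lam]_x expabs e x = 2 / e.
  transitivity (\int[lam]_x (2^-1 * (expabs e x * (1 + cos (0 * x))))).
    by apply: eq_Rintegral => x _; rewrite mul0r cos0; field.
  by rewrite RintegralZl// E0; field.
have mt : measurable_fun setT (fun x : R => x * t) by exact: measurable_funM.
split=> //.
- have [Is Es] := H t.
  have -> : \int[lam]_x (expabs e x * cos (x * t)) =
      \int[lam]_x (expabs e x * (1 + cos (t * x)) - expabs e x).
    by apply: eq_Rintegral => x _; rewrite (mulrC t); ring.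
  rewrite RintegralB// Es E1; field.
  by rewrite e00/= gt_eqF// ltr_pwDl ?sqr_ge0// exprn_gt0.
- have Is := integ_sin I1 mt.
  have [_] := integ_opp Is; rewrite /expabs.
  under eq_Rintegral do rewrite normrN mulNr sinN mulrN -mulN1r.
  by rewrite RintegralZl//; lra.
Qed.

(** The Cauchy density of scale e, also the Poisson kernel of the half-plane. *)
Definition cauchyk e (z : R) : R := pi^-1 * (e / (e ^+ 2 + z ^+ 2)).

Lemma cauchyk_ge0 e z : 0 <= e -> 0 <= cauchyk e z.
Proof.
move=> e0; apply: mulr_ge0; first by rewrite invr_ge0 pi_ge0.
by apply: divr_ge0 => //; rewrite addr_ge0 ?sqr_ge0.
Qed.

Lemma is_derive_atan_scaled e (c x : R) : 0 < e ->
  is_derive x (1 : R) (fun y : R => pi^-1 * atan ((y - c) / e)) (cauchyk e (c - x)).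
Proof.
move=> e0.
have h1 : is_derive x 1 (fun y : R => (y - c) / e) e^-1.
  rewrite (_ : (fun y => _) = fun y => e^-1 * (y - c)); last by apply/funext => y; rewrite mulrC.
  by apply: is_derive_eq; rewrite /GRing.scale/= subr0 mulr1.
have h2 : is_derive ((x - c) / e) 1 (@atan R) (1 + ((x - c) / e) ^+ 2)^-1.
  split; first exact: derivable_atan.
  by rewrite -derive1E derive1_atan.
have h3 := @is_derive1_comp R (@atan R) (fun y => (y - c) / e) x _ _ h2 h1.
have h4 := @is_deriveZ _ _ _ _ pi^-1 x 1 _ h3.
apply: (is_derive_congr h4).
rewrite /GRing.scale/= /cauchyk; congr (_ * _).
have p1 : e ^+ 2 + (c - x) ^+ 2 != 0 by rewrite gt_eqF// ltr_pwDl ?sqr_ge0// exprn_gt0.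
by field; rewrite p1 gt_eqF.
Qed.

Lemma continuous_cauchyk e c : 0 < e -> continuous (fun x => cauchyk e (c - x)).
Proof.
move=> e0 x; apply: cvgM; first exact: cvg_cst.
apply: cvgM; first exact: cvg_cst.
apply: cvgV; first by rewrite gt_eqF// ltr_pwDl ?sqr_ge0// exprn_gt0.
apply: cvgD; first exact: cvg_cst.
rewrite expr2; under eq_fun do rewrite expr2.
by apply: cvgM; apply: cvgB; [exact: cvg_cst|exact: cvg_id|exact: cvg_cst|exact: cvg_id].
Qed.

Lemma cvg_atan_scaled_y e c : 0 < e -> atan ((n%:R - c) / e) @[n --> \oo] --> (pi / 2 : R).
Proof.
move=> e0; apply: (@cvg_comp _ _ _ (fun n : nat => (n%:R - c) / e) (@atan R) _ +oo).
  apply/cvgryPge => A; near=> n.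
  rewrite ler_pdivlMr// lerBrDr; near: n; exact: nbhs_infty_ger.
exact: cvgy_atan.
Unshelve. all: by end_near. Qed.

Lemma integral_cauchyk e c : 0 < e ->
  integ lam (fun x => cauchyk e (c - x)) /\ \int[lam]_x cauchyk e (c - x) = 1.
Proof.
move=> e0; apply: (FTC_line _ _ (fun x => is_derive_atan_scaled c x e0)).
- by move=> x; apply: cauchyk_ge0; exact: ltW.
- exact: continuous_cauchyk.
- have h1 := cvg_atan_scaled_y c e0.
  have h2 := cvg_atan_scaled_y (- c) e0.
  rewrite (_ : (fun _ => _) = fun n => pi^-1 * (atan ((n%:R - c) / e) + atan ((n%:R - - c) / e))).
    rewrite [X in _ --> X](_ : _ = pi^-1 * (pi / 2 + pi / 2)); last by rewrite -splitr mulVf// gt_eqF// pi_gt0.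
    by apply: cvgM; [exact: cvg_cst|exact: cvgD].
  apply/funext => n; rewrite -mulrBr (_ : (- n%:R - c) / e = - ((n%:R - - c) / e)) ?atanN ?opprK//.
  by rewrite -mulNr opprD.
Qed.

Lemma cvg_atan_div (e_ : nat -> R) (c : R) : (forall k, 0 < e_ k) ->
  e_ @ \oo --> 0 -> 0 < c -> atan (c / e_ k) @[k --> \oo] --> (pi / 2 : R).
Proof.
move=> e_gt0 e_0 c0; apply: (@cvg_comp _ _ _ (fun k => c / e_ k) (@atan R) _ +oo); last exact: cvgy_atan.
apply/cvgryPge => A; near=> k; rewrite ler_pdivlMr//.
have A1 : 0 < `|A| + 1 by rewrite ltr_wpDl.
have : e_ k <= c / (`|A| + 1).
  by near: k; apply: (cvgr_le 0) => //; rewrite divr_gt0.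
rewrite ler_pdivlMr// mulrDr mulr1 => h; have := e_gt0 k.
have : A * e_ k <= `|A| * e_ k by rewrite ler_wpM2r ?ler_norm// ltW.
by rewrite (mulrC (e_ k)) in h; lra.
Unshelve. all: by end_near. Qed.

Lemma cauchyk_itv e (a b x : R) : 0 < e -> a < b ->
  \int[lam]_(y in `[a, b]) cauchyk e (x - y) =
  pi^-1 * (atan ((b - x) / e) - atan ((a - x) / e)).
Proof.
move=> e0 ab; rewrite /Rintegral.
by rewrite (FTC_itv ab (@continuous_cauchyk e x e0) (fun y => is_derive_atan_scaled x y e0)) /= mulrBr.
Qed.

(** The two arctangents tend to pi/2 or -pi/2 according to the side on which x lies. The endpoints
    are excluded because the limit there is 1/2. *)
Lemma cauchyk_itv_cvg (e_ : nat -> R) (a b x : R) : a < b -> x != a -> x != b ->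
  (forall k, 0 < e_ k) -> e_ @ \oo --> 0 ->
  \int[lam]_(y in `[a, b]) cauchyk (e_ k) (x - y) @[k --> \oo] --> (\1_(`[a, b]%classic) x : R).
Proof.
move=> ab xa xb e_gt0 e_0.
under eq_fun do rewrite cauchyk_itv//.
have P (c : R) : 0 < c -> atan (c / e_ k) @[k --> \oo] --> (pi / 2 : R) by exact: cvg_atan_div.
have N (c : R) : c < 0 -> atan (c / e_ k) @[k --> \oo] --> (- (pi / 2) : R).
  move=> c0; rewrite (_ : (fun k => atan (c / e_ k)) = fun k => - atan (- c / e_ k)); last first.
    by apply/funext => k; rewrite mulNr atanN opprK.
  by apply: cvgN; apply: P; rewrite oppr_gt0.
have pi0 : (pi : R) != 0 by rewrite gt_eqF// pi_gt0.
have C u v (l1 l2 : R) : u k @[k --> \oo] --> l1 -> v k @[k --> \oo] --> l2 ->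
    pi^-1 * (u k - v k) @[k --> \oo] --> pi^-1 * (l1 - l2).
  by move=> h1 h2; apply: cvgM; [exact: cvg_cst|exact: cvgB].
have [xlta|] := ltP x a.
  rewrite indicE memNset/=; last by rewrite in_itv/= leNgt xlta.
  have hb : 0 < b - x by rewrite subr_gt0 (lt_trans xlta).
  have ha : 0 < a - x by rewrite subr_gt0.
  have h := C _ _ _ _ (P _ hb) (P _ ha); rewrite subrr mulr0 in h; exact: h.
rewrite le_eqVlt eq_sym (negbTE xa)/= => altx.
have [bltx|] := ltP b x.
  rewrite indicE memNset/=; last by rewrite in_itv/= [x <= b]leNgt bltx andbF.
  have hb : b - x < 0 by rewrite subr_lt0.
  have ha : a - x < 0 by rewrite subr_lt0 (lt_trans ab).
  have h := C _ _ _ _ (N _ hb) (N _ ha); rewrite subrr mulr0 in h; exact: h.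
rewrite le_eqVlt (negbTE xb)/= => xltb.
rewrite indicE mem_set/=; last by rewrite in_itv/= !ltW.
have hb : 0 < b - x by rewrite subr_gt0.
have ha : a - x < 0 by rewrite subr_lt0.
have h := C _ _ _ _ (P _ hb) (N _ ha); rewrite opprK -splitr mulVf// in h; exact: h.
Qed.

End one_dim.

(** * The Hartley transform *)

Section hartley.
Context (R : realType).
Local Notation lam := (@lebesgue_measure R).

Definition cas (t : R) : R := cos t + sin t.

Lemma cas_bound t : `|cas t| <= 2.
Proof.
rewrite /cas (le_trans (ler_normD _ _))// -[leRHS]/(1 + 1) lerD// ler_norml.
  by rewrite cos_geN1 cos_le1.
by rewrite sin_geN1 sin_le1.
Qed.

Lemma measurable_cas : measurable_fun setT cas.
Proof. by apply: measurable_funD; [exact: measurable_cosT|exact: measurable_sinT]. Qed.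

Lemma cas_mul (s t : R) : cas s * cas t = cos (s - t) + sin (s + t).
Proof. rewrite /cas cosB sinD; ring. Qed.

Lemma dotpC n (x y : 'rV[R]_n) : dotp x y = dotp y x.
Proof. by apply: eq_bigr => i _; rewrite mulrC. Qed.

Lemma dotpDr n (x y z : 'rV[R]_n) : dotp x (y + z) = dotp x y + dotp x z.
Proof. by rewrite /dotp -big_split; apply: eq_bigr => i _; rewrite mxE mulrDr. Qed.

Lemma dotpBr n (x y z : 'rV[R]_n) : dotp x (y - z) = dotp x y - dotp x z.
Proof. by rewrite /dotp -sumrB; apply: eq_bigr => i _; rewrite !mxE mulrBr. Qed.

Variable n : nat.
Local Notation V := 'rV[R]_n.
Local Notation mu := (lebesgue_rV R n).
Local Notation L2 := (Lfun mu 2%:E).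
Implicit Types (f g : V -> R) (x y xi : V) (e : R).

Definition hcst : R := (2 * pi) `^ (- (n%:R / 2)).

Lemma hcst_gt0 : 0 < hcst.
Proof. by rewrite powR_gt0// mulr_gt0// pi_gt0. Qed.

Lemma hcst_sqr : hcst ^+ 2 * (2 * pi) ^+ n = 1.
Proof.
have p0 : (0 : R) < 2 * pi by rewrite mulr_gt0// pi_gt0.
rewrite /hcst -powR_mulrn ?powR_ge0// -powR_mulrn ?ltW// -powRrM -powRD.
  rewrite (_ : _ + _ = 0) ?powRr0//; first by field.
by apply/implyP => _; rewrite gt_eqF.
Qed.

Definition hartley f xi : R := hcst * \int[mu]_x (f x * cas (dotp x xi)).

(** A product over the coordinates, rather than a function of the Euclidean norm: the transform then
    factors into Cauchy kernels in one variable. *)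
Definition wexp e xi : R := \prod_i expabs e (xi ord0 i).

Definition ck e x y : R := \prod_i cauchyk e (x ord0 i - y ord0 i).

Lemma wexp_gt0 e xi : 0 < wexp e xi.
Proof. by apply: prodr_gt0 => i _; exact: expabs_gt0. Qed.

Lemma wexp_le1 e xi : 0 <= e -> wexp e xi <= 1.
Proof.
by move=> e0; apply: prodr_ile1 => i _; rewrite expabs_le1// ltW// expabs_gt0.
Qed.

Lemma integ_wexp e : 0 < e -> integ mu (wexp e).
Proof.
move=> e0; apply: (@Rintegral_tensor R n (fun=> expabs e) _).1 => i.
by have [] := integral_expabs 0 e0.
Qed.

Lemma integ_cas f xi : integ mu f -> integ mu (fun x => f x * cas (dotp x xi)).
Proof.
move=> If; under eq_fun do rewrite mulrC.
apply: (@integM_bounded _ _ _ _ 2) => //.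
- exact: (measurableT_comp measurable_cas (measurable_dotp xi)).
- by move=> x; exact: cas_bound.
Qed.

(** By [cas_mul] the product of kernels is a cosine of x - y plus a sine of x + y. The weight is
    even, so the sine part integrates to 0 and a convolution kernel remains. *)
Lemma integral_wexp_cas e x y : 0 < e ->
  \int[mu]_xi (wexp e xi * (cas (dotp xi x) * cas (dotp xi y))) =
  (2 * pi) ^+ n * ck e x y.
Proof.
move=> e0.
have F z := @fourier_tensor R n (fun=> expabs e) z
  (fun i => 2 * e / (e ^+ 2 + z ord0 i ^+ 2)) (fun=> 0).
have {}F z : \int[mu]_xi (wexp e xi * cos (dotp xi z)) =
    \prod_i (2 * e / (e ^+ 2 + z ord0 i ^+ 2)) /\
    \int[mu]_xi (wexp e xi * sin (dotp xi z)) = 0.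
  have [] := F z.
  - by move=> i; have [] := integral_expabs 0 e0.
  - by move=> i; have [_ -> _] := integral_expabs (z ord0 i) e0; rewrite cos0 mulr1.
  - by move=> i; have [_ _ ->] := integral_expabs (z ord0 i) e0; rewrite sin0 mulr0.
  - move=> _; rewrite sumr_const mul0rn cos0 sin0 mulr0 mulr1 => -> ->; split=> //.
have Iw := integ_wexp e0.
transitivity (\int[mu]_xi (wexp e xi * cos (dotp xi (x - y)) + wexp e xi * sin (dotp xi (x + y)))).
  by apply: eq_Rintegral => xi _; rewrite cas_mul -dotpBr -dotpDr mulrDr.
rewrite RintegralD//; last 2 first.
  exact: (integ_cos Iw (measurable_dotp _)).
  exact: (integ_sin Iw (measurable_dotp _)).
rewrite (F _).1 (F _).2 addr0.
have -> : (2 * pi : R) ^+ n = \prod_(i < n) (2 * pi) by rewrite prodr_const card_ord.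
rewrite -big_split; apply: eq_bigr => i _; rewrite !mxE /cauchyk /=.
have p0 : (pi : R) != 0 by rewrite gt_eqF// pi_gt0.
by rewrite mulrA mulfK// mulrA.
Qed.

Lemma measurable_ck2 e : 0 < e -> measurable_fun setT (fun z : V * V => ck e z.1 z.2).
Proof.
move=> e0; rewrite /ck; apply: measurable_prod => i _.
have m1 : measurable_fun setT (fun z : V * V => z.1 ord0 i - z.2 ord0 i).
  apply: measurable_funB.
  - exact: (measurableT_comp (measurable_coord i) measurable_fst).
  - exact: (measurableT_comp (measurable_coord i) measurable_snd).
have m2 : measurable_fun setT (fun a : R => cauchyk e (0 - a)).
  apply: continuous_measurable_fun; exact: (@continuous_cauchyk R e 0 e0).
rewrite (_ : (fun z => _) = (fun a : R => cauchyk e (0 - a)) \o (fun z : V * V => z.1 ord0 i - z.2 ord0 i)).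
  exact: (measurableT_comp m2 m1).
by apply/funext => z /=; rewrite sub0r /cauchyk sqrrN.
Qed.

Lemma measurable_ck e x : 0 < e -> measurable_fun setT (ck e x).
Proof.
move=> e0; have mx : measurable_fun setT (fun y : V => (x, y)) by exact: measurable_pair1.
exact: (measurableT_comp (measurable_ck2 e0) mx).
Qed.

Lemma ck_ge0 e x y : 0 <= e -> 0 <= ck e x y.
Proof. by move=> e0; apply: prodr_ge0 => i _; exact: cauchyk_ge0. Qed.

Lemma ckC e x y : ck e x y = ck e y x.
Proof. by apply: eq_bigr => i _; rewrite /cauchyk -[x ord0 i - _]opprB sqrrN. Qed.

Lemma ck_bound e x y : 0 < e -> `|ck e x y| <= ((pi * e)^-1) ^+ n.
Proof.
move=> e0; rewrite (ger0_norm (ck_ge0 x y (ltW e0))).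
rewrite -[n in leRHS]card_ord -prodr_const; apply: ler_prod => i _.
rewrite cauchyk_ge0 ?(ltW e0)//= /cauchyk invfM ler_wpM2l ?invr_ge0 ?pi_ge0//.
have e2 : 0 < e ^+ 2 by rewrite exprn_gt0.
have d0 : 0 < e ^+ 2 + (x ord0 i - y ord0 i) ^+ 2 by rewrite ltr_pwDl// sqr_ge0.
rewrite ler_pdivrMr// mulrDr expr2 mulrA mulVf ?gt_eqF// mul1r lerDl.
by rewrite mulr_ge0 ?invr_ge0 ?(ltW e0)// sqr_ge0.
Qed.

Lemma integral_ck e x : 0 < e -> integ mu (ck e x) /\ \int[mu]_y ck e x y = 1.
Proof.
move=> e0; have [I E] := @Rintegral_tensor R n (fun i a => cauchyk e (x ord0 i - a))
  ltac:(by move=> i; exact: (@integral_cauchyk R e (x ord0 i) e0).1).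
split=> //; rewrite E big1// => i _.
exact: (@integral_cauchyk R e (x ord0 i) e0).2.
Qed.

Lemma hartley_prod f g : integ mu f -> integ mu g ->
  integ (mu \x mu)%E (fun z => f z.1 * cas (dotp z.1 z.2) * g z.2).
Proof.
move=> If Ig.
rewrite (_ : (fun z => _) = fun z : V * V => cas (dotp z.1 z.2) * (f z.1 * g z.2)).
  apply: (@integM_bounded _ _ _ _ 2).
  - exact: (measurableT_comp measurable_cas (@measurable_dotp2 R n)).
  - by move=> z; exact: cas_bound.
  - exact: (integ_tensor If Ig).1.
by apply/funext => z; ring.
Qed.

(** Fubini's theorem gives measurability in xi only against an integrable factor in xi. The positive
    weight [wexp 1] serves as that factor and is divided out again. *)
Lemma measurable_hartley f : integ mu f -> measurable_fun setT (hartley f).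
Proof.
move=> If; have [I _] := Rfubini2 (hartley_prod If (integ_wexp ltr01))
  ltac:(by move=> y /=; under eq_fun do rewrite mulrC; exact/integZ/integ_cas).
have m1 := integ_measurable I.
have -> : hartley f = fun xi => hcst * ((\int[mu]_x (f x * cas (dotp x xi) * wexp 1 xi)) * (wexp 1 xi)^-1).
  apply/funext => xi; rewrite /hartley RintegralZr ?mulfK//; first by rewrite gt_eqF// wexp_gt0.
  exact: integ_cas.
apply: measurable_funM => //; apply: measurable_funM => //.
have mw := integ_measurable (integ_wexp (ltr01 : 0 < (1 : R))).
rewrite (_ : (fun xi => _) = fun xi => \prod_i expR (`|xi ord0 i|)); last first.
  apply/funext => xi; rewrite /wexp -prodfV; apply: eq_bigr => i _.
  by rewrite /expabs mul1r expRN invrK.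
apply: (@measurable_prod_coord R n (fun i a => expR `|a|)) => i.
exact: measurableT_comp.
Qed.

(** Fubini's theorem together with the symmetry of the kernel in x and xi. *)
Lemma hartley_mult f g : integ mu f -> integ mu g ->
  \int[mu]_xi (hartley f xi * g xi) = \int[mu]_x (f x * hartley g x).
Proof.
move=> If Ig; have I := hartley_prod If Ig.
have [I1 E1] := Rfubini1 I ltac:(by move=> x /=; under eq_fun do rewrite -mulrA (mulrC (cas _)) dotpC; exact/integZ/integ_cas).
have [I2 E2] := Rfubini2 I ltac:(by move=> y /=; under eq_fun do rewrite mulrC; exact/integZ/integ_cas).
have E : \int[mu]_xi (hcst * (\int[mu]_x (f x * cas (dotp x xi) * g xi))) =
    \int[mu]_x (hcst * (\int[mu]_xi (f x * cas (dotp x xi) * g xi))).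
  by rewrite (RintegralZl _ measurableT I2) (RintegralZl _ measurableT I1) E1 E2.
transitivity (\int[mu]_xi (hcst * (\int[mu]_x (f x * cas (dotp x xi) * g xi)))).
  by apply: eq_Rintegral => xi _; rewrite RintegralZr ?mulrA//; exact: integ_cas.
rewrite E; apply: eq_Rintegral => x _.
rewrite /hartley mulrCA; congr (_ * _); rewrite -(RintegralZl _ measurableT (integ_cas x Ig)).
by apply: eq_Rintegral => xi _; rewrite -mulrA (mulrC (cas _)) dotpC.
Qed.

Lemma hartley_bound f xi : integ mu f ->
  `|hartley f xi| <= 2 * hcst * \int[mu]_x `|f x|.
Proof.
move=> If; rewrite /hartley normrM (gtr0_norm hcst_gt0) -mulrA mulrCA ler_wpM2l//.
  exact/ltW/hcst_gt0.
rewrite (le_trans (le_normr_Rintegral measurableT (integ_cas xi If)))//.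
rewrite -RintegralZl//; last exact: integ_abs.
apply: ler_Rintegral.
- exact/integ_abs/integ_cas.
- exact/integZ/integ_abs.
- by move=> x; rewrite normrM mulrC ler_wpM2r// cas_bound.
Qed.

(* Inserting the factor wexp e turns the double integral into a convolution with a product of
   Cauchy kernels, an approximate identity as e tends to 0. *)
Lemma hartley_reg f g e : 0 < e -> integ mu f -> integ mu g ->
  let G x := \int[mu]_y (g y * ck e x y) in
  [/\ integ mu (fun x => f x * G x),
      integ mu (fun xi => hartley f xi * (hartley g xi * wexp e xi)) &
  \int[mu]_xi (hartley f xi * (hartley g xi * wexp e xi)) = \int[mu]_x (f x * G x)].
Proof.
move=> e0 If Ig G.
have Iw := integ_wexp e0.
have Ih : integ mu (fun xi => hartley g xi * wexp e xi).
  apply: (@integM_bounded _ _ _ _ (2 * hcst * \int[mu]_x `|g x|)) => //.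
    exact: measurable_hartley.
  by move=> xi; exact: hartley_bound.
have GE x : hartley (fun xi => hartley g xi * wexp e xi) x = G x.
  rewrite /hartley; under eq_Rintegral do rewrite -mulrA.
  have Iwc := integ_cas x Iw.
  rewrite hartley_mult// -RintegralZl//; last first.
    under eq_fun do rewrite mulrC.
    apply: (@integM_bounded _ _ _ _ (2 * hcst * \int[mu]_xi `|wexp e xi * cas (dotp xi x)|)) => //.
      exact: measurable_hartley.
    by move=> y; exact: hartley_bound.
  apply: eq_Rintegral => y _; rewrite mulrCA; congr (_ * _).
  rewrite /hartley; under eq_Rintegral do rewrite -mulrA.
  rewrite integral_wexp_cas//.
  by transitivity (hcst ^+ 2 * (2 * pi) ^+ n * ck e x y); [ring|rewrite hcst_sqr mul1r].
have mG : measurable_fun setT G.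
  by rewrite (_ : G = hartley (fun xi => hartley g xi * wexp e xi));
    [exact: measurable_hartley|apply/funext => x; rewrite GE].
split.
- under eq_fun do rewrite mulrC.
  apply: (@integM_bounded _ _ _ _ (2 * hcst * \int[mu]_xi `|hartley g xi * wexp e xi|)) => //.
  by move=> x; rewrite -GE; exact: hartley_bound.
- apply: (@integM_bounded _ _ _ _ (2 * hcst * \int[mu]_x `|f x|)) => //.
    exact: measurable_hartley.
  by move=> xi; exact: hartley_bound.
- by rewrite hartley_mult//; apply: eq_Rintegral => x _; rewrite GE.
Qed.

Lemma cvg_wexp xi : wexp k.+1%:R^-1 xi @[k --> \oo] --> (1 : R).
Proof.
rewrite (_ : (fun k => _) = fun k => expR (- (k.+1%:R^-1 * \sum_i `|xi ord0 i|))); last first.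
  by apply/funext => k; rewrite /wexp /expabs -expR_sum sumrN mulr_sumr.
have h1 : - (k.+1%:R^-1 * \sum_i `|xi ord0 i|) @[k --> \oo] --> - (0 * \sum_i `|xi ord0 i|).
  by apply: cvgN; apply: cvgM; [exact: cvg_harmonic|exact: cvg_cst].
have h2 := cvg_comp _ _ h1 (@continuous_expR R _).
by rewrite mul0r oppr0 expR0 in h2; exact: h2.
Qed.

(** Schur's test: f(x) f(y) is at most (f(x)^2 + f(y)^2) / 2, and the kernel is symmetric with mass
    1 in each variable, so each half contributes half of the integral of f^2. *)
Lemma hartley_reg_le f e : 0 < e -> integ mu f -> f \in L2 ->
  \int[mu]_x (f x * \int[mu]_y (f y * ck e x y)) <= \int[mu]_x (f x ^+ 2).
Proof.
move=> e0 If f2; have I2 := L2_sqr f2.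
have Ick (h : V -> R) x : integ mu h -> integ mu (fun y => h y * ck e x y).
  move=> Ih; under eq_fun do rewrite mulrC.
  apply: (@integM_bounded _ _ _ _ (((pi * e)^-1) ^+ n)) => //.
    exact: measurable_ck.
  by move=> y; exact: ck_bound.
pose K (z : V * V) := f z.2 ^+ 2 * ck e z.1 z.2.
have mK : measurable_fun setT K.
  apply: measurable_funM; last exact: measurable_ck2.
  apply: measurable_funX.
  exact: (measurableT_comp (L2_measurable f2) measurable_snd).
have IK : integ (mu \x mu)%E K.
  apply/integrable21ltyP; first exact/measurable_EFinP.
  have E y : (\int[mu]_x `|(EFin \o K) (x, y)| = (f y ^+ 2)%:E)%E.
    under eq_integral => x _.
      rewrite /= /K /= ger0_norm; last by rewrite mulr_ge0 ?sqr_ge0 ?ck_ge0 ?(ltW e0).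
      rewrite ckC; over.
    rewrite -Rintegral_EFin; last exact/integZ/(integral_ck y e0).1.
    by rewrite RintegralZl ?(integral_ck y e0).2 ?mulr1//; exact: (integral_ck y e0).1.
  under eq_integral do rewrite E.
  by rewrite -Rintegral_EFin// ltry.
have [IK1 EK1] := Rfubini1 IK ltac:(by move=> x; exact: Ick).
have [IK2 EK2] := Rfubini2 IK ltac:(by move=> y /=; rewrite /K /=; apply: integZ; under eq_fun do rewrite ckC; exact: (integral_ck y e0).1).
have EK : \int[mu]_x \int[mu]_y K (x, y) = \int[mu]_x (f x ^+ 2).
  rewrite EK1 -EK2; apply: eq_Rintegral => y _; rewrite /K /=.
  rewrite RintegralZl//; last by under eq_fun do rewrite ckC; exact: (integral_ck y e0).1.
  by under eq_Rintegral do rewrite ckC; rewrite (integral_ck y e0).2 mulr1.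
have [I1 _ _] := hartley_reg e0 If If.
apply: (@le_trans _ _ (\int[mu]_x (2^-1 * f x ^+ 2 + 2^-1 * \int[mu]_y K (x, y)))).
  apply: ler_Rintegral => //.
    by apply: integD; exact: integZ.
  move=> x; rewrite -RintegralZl//; last exact: Ick.
  have Ix := (integral_ck x e0).1.
  rewrite -[f x ^+ 2]mulr1 -[X in f x ^+ 2 * X](integral_ck x e0).2 -RintegralZl// -RintegralZl//; last exact: integZ.
  rewrite -RintegralZl//; last exact: Ick.
  rewrite -RintegralD//; [|by do 2 apply: integZ|by apply: integZ; exact: Ick].
  apply: ler_Rintegral.
  - by apply: integZ; exact: Ick.
  - by apply: integD; [do 2 apply: integZ|apply: integZ; exact: Ick].
  - move=> y; rewrite /K /=; have c0 := ck_ge0 x y (ltW e0).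
    have : 0 <= (f x - f y) ^+ 2 * ck e x y by rewrite mulr_ge0 ?sqr_ge0.
    set c := ck e x y; set u := f x; set v := f y => h.
    rewrite -subr_ge0 (_ : _ - _ = 2^-1 * ((u - v) ^+ 2 * c)); last by field.
    by rewrite mulr_ge0.
rewrite RintegralD//; [|exact: integZ|exact: integZ].
by rewrite (RintegralZl _ measurableT I2) (RintegralZl _ measurableT IK1) EK -mulrDl (_ : 2^-1 + 2^-1 = 1) ?mul1r//; lra.
Qed.

(** [hartley_reg] with g = f bounds the regularized integrals uniformly, and Fatou's lemma removes
    the weight. Equality of the norms has to wait for the inversion formula. *)
Lemma hartley_L2 f : integ mu f -> f \in L2 ->
  hartley f \in L2 /\ nrmL2 mu (hartley f) <= nrmL2 mu f.
Proof.
move=> If f2; have mh := measurable_hartley If.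
have [I le] : integ mu (fun xi => hartley f xi ^+ 2) /\
    \int[mu]_xi (hartley f xi ^+ 2) <= \int[mu]_x (f x ^+ 2).
  apply: (@fatou_le _ _ _ _ (fun k xi => hartley f xi * (hartley f xi * wexp k.+1%:R^-1 xi))).
  - by move=> k; have [] := @hartley_reg f f k.+1%:R^-1 ltac:(by rewrite invr_gt0) If If.
  - exact: measurable_funX.
  - move=> k x; rewrite mulrA -expr2 mulr_ge0 ?sqr_ge0//.
    exact/ltW/wexp_gt0.
  - by move=> x; exact: sqr_ge0.
  - apply: nearW => xi; under eq_fun do rewrite mulrA -expr2.
    have h := cvgM (cvg_cst (hartley f xi ^+ 2)) (@cvg_wexp xi).
    by rewrite mulr1 in h; exact: h.
  - move=> k; have k0 : 0 < (k.+1%:R^-1 : R) by rewrite invr_gt0.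
    have [_ _ ->] := hartley_reg k0 If If.
    exact: hartley_reg_le.
split; first exact/L2P.
by rewrite /nrmL2 ler_wsqrtr// !dotL2_sqr.
Qed.

End hartley.

Lemma Rintegral_indic d (T : measurableType d) (R : realType) (mu : {measure set T -> \bar R})
  (D : set T) (f : T -> R) : \int[mu]_x (\1_D x * f x) = \int[mu]_(x in D) f x.
Proof.
rewrite [RHS]Rintegral_mkcond; apply: eq_Rintegral => x _.
by rewrite patchE indicE; case: ifPn => _; rewrite ?mul1r ?mul0r.
Qed.

Lemma Rintegral0 d (T : measurableType d) (R : realType) (mu : {measure set T -> \bar R}) :
  \int[mu]_x (0 : R) = 0.
Proof. by rewrite /Rintegral integral0. Qed.

Lemma cvg_prodr (R : realType) (I : finType) (u : I -> nat -> R) (l : I -> R) :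
  (forall i, u i @ \oo --> l i) -> \prod_i u i k @[k --> \oo] --> \prod_i l i.
Proof.
move=> ul; elim: (index_enum I) => [|i r IH].
  by under eq_fun do rewrite big_nil; rewrite big_nil; exact: cvg_cst.
by under eq_fun do rewrite big_cons; rewrite big_cons; apply: cvgM; [exact: ul|exact: IH].
Qed.

(** * Plancherel's identity for indicators of boxes *)

Section boxes.
Context (R : realType).
Local Notation lam := (@lebesgue_measure R).

(** The endpoints need not be ordered: empty intervals are allowed, so that products of indicators
    stay in the family. *)
Definition itvi (a b s : R) : R := \1_(`]a, b]%classic) s.

Lemma itvi_ge0 a b s : 0 <= itvi a b s.
Proof. by rewrite /itvi indicE. Qed.

Lemma itvi_le1 a b s : itvi a b s <= 1.
Proof. by rewrite /itvi indicE; case: (_ \in _). Qed.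

Lemma itviM a b c d s : itvi a b s * itvi c d s = itvi (Num.max a c) (Num.min b d) s.
Proof.
rewrite /itvi !indicE -natrM mulnb; congr ((nat_of_bool _)%:R).
apply/andP/idP; rewrite !inE/= !in_itv/=.
  by move=> [/andP[h1 h2] /andP[h3 h4]]; rewrite gt_max h1 h3 le_min h2 h4.
by rewrite gt_max le_min => /andP[/andP[-> ->] /andP[-> ->]].
Qed.

Lemma integ_itvi a b : integ lam (itvi a b).
Proof. by have := @integrable_indic_itv R a b false false. Qed.

Lemma itvi_empty a b s : b <= a -> itvi a b s = 0.
Proof.
move=> ba; rewrite /itvi indicE memNset//= in_itv/= => /andP[h1 h2].
by have := lt_le_trans h1 h2; rewrite ltNge ba.
Qed.

Lemma ae_neq2 (P : R -> Prop) (c d : R) :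
  (forall s, s != c -> s != d -> P s) -> {ae lam, forall s, P s}.
Proof.
move=> h; exists ([set c] `|` [set d]); split.
- by apply: measurableU; exact: measurable_set1.
- by rewrite null_set_setU//; exact: lebesgue_measure_set1.
- move=> s /= hs; apply: contrapT => /not_orP[/eqP sc /eqP sd].
  by apply: hs; exact: h.
Qed.

Lemma cauchyk_itvi0 e (a b s : R) : b <= a ->
  \int[lam]_t (itvi a b t * cauchyk e (s - t)) = 0.
Proof.
move=> ba; rewrite -[RHS](Rintegral0 lam); apply: eq_Rintegral => t _.
by rewrite itvi_empty// mul0r.
Qed.

Lemma cauchyk_itviE e (a b s : R) : 0 < e ->
  \int[lam]_t (itvi a b t * cauchyk e (s - t)) =
  \int[lam]_(t in `[a, b]) cauchyk e (s - t).
Proof.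
move=> e0; rewrite Rintegral_indic Rintegral_itv_obnd_cbnd//.
exact: (integrableS measurableT _ _ (@integral_cauchyk R e s e0).1).
Qed.

Lemma measurable_cauchyk_itvi (e a b : R) : 0 < e ->
  measurable_fun setT (fun s : R => \int[lam]_t (itvi a b t * cauchyk e (s - t))).
Proof.
move=> e0; have [ba|ab] := leP b a.
  by rewrite (_ : (fun s => _) = fun=> 0)//; apply/funext => s; exact: cauchyk_itvi0.
rewrite (_ : (fun s => _) = fun s => pi^-1 * (atan ((b - s) / e) - atan ((a - s) / e))).
  apply: continuous_measurable_fun => s; apply: cvgM; first exact: cvg_cst.
  have C (c : R) : atan ((c - s) / e) @[s --> s] --> atan ((c - s) / e).
    have h1 : (c - x) / e @[x --> s] --> (c - s) / e.
      apply: cvgM; last exact: cvg_cst.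
      by apply: cvgB; [exact: cvg_cst|exact: cvg_id].
    exact: (cvg_comp _ _ h1 (@continuous_atan R _)).
  by apply: cvgB; exact: C.
by apply/funext => s; rewrite cauchyk_itviE// cauchyk_itv.
Qed.

Lemma cauchyk_itvi_cvg (e_ : nat -> R) (a b s : R) : s != a -> s != b ->
  (forall k, 0 < e_ k) -> e_ @ \oo --> 0 ->
  \int[lam]_t (itvi a b t * cauchyk (e_ k) (s - t)) @[k --> \oo] --> itvi a b s.
Proof.
move=> sa sb e_gt0 e_0; have [ba|ab] := leP b a.
  rewrite itvi_empty// (_ : (fun k => _) = fun=> 0); first exact: cvg_cst.
  by apply/funext => k; rewrite cauchyk_itvi0.
rewrite (_ : itvi a b s = \1_(`[a, b]%classic) s).
  by under eq_fun do rewrite cauchyk_itviE//; exact: cauchyk_itv_cvg.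
rewrite /itvi !indicE; congr (nat_of_bool _)%:R.
apply/idP/idP; rewrite !inE/= !in_itv/= => /andP[h1 h2]; rewrite h2 andbT.
  exact: ltW.
by rewrite lt_neqAle h1 eq_sym sa.
Qed.

Lemma cauchyk_itvi_bound e a b s : 0 < e ->
  0 <= \int[lam]_t (itvi a b t * cauchyk e (s - t)) <= 1.
Proof.
move=> e0; have [I E] := @integral_cauchyk R e s e0; apply/andP; split.
  by apply: Rintegral_ge0 => t _; rewrite mulr_ge0 ?itvi_ge0 ?cauchyk_ge0 ?ltW.
rewrite -[leRHS]E; apply: ler_Rintegral => //.
  apply: (@integM_bounded _ _ _ _ 1) => //.
    exact: integ_measurable (integ_itvi a b).
  by move=> t; rewrite ger0_norm ?itvi_ge0 ?itvi_le1.
by move=> t; rewrite ler_piMl ?itvi_le1// cauchyk_ge0 ?ltW.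
Qed.

Variable n : nat.
Local Notation V := 'rV[R]_n.
Local Notation mu := (lebesgue_rV R n).
Local Notation L2 := (Lfun mu 2%:E).

Definition boxi (a b : 'I_n -> R) (x : V) : R := \prod_i itvi (a i) (b i) (x ord0 i).

Lemma boxi_ge0 a b x : 0 <= boxi a b x.
Proof. by apply: prodr_ge0 => i _; exact: itvi_ge0. Qed.

Lemma boxi_le1 a b x : boxi a b x <= 1.
Proof. by apply: prodr_ile1 => i _; rewrite itvi_ge0 itvi_le1. Qed.

Lemma normr_boxi_le1 a b x : `|boxi a b x| <= 1.
Proof. by rewrite ger0_norm ?boxi_ge0 ?boxi_le1. Qed.

Lemma boxiM a b c d x : boxi a b x * boxi c d x =
  boxi (fun i => Num.max (a i) (c i)) (fun i => Num.min (b i) (d i)) x.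
Proof. by rewrite /boxi -big_split; apply: eq_bigr => i _; exact: itviM. Qed.

Lemma boxi_idem a b x : boxi a b x ^+ 2 = boxi a b x.
Proof.
rewrite expr2 boxiM; apply: eq_bigr => i _.
by rewrite maxxx minxx.
Qed.

Lemma integ_boxi a b : integ mu (boxi a b).
Proof. by apply: (@Rintegral_tensor R n (fun i => itvi (a i) (b i)) _).1 => i; exact: integ_itvi. Qed.

Lemma measurable_boxi a b : measurable_fun setT (boxi a b).
Proof. exact: integ_measurable (integ_boxi a b). Qed.

Lemma L2_boxi a b : boxi a b \in L2.
Proof.
apply/L2P; split; first exact: measurable_boxi.
rewrite (_ : (fun x => _) = boxi a b); first exact: integ_boxi.
by apply/funext => x; rewrite boxi_idem.
Qed.

Lemma boxi_indic a b : boxi a b = \1_[set x : V | forall i, a i < x ord0 i <= b i].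
Proof.
apply/funext => x; rewrite indicE; case: (boolP (x \in _)); rewrite ?inE/=.
  move=> h; rewrite /boxi big1// => i _; rewrite /itvi indicE mem_set//=.
  by rewrite in_itv/=.
rewrite notin_setE/= => h.
have [i hi] : exists i, ~~ (a i < x ord0 i <= b i).
  apply: contrapT => hn; apply: (h) => i; apply: contrapT => /negP hi; by apply: hn; exists i.
rewrite /boxi (bigD1 i)//= /itvi indicE memNset ?mul0r//=.
by rewrite in_itv/=; exact/negP.
Qed.

Lemma cvg_boxi (x : V) : boxi (fun=> - k%:R) (fun=> k%:R) x @[k --> \oo] --> (1 : R).
Proof.
apply: cvg_near_cst; near=> k; rewrite boxi_indic indicE mem_set//= => i.
have hk : \sum_i `|x ord0 i| < k%:R by near: k; exact: nbhs_infty_gtr.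
have : `|x ord0 i| < k%:R.
  by rewrite (le_lt_trans _ hk)// (bigD1 i)//= lerDl sumr_ge0.
by rewrite ltr_norml => /andP[-> /ltW ->].
Unshelve. all: by end_near. Qed.

(** With the exponential weight inserted, the left side factors into integrals over the line. As the
    scale tends to 0, dominated convergence applies on both sides: the weight tends to 1, and the
    Cauchy averages of an interval tend to its indicator off the two endpoints. *)
Lemma plancherel_boxi a b c d :
  dotL2 mu (hartley (boxi a b)) (hartley (boxi c d)) = dotL2 mu (boxi a b) (boxi c d).
Proof.
pose e_ (k : nat) : R := k.+1%:R^-1.
have e_gt0 k : 0 < e_ k by rewrite invr_gt0.
have IA := integ_boxi a b; have IB := integ_boxi c d.
have [HA2 _] := hartley_L2 IA (L2_boxi a b).
have [HB2 _] := hartley_L2 IB (L2_boxi c d).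
pose h i k s := \int[lam]_t (itvi (c i) (d i) t * cauchyk (e_ k) (s - t)).
have E k : \int[mu]_xi (hartley (boxi a b) xi * (hartley (boxi c d) xi * wexp (e_ k) xi)) =
   \prod_i \int[lam]_s (itvi (a i) (b i) s * h i k s).
  have [_ _ ->] := hartley_reg (e_gt0 k) IA IB.
  transitivity (\int[mu]_x \prod_i (itvi (a i) (b i) (x ord0 i) * h i k (x ord0 i))).
    apply: eq_Rintegral => x _; rewrite big_split; congr (_ * _).
    rewrite -(@Rintegral_tensor R n (fun i t => itvi (c i) (d i) t * cauchyk (e_ k) (x ord0 i - t)) _).2.
      by apply: eq_Rintegral => y _; rewrite -big_split.
    move=> i; apply: (@integM_bounded _ _ _ _ 1).
    + exact: integ_measurable (integ_itvi _ _).
    + by move=> t; rewrite ger0_norm ?itvi_ge0 ?itvi_le1.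
    + exact: (@integral_cauchyk R (e_ k) (x ord0 i) (e_gt0 k)).1.
  apply: (@Rintegral_tensor R n (fun i s => itvi (a i) (b i) s * h i k s) _).2 => i.
  under eq_fun do rewrite mulrC.
  apply: (@integM_bounded _ _ _ _ 1); last exact: integ_itvi.
  - exact: measurable_cauchyk_itvi.
  - by move=> s; have /andP[h0 h1] := cauchyk_itvi_bound (c i) (d i) s (e_gt0 k); rewrite ger0_norm.
have L1 : \int[mu]_xi (hartley (boxi a b) xi * (hartley (boxi c d) xi * wexp (e_ k) xi))
   @[k --> \oo] --> dotL2 mu (hartley (boxi a b)) (hartley (boxi c d)).
  apply: (@dct _ _ _ _ _ _ (fun xi => `|hartley (boxi a b) xi * hartley (boxi c d) xi|) _ _ _ _ _).2.
  - move=> k; apply: measurable_funM; first exact: L2_measurable HA2.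
    apply: measurable_funM; first exact: L2_measurable HB2.
    exact: integ_measurable (integ_wexp n (e_gt0 k)).
  - by apply: measurable_funM; [exact: L2_measurable HA2|exact: L2_measurable HB2].
  - apply: nearW => xi; under eq_fun do rewrite mulrA.
    have H := cvgM (cvg_cst (hartley (boxi a b) xi * hartley (boxi c d) xi)) (@cvg_wexp R n xi).
    by rewrite mulr1 in H; exact: H.
  - exact/integ_abs/L2M.
  - move=> k xi; rewrite mulrA normrM ler_piMr//.
    by rewrite ger0_norm ?wexp_le1 ?ltW// wexp_gt0.
have L2' : \prod_i \int[lam]_s (itvi (a i) (b i) s * h i k s) @[k --> \oo] -->
    \prod_i \int[lam]_s (itvi (a i) (b i) s * itvi (c i) (d i) s).
  apply: cvg_prodr => i.
  apply: (@dct _ _ R lam (fun k s => itvi (a i) (b i) s * h i k s)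
    (fun s => itvi (a i) (b i) s * itvi (c i) (d i) s) (itvi (a i) (b i)) _ _ _ _ _).2.
  - move=> k; apply: measurable_funM; last exact: measurable_cauchyk_itvi.
    exact: integ_measurable (integ_itvi _ _).
  - by apply: measurable_funM; exact: integ_measurable (integ_itvi _ _).
  - apply: (@ae_neq2 _ (c i) (d i)) => s sc sd.
    apply: cvgM; first exact: cvg_cst.
    by apply: cauchyk_itvi_cvg => //; exact: cvg_harmonic.
  - exact: integ_itvi.
  - move=> k s; have /andP[h0 h1] := cauchyk_itvi_bound (c i) (d i) s (e_gt0 k).
    by rewrite ger0_norm ?mulr_ge0 ?itvi_ge0// ler_piMr// itvi_ge0.
have EAB : dotL2 mu (boxi a b) (boxi c d) = \prod_i \int[lam]_s (itvi (a i) (b i) s * itvi (c i) (d i) s).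
  rewrite -(@Rintegral_tensor R n (fun i s => itvi (a i) (b i) s * itvi (c i) (d i) s) _).2.
    by apply: eq_Rintegral => x _; rewrite -big_split.
  move=> i; under eq_fun do rewrite itviM; exact: integ_itvi.
rewrite EAB; move: L1; under eq_fun do rewrite E; move=> L1.
by rewrite -(cvg_lim (@norm_hausdorff _ _) L2') (cvg_lim (@norm_hausdorff _ _) L1).
Qed.

End boxes.

(** * Extension of the transform to L2 and inversion *)

Section hartley_L2.
Context (R : realType) (n : nat).
Local Notation V := 'rV[R]_n.
Local Notation mu := (lebesgue_rV R n).
Local Notation L2 := (Lfun mu 2%:E).
Local Notation coord_rV := (@coord_rV R n).
Implicit Types (f g h : V -> R).

Definition hbox (a b : 'I_n -> R) : set V := [set x : V | forall i, a i < x ord0 i <= b i].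

Definition hboxes : set (set V) := [set A | exists a b, A = hbox a b].

Lemma hboxI a b c d : hbox a b `&` hbox c d =
  hbox (fun i => Num.max (a i) (c i)) (fun i => Num.min (b i) (d i)).
Proof.
apply/seteqP; split=> x /= => [[h1 h2] i|h].
  by have /andP[? ?] := h1 i; have /andP[? ?] := h2 i; rewrite gt_max le_min; apply/andP; split; apply/andP.
by split=> i; have /andP[] := h i; rewrite gt_max le_min => /andP[h1 h2] /andP[h3 h4];
  apply/andP; split.
Qed.

Lemma measurable_hbox a b : measurable (hbox a b).
Proof.
have -> : hbox a b = (boxi a b) @^-1` [set 1].
  apply/seteqP; split=> x; rewrite /preimage/= boxi_indic indicE.
    by move=> h; rewrite mem_set.
  by case: (boolP (x \in _)) => [|_ /eqP]; [rewrite inE|rewrite eq_sym oner_eq0].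
rewrite -[X in measurable X]setTI.
by apply: (measurable_boxi a b) => //; exact: measurable_set1.
Qed.

Lemma hboxes_generate : @measurable _ V = <<s hboxes >>.
Proof.
apply/seteqP; split; last first.
  apply: smallest_sub; first exact: sigma_algebra_measurable.
  by move=> _ [a [b ->]]; exact: measurable_hbox.
pose T := g_sigma_algebraType hboxes.
have mid : measurable_fun [set: T] (id : T -> V).
  apply: measurable_fun_coord_rV => i.
  apply: (measurability (@RGenOInfty.G R)); first exact: RGenOInfty.measurableE.
  move=> _ [_ [c ->] <-]; rewrite setTI.
  (* A half-space in coordinate i is a countable union of boxes whose lower end in direction i is
     fixed at c. *)
  pose B (k : nat) := hbox (fun j => if j == i then c else - k%:R) (fun=> k%:R).
  have -> : (Defs.coord_rV i \o (id : T -> V)) @^-1` [set` `]c, +oo[] = \bigcup_k B k.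
    apply/seteqP; split=> x /=; rewrite /coord_rV in_itv/= andbT.
      move=> cx; exists (Num.truncn (\sum_j `|x ord0 j|)).+1 => //= j.
      have hk : \sum_j `|x ord0 j| < (Num.truncn (\sum_j `|x ord0 j|)).+1%:R.
        exact: truncnS_gt.
      have : `|x ord0 j| < (Num.truncn (\sum_j `|x ord0 j|)).+1%:R.
        by rewrite (le_lt_trans _ hk)// (bigD1 j)//= lerDl sumr_ge0.
      rewrite ltr_norml => /andP[h1 /ltW ->]; rewrite andbT.
      by case: eqP => [->|].
    by move=> [k _ /(_ i)]; rewrite eqxx => /andP[].
  apply: sigma_algebra_bigcup => k; apply: sub_sigma_algebra.
  by exists (fun j => if j == i then c else - k%:R), (fun=> k%:R).
by move=> A mA; have := mid measurableT A mA; rewrite setTI.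
Qed.

Lemma Rintegral_hbox f a b : \int[mu]_(x in hbox a b) f x = \int[mu]_x (f x * boxi a b x).
Proof.
by rewrite -Rintegral_indic; apply: eq_Rintegral => x _; rewrite boxi_indic mulrC.
Qed.

(** The sets over which f integrates to 0 form a Dynkin class containing the boxes, which are stable
    under intersection. The vanishing total integral puts the whole space in the class and allows
    complements. *)
Lemma integ_box_eq0 f : integ mu f ->
  \int[mu]_x f x = 0 -> (forall a b, \int[mu]_x (f x * boxi a b x) = 0) ->
  {ae mu, forall x, f x = 0}.
Proof.
move=> If f0 fb; have mf := integ_measurable If.
have IS S : measurable S -> mu.-integrable S (EFin \o f).
  by move=> mS; exact: (integrableS measurableT mS (@subsetT _ S) If).
have H S : <<s hboxes >> S -> (\int[mu]_(x in S) (f x)%:E = 0)%E.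
  apply: (@dynkin_induction _ V hboxes (fun S => (\int[mu]_(x in S) (f x)%:E = 0)%E) hboxes_generate).
  - by move=> _ _ [a [b ->]] [c [d ->]]; rewrite hboxI; exists (fun i => Num.max (a i) (c i)), (fun i => Num.min (b i) (d i)).
  - by rewrite -Rintegral_EFin// f0.
  - move=> _ [a [b ->]]; have := fb a b; rewrite -Rintegral_hbox => h.
    rewrite -[LHS]fineK; first by rewrite -/(Rintegral mu (hbox a b) f) h.
    by apply: integrable_fin_num; [exact: measurable_hbox|apply: IS; exact: measurable_hbox].
  - move=> {}S mS S0; have mSc := measurableC mS.
    have Is := IS _ mS; have Ic := IS _ mSc.
    have := Rintegral_setU mS mSc (IS _ (measurableU _ _ mS mSc)).
    rewrite setUv f0 => /(_ _)/esym; rewrite {1}/Rintegral S0/= add0r => h.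
    rewrite -[LHS]fineK; last exact: integrable_fin_num.
    by rewrite -/(Rintegral mu (~` S) f) h//; apply/disj_setPS; rewrite setICr.
  - move=> F mF tF F0; rewrite integral_bigcup//.
    + by rewrite eseries0// => i _ _ ; exact: F0.
    + by apply: IS; exact: bigcup_measurable.
have := @integral_ae_eq _ _ _ mu setT measurableT (cst 0%E) (EFin \o f) If.
move=> /(_ (measurable_cst _)) h.
have : ae_eq mu setT (EFin \o f) (cst 0%E).
  apply: h => E _ mE; rewrite integral0; apply: H; by rewrite -hboxes_generate.
by apply: filterS => x /(_ I) /= h'; apply: EFin_inj; exact: h'.
Qed.

(** A function in L2 need not be integrable, so it is first cut off to a cube. The cutoff preserves
    the hypothesis because the product of two boxes is a box. *)
Lemma L2_box_eq0 f : f \in L2 -> (forall a b, \int[mu]_x (f x * boxi a b x) = 0) ->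
  {ae mu, forall x, f x = 0}.
Proof.
move=> f2 fb.
pose fk k x := f x * boxi (fun=> - k%:R) (fun=> k%:R) x.
have H k : {ae mu, forall x, fk k x = 0}.
  apply: integ_box_eq0.
  - exact: L2M f2 (L2_boxi _ _).
  - exact: fb.
  - move=> a b; rewrite -[RHS](fb (fun i => Num.max (- k%:R) (a i)) (fun i => Num.min (k%:R) (b i))).
    by apply: eq_Rintegral => x _; rewrite /fk -mulrA boxiM.
have := ae_foralln H; apply: filterS => x hx.
have C : f x * boxi (fun=> - k%:R) (fun=> k%:R) x @[k --> \oo] --> f x * 1.
  by apply: cvgM; [exact: cvg_cst|exact: cvg_boxi].
rewrite mulr1 in C.
have C0 : f x * boxi (fun=> - k%:R) (fun=> k%:R) x @[k --> \oo] --> (0 : R).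
  by under eq_fun do rewrite [_ * _]hx; exact: cvg_cst.
by rewrite -(cvg_lim (@norm_hausdorff _ _) C) (cvg_lim (@norm_hausdorff _ _) C0).
Qed.

(** Cutting off to large cubes is enough: a square-integrable function on a cube is integrable. *)
Lemma L2_approx f (e : R) : f \in L2 -> 0 < e ->
  exists g, [/\ integ mu g, g \in L2 & nrmL2 mu (fun x => f x - g x) <= e].
Proof.
move=> f2 e0.
pose b k : V -> R := boxi (fun=> - k%:R) (fun=> k%:R).
pose fk k x := b k x * f x.
have fk2 k : fk k \in L2 by apply: (@L2M_bounded _ _ _ _ 1) => //; [exact: measurable_boxi|move=> x; exact: normr_boxi_le1].
have C : \int[mu]_x ((f x - fk k x) ^+ 2) @[k --> \oo] --> (0 : R).
  rewrite -(Rintegral0 mu); apply: (@dct _ _ _ _ _ _ (fun x => f x ^+ 2) _ _ _ _ _).2 => //.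
  - by move=> k; apply: measurable_funX; apply: measurable_funB; [exact: L2_measurable f2|exact: L2_measurable (fk2 k)].
  - apply: nearW => x.
    have h1 : f x - b k x * f x @[k --> \oo] --> f x - 1 * f x.
      by apply: cvgB; [exact: cvg_cst|apply: cvgM; [exact: cvg_boxi|exact: cvg_cst]].
    have h2 := cvgM h1 h1; rewrite mul1r subrr mulr0 in h2.
    by under eq_fun do rewrite expr2; exact: h2.
  - exact: L2_sqr.
  - move=> k x; rewrite ger0_norm ?sqr_ge0// /fk.
    rewrite (_ : f x - b k x * f x = (1 - b k x) * f x); last by ring.
    rewrite exprMn ler_piMl ?sqr_ge0// exprn_ile1 ?subr_ge0 ?boxi_le1//.
    by rewrite gerBl boxi_ge0.
have [k hk] : exists k, \int[mu]_x ((f x - fk k x) ^+ 2) <= e ^+ 2.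
  have : \forall k \near \oo, \int[mu]_x ((f x - fk k x) ^+ 2) <= e ^+ 2.
    by apply: (cvgr_le 0) => //; rewrite exprn_gt0.
  by move=> [k _ /(_ k (leqnn k))]; exists k.
exists (fk k); split=> //.
  by rewrite /integ /fk; have := L2M (L2_boxi (fun=> - k%:R) (fun=> k%:R)) f2.
rewrite -(@ler_pXn2r _ 2)// ?nnegrE ?nrmL2_ge0 ?(ltW e0)//.
by rewrite nrmL2_sqr dotL2_sqr.
Qed.

Lemma hartleyD f g xi : integ mu f -> integ mu g ->
  hartley (fun x => f x + g x) xi = hartley f xi + hartley g xi.
Proof.
move=> If Ig; rewrite /hartley -mulrDr; congr (_ * _).
under eq_Rintegral do rewrite mulrDl.
by rewrite RintegralD//; exact: integ_cas.
Qed.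

Lemma hartleyB f g xi : integ mu f -> integ mu g ->
  hartley (fun x => f x - g x) xi = hartley f xi - hartley g xi.
Proof.
move=> If Ig; rewrite /hartley -mulrBr; congr (_ * _).
under eq_Rintegral do rewrite mulrBl.
by rewrite RintegralB//; exact: integ_cas.
Qed.

(** The multiplication formula, tested where the transform is a genuine integral, determines g up to
    a null set by [L2_box_eq0]. *)
Definition isHT f g := g \in L2 /\ forall h, integ mu h -> h \in L2 ->
  dotL2 mu g h = dotL2 mu f (hartley h).

Lemma eq0_small (a C : R) : (forall k : nat, `|a| <= C * 2^-1 ^+ k) -> a = 0.
Proof.
move=> h; apply/eqP; rewrite -normr_eq0 eq_le normr_ge0 andbT.
have : C * 2^-1 ^+ k @[k --> \oo] --> C * 0.
  by apply: cvgM; [exact: cvg_cst|apply: cvg_expr; rewrite ger0_norm ?invr_ge0// invf_lt1// ltr1n].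
rewrite mulr0 => C0; rewrite -(cvg_lim (@norm_hausdorff _ _) C0).
by apply: limr_ge; [exact: cvgP C0|exact: nearW].
Qed.

Lemma HT_exists f : f \in L2 -> exists g, isHT f g.
Proof.
move=> f2.
(* The exponent [k.+2] leaves room for two consecutive errors to add up to at most 2^-k, the rate
   asked by [L2_complete]. *)
have e0 (k : nat) : (0 : R) < 2^-1 ^+ k.+2 by rewrite exprn_gt0// invr_gt0.
have /(_ _)/cid F k := L2_approx f2 (e0 k).
pose u k := projT1 (F k).
have [Iu u2 fu] : [/\ forall k, integ mu (u k), forall k, u k \in L2 &
    forall k, nrmL2 mu (fun x => f x - u k x) <= 2^-1 ^+ k.+2].
  by split=> k; have [] := projT2 (F k).
have uu k : nrmL2 mu (fun x => u k.+1 x - u k x) <= 2^-1 ^+ k.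
  have -> : (fun x => u k.+1 x - u k x) = fun x => (f x - u k x) - (f x - u k.+1 x).
    by apply/funext => x; ring.
  apply: (le_trans (nrmL2B (L2B f2 (u2 k)) (L2B f2 (u2 k.+1)))).
  have := fu k; have := fu k.+1; rewrite !exprS.
  have : (0 : R) <= 2^-1 ^+ k by rewrite exprn_ge0// invr_ge0.
  lra.
have [g g2 gk] := @L2_complete _ _ _ mu (fun k => hartley (u k))
  ltac:(by move=> k; have [] := hartley_L2 (Iu k) (u2 k))
  ltac:(move=> k; apply: (le_trans _ (uu k)); rewrite (_ : (fun x => _) = hartley (fun x => u k.+1 x - u k x));
     [have [] := hartley_L2 (integB (Iu k.+1) (Iu k)) (L2B (u2 k.+1) (u2 k)); done|
      by apply/funext => x; rewrite hartleyB]).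
exists g; split=> // h Ih h2.
have [hh2 _] := hartley_L2 Ih h2.
apply/eqP; rewrite -subr_eq0; apply/eqP.
apply: (@eq0_small _ (2 * nrmL2 mu h + nrmL2 mu (hartley h))) => k.
have [Hu2 _] := hartley_L2 (Iu k) (u2 k).
have -> : dotL2 mu g h - dotL2 mu f (hartley h) =
    dotL2 mu (fun x => g x - hartley (u k) x) h - dotL2 mu (fun x => f x - u k x) (hartley h).
  rewrite !dotL2Bl// (_ : dotL2 mu (hartley (u k)) h = dotL2 mu (u k) (hartley h)); first by ring.
  exact: hartley_mult.
rewrite (le_trans (ler_normB _ _))// mulrDl lerD//.
  rewrite (le_trans (cauchy_schwarz (L2B g2 Hu2) h2))//.
  by rewrite mulrAC ler_wpM2r ?nrmL2_ge0.
rewrite (le_trans (cauchy_schwarz (L2B f2 (u2 k)) hh2))// mulrC ler_wpM2l ?nrmL2_ge0//.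
rewrite (le_trans (fu k))// 2!exprS.
have : (0 : R) <= 2^-1 ^+ k by rewrite exprn_ge0// invr_ge0.
lra.
Qed.

(* The extension of hartley to L2, pinned down by duality; it is junk outside L2. *)
Definition HT f : V -> R := xget (fun=> 0) [set g | isHT f g].

Lemma HTP f : f \in L2 -> isHT f (HT f).
Proof. by move=> /HT_exists[g hg]; rewrite /HT; exact: (xgetI _ hg). Qed.

Lemma HT_L2 f : f \in L2 -> HT f \in L2.
Proof. by move=> /HTP[]. Qed.

Lemma HT_spec f h : f \in L2 -> integ mu h -> h \in L2 ->
  dotL2 mu (HT f) h = dotL2 mu f (hartley h).
Proof. by move=> /HTP[_]; apply. Qed.

Lemma HT_uniq f g : f \in L2 -> isHT f g -> {ae mu, forall x, HT f x = g x}.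
Proof.
move=> f2 [g2 fg]; have := @L2_box_eq0 (fun x => HT f x - g x) (L2B (HT_L2 f2) g2).
move=> h; have {h} : {ae mu, forall x, HT f x - g x = 0}.
  apply: h => a b; rewrite -/(dotL2 mu (fun x => HT f x - g x) (boxi a b)).
  rewrite dotL2Bl ?HT_L2 ?L2_boxi// HT_spec ?fg ?subrr//; exact: integ_boxi || exact: L2_boxi.
by apply: filterS => x /eqP; rewrite subr_eq0 => /eqP.
Qed.

Lemma HT_hartley f : integ mu f -> f \in L2 -> {ae mu, forall x, HT f x = hartley f x}.
Proof.
move=> If f2; apply: HT_uniq => //; split; first by have [] := hartley_L2 If f2.
by move=> h Ih h2; exact: hartley_mult.
Qed.

Lemma HT_ae f g : f \in L2 -> g \in L2 -> {ae mu, forall x, f x = g x} ->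
  {ae mu, forall x, HT f x = HT g x}.
Proof.
move=> f2 g2 fg; apply: HT_uniq => //; split; first exact: HT_L2.
move=> h Ih h2; rewrite HT_spec//; apply: ae_eq_Rintegral.
- by apply: measurable_funM; [exact: L2_measurable g2|exact: measurable_hartley].
- by apply: measurable_funM; [exact: L2_measurable f2|exact: measurable_hartley].
- by apply: filterS fg => x ->.
Qed.

Lemma HTD f g : f \in L2 -> g \in L2 ->
  {ae mu, forall x, HT (fun x => f x + g x) x = HT f x + HT g x}.
Proof.
move=> f2 g2; apply: HT_uniq; first exact: L2D.
split; first by apply: L2D; exact: HT_L2.
move=> h Ih h2; have [hh _] := hartley_L2 Ih h2.
by rewrite !dotL2Dl ?HT_L2// !HT_spec.
Qed.

Lemma HTZ k f : f \in L2 -> {ae mu, forall x, HT (fun x => k * f x) x = k * HT f x}.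
Proof.
move=> f2; apply: HT_uniq; first exact: L2Z.
split; first by apply: L2Z; exact: HT_L2.
move=> h Ih h2; have [hh _] := hartley_L2 Ih h2.
by rewrite !dotL2Zl ?HT_L2// !HT_spec.
Qed.

Lemma HTB f g : f \in L2 -> g \in L2 ->
  {ae mu, forall x, HT (fun x => f x - g x) x = HT f x - HT g x}.
Proof.
move=> f2 g2; apply: HT_uniq; first exact: L2B.
split; first by apply: L2B; exact: HT_L2.
move=> h Ih h2; have [hh _] := hartley_L2 Ih h2.
by rewrite !dotL2Bl ?HT_L2// !HT_spec.
Qed.

Lemma le_small (a b C : R) : 0 <= C -> (forall e, 0 < e -> a <= b + C * e) -> a <= b.
Proof.
move=> C0 h; apply/ler_addgt0Pr => e e0.
have C1 : 0 < C + 1 by rewrite ltr_wpDl.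
have := h (e / (C + 1)) (divr_gt0 e0 C1).
have : C * (e / (C + 1)) <= e.
  rewrite mulrA ler_pdivrMr// mulrC ler_wpM2l ?ltW//; lra.
lra.
Qed.

(** As [HT f] is given by duality only, its norm is found by pairing it with an integrable h close
    to [HT f] itself: N^2 is at most N e + M (N + e) for every e > 0, whence N is at most M. *)
Lemma HT_contract f : f \in L2 -> nrmL2 mu (HT f) <= nrmL2 mu f.
Proof.
move=> f2; have H2 := HT_L2 f2.
set N := nrmL2 mu (HT f); set M := nrmL2 mu f.
have N0 : 0 <= N by exact: nrmL2_ge0.
have M0 : 0 <= M by exact: nrmL2_ge0.
have [->//|Nn0] := eqVneq N 0.
have Np : 0 < N by rewrite lt_neqAle eq_sym Nn0.
suff : N * N <= M * N by rewrite ler_pM2r.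
apply: (@le_small _ _ (N + M)); first exact: addr_ge0.
move=> e e0; have [h [Ih h2 he]] := L2_approx H2 e0.
have [hh2 hc] := hartley_L2 Ih h2.
have -> : N * N = dotL2 mu (HT f) (fun x => HT f x - h x) + dotL2 mu f (hartley h).
  by rewrite -expr2 nrmL2_sqr dotL2Br// (HT_spec f2 Ih h2); ring.
have h1 : dotL2 mu (HT f) (fun x => HT f x - h x) <= N * e.
  rewrite (le_trans (ler_norm _))// (le_trans (cauchy_schwarz H2 (L2B H2 h2)))//.
  by rewrite ler_wpM2l.
have hN : nrmL2 mu h <= N + e.
  rewrite (_ : h = fun x => HT f x - (HT f x - h x)).
    by rewrite (le_trans (nrmL2B H2 (L2B H2 h2)))// lerD2l.
  by apply/funext => x; ring.
have h3 : dotL2 mu f (hartley h) <= M * (N + e).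
  rewrite (le_trans (ler_norm _))// (le_trans (cauchy_schwarz f2 hh2))//.
  by rewrite ler_wpM2l// (le_trans hc).
have -> : M * N + (N + M) * e = N * e + M * (N + e) by ring.
exact: lerD.
Qed.

Lemma HT_adjoint f g : f \in L2 -> g \in L2 ->
  dotL2 mu (HT f) g = dotL2 mu f (HT g).
Proof.
move=> f2 g2; have Hf := HT_L2 f2; have Hg := HT_L2 g2.
apply/eqP; rewrite -subr_eq0 -normr_le0.
apply: (@le_small _ _ (2 * nrmL2 mu f)); first by rewrite mulr_ge0 ?nrmL2_ge0.
move=> e e0; have [h [Ih h2 he]] := L2_approx g2 e0.
have [hh2 hc] := hartley_L2 Ih h2.
have -> : dotL2 mu (HT f) g - dotL2 mu f (HT g) =
   dotL2 mu (HT f) (fun x => g x - h x) - dotL2 mu f (fun x => HT g x - hartley h x).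
  by rewrite !dotL2Br// (HT_spec f2 Ih h2); ring.
rewrite add0r (_ : 2 * _ * e = nrmL2 mu f * e + nrmL2 mu f * e); last by ring.
rewrite (le_trans (ler_normB _ _))// lerD//.
  rewrite (le_trans (cauchy_schwarz Hf (L2B g2 h2)))// ler_pM ?nrmL2_ge0//.
  exact: HT_contract.
rewrite (le_trans (cauchy_schwarz f2 (L2B Hg hh2)))// ler_wpM2l ?nrmL2_ge0//.
rewrite (@nrmL2_ae _ _ _ _ _ (HT (fun x => g x - h x))).
- by rewrite (le_trans (HT_contract (L2B g2 h2))).
- exact: L2B.
- exact/L2_measurable/HT_L2/L2B.
- apply: filterS2 (HTB g2 h2) (HT_hartley Ih h2) => x -> ->.
  by [].
Qed.

(** Tested against another box, the claim is [plancherel_boxi] read through the duality defining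
    [HT]. *)
Lemma HT_inv_box a b : {ae mu, forall x, HT (hartley (boxi a b)) x = boxi a b x}.
Proof.
have IA := integ_boxi a b; have A2 := L2_boxi a b.
have [HA2 _] := hartley_L2 IA A2.
have h : {ae mu, forall x, HT (hartley (boxi a b)) x - boxi a b x = 0}.
  apply: L2_box_eq0; first exact: L2B (HT_L2 HA2) A2.
  move=> c d; rewrite -/(dotL2 mu (fun x => HT (hartley (boxi a b)) x - boxi a b x) (boxi c d)).
  rewrite dotL2Bl ?HT_L2 ?L2_boxi// HT_spec ?L2_boxi//; last exact: integ_boxi.
  by rewrite plancherel_boxi subrr.
by apply: filterS h => x /eqP; rewrite subr_eq0 => /eqP.
Qed.

(** Pairing with a box moves both transforms on to the box, where inversion is known. *)
Lemma HT_inv f : f \in L2 -> {ae mu, forall x, HT (HT f) x = f x}.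
Proof.
move=> f2; have H2 := HT_L2 f2; have HH2 := HT_L2 H2.
have h : {ae mu, forall x, HT (HT f) x - f x = 0}.
  apply: L2_box_eq0; first exact: L2B.
  move=> a b; rewrite -/(dotL2 mu (fun x => HT (HT f) x - f x) (boxi a b)).
  have IA := integ_boxi a b; have A2 := L2_boxi a b.
  have [HA2 _] := hartley_L2 IA A2.
  rewrite dotL2Bl// HT_spec// HT_adjoint//.
  apply/eqP; rewrite subr_eq0; apply/eqP; apply: ae_eq_Rintegral.
  - by apply: measurable_funM; [exact: L2_measurable f2|exact/L2_measurable/HT_L2].
  - by apply: measurable_funM; [exact: L2_measurable f2|exact: measurable_boxi].
  - by apply: filterS (HT_inv_box a b) => x ->.
by apply: filterS h => x /eqP; rewrite subr_eq0 => /eqP.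
Qed.

(** A contraction that is its own inverse preserves norms. *)
Lemma HT_isometry f : f \in L2 -> nrmL2 mu (HT f) = nrmL2 mu f.
Proof.
move=> f2; apply/eqP; rewrite eq_le HT_contract//=.
rewrite -(@nrmL2_ae _ _ _ mu (HT (HT f)) f).
- exact/HT_contract/HT_L2.
- by do 2 apply: HT_L2.
- exact: L2_measurable f2.
- exact: HT_inv.
Qed.

End hartley_L2.

(** * Test functions and the weak Laplacian *)

Section smooth_bump.
Context (R : realType).
Local Notation lam := (@lebesgue_measure R).
Implicit Types (S : {poly R}) (k : nat) (u x y r : R).

(* The derivatives of [exp (- 1 / u)], extended by 0 to [u <= 0], are combinations of the gk. *)
Definition gk k u : R := if 0 < u then (u^-1) ^+ k * expR (- u^-1) else 0.

Lemma gk_le0 k u : u <= 0 -> gk k u = 0.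
Proof. by rewrite /gk ltNge => ->. Qed.

Lemma gk_ge0 k u : 0 <= gk k u.
Proof.
by rewrite /gk; case: ifP => // u0; rewrite mulr_ge0 ?expR_ge0// exprn_ge0// invr_ge0 ltW.
Qed.

Lemma gk_gt0 k u : 0 < u -> 0 < gk k u.
Proof. by move=> u0; rewrite /gk u0 mulr_gt0 ?expR_gt0// exprn_gt0// invr_gt0. Qed.

Lemma gkS k u : gk k u = u * gk k.+1 u.
Proof.
rewrite /gk; case: ifP => u0; last by rewrite mulr0.
by rewrite exprS !mulrA divff ?mul1r// gt_eqF.
Qed.

(** With v = 1/u, the exponential of v dominates v^(k+1) / (k+1)!. The linear bound in u is what
    makes the difference quotients at 0 vanish. *)
Lemma gk_bound k u : 0 < u -> gk k u <= (k.+1)`!%:R * u.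
Proof.
move=> u0; rewrite /gk u0 expRN ler_pdivrMr ?expR_gt0//.
have v0 : 0 <= u^-1 by rewrite invr_ge0 ltW.
have := expR_ge1Dxn k v0; set F : R := (k.+1)`!%:R => h.
have F0 : 0 < F by rewrite /F ltr0n fact_gt0.
have : u^-1 ^+ k.+1 <= F * expR u^-1.
  rewrite mulrC -ler_pdivrMr//; apply: le_trans h.
  by rewrite lerDr.
move=> /(ler_wpM2l (ltW u0)); rewrite exprS mulrA divff ?gt_eqF// mul1r.
by move=> /le_trans; apply; rewrite mulrCA mulrA.
Qed.

Lemma is_derive_gk k u : is_derive u (1 : R) (gk k) (gk k.+2 u - k%:R * gk k.+1 u).
Proof.
have [u0|u0|u0] := ltgtP 0 u.
- have nu : u != 0 by rewrite gt_eqF.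
  have h1 : is_derive u (1 : R) (fun v : R => v^-1) (- u ^- 2).
    have h := @is_deriveV R id u 1 1 nu (is_derive_id u 1).
    by apply: (is_derive_congr h); rewrite /GRing.scale/= mulr1.
  have h2 := is_deriveX k h1.
  have h3 := @is_derive1_comp R expR (fun v => - v^-1) u _ _ (is_derive_expR _) (is_deriveN h1).
  have h4 := is_deriveM h2 h3.
  have h5 : is_derive u (1 : R) (fun v : R => v^-1 ^+ k * expR (- v^-1)) (gk k.+2 u - k%:R * gk k.+1 u).
    have -> : (fun v : R => v^-1 ^+ k * expR (- v^-1)) =
        (fun v : R => v^-1) ^+ k * (expR \o (fun v : R => - v^-1)).
      by apply/funext => v; rewrite !fctE.
    apply: (is_derive_congr h4); rewrite /gk u0 /GRing.scale/= !fctE /=.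
    set e := expR _; case: k {h2 h4} => [|k]; first by rewrite /=; field.
    by rewrite /= !exprS; field.
  apply: near_eq_is_derive h5; near=> v.
  have v0 : 0 < v by near: v; exact: lt_nbhsr.
  by rewrite /gk v0.
- rewrite !gk_le0 ?ltW// mulr0 subr0; apply: near_eq_is_derive (is_derive_cst (0 : R) u 1).
  near=> v; have v0 : v < 0 by near: v; exact: lt_nbhsl.
  by rewrite gk_le0// ltW.
(* For h > 0 the difference quotient at 0 is [gk k.+1 h], which is O(h) by [gk_bound]; for h < 0 it
   is 0. *)
- rewrite -u0 !gk_le0// mulr0 subr0.
  have C : h^-1 *: ((gk k \o shift 0) (h *: (1 : R)) - gk k 0) @[h --> 0^'] --> (0 : R).
    apply: norm_cvg0.
    have h0 : (k.+2)`!%:R * `|h| @[h --> (0 : R)^'] --> ((k.+2)`!%:R * 0 : R).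
      apply: cvgM; first exact: cvg_cst.
      have nc := @norm_continuous R R 0; rewrite /continuous_at normr0 in nc.
      exact: cvg_within_filter nc.
    rewrite mulr0 in h0.
    apply: (squeeze_cvgr _ (cvg_cst (0 : R)) h0).
    near=> h; rewrite normr_ge0/= /GRing.scale/= mulr1 addr0 (gk_le0 k (lexx 0)) subr0.
    have [hp|hn] := ltP 0 h.
      rewrite gkS mulrA mulVf ?gt_eqF// mul1r ger0_norm ?gk_ge0// (gtr0_norm hp).
      exact: gk_bound.
    by rewrite gk_le0// mulr0 normr0 mulr_ge0.
  split; first exact: cvgP C.
  exact: (cvg_lim (@norm_hausdorff _ _) C).
Unshelve. all: by end_near. Qed.

(* The functions bf are closed under differentiation, with bfD acting on the polynomial factor;
   the bump used as test function is the one with S = 1 and k = 0. *)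
Definition bf S k r y x : R := S.[(x - y) / r] * gk k (1 - ((x - y) / r) ^+ 2).

Definition bfD S k r : {poly R} :=
  r^-1 *: (S^`() * (1 - 'X ^+ 2) ^+ 2 - 'X *+ 2 * S * (1 - k%:R *: (1 - 'X ^+ 2))).

Lemma is_derive_bf S k r y x : is_derive x (1 : R) (bf S k r y) (bf (bfD S k r) k.+2 r y x).
Proof.
have h1 : is_derive x 1 (fun z : R => (z - y) / r) r^-1.
  rewrite (_ : (fun z => _) = fun z => r^-1 * (z - y)); last by apply/funext => z; rewrite mulrC.
  by apply: is_derive_eq; rewrite /GRing.scale/= subr0 mulr1.
have h2 := @is_derive1_comp R (horner S) (fun z => (z - y) / r) x _ _ (is_derive_poly S _) h1.
have h3 := is_deriveX 2 h1.
have h4 := is_deriveB (is_derive_cst (1 : R) x 1) h3.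
have h5 := @is_derive1_comp R (gk k) _ x _ _ (is_derive_gk k _) h4.
have h6 := is_deriveM h2 h5.
apply: (is_derive_congr h6).
rewrite /bf /bfD !hornerE /GRing.scale/= !fctE /=.
(* Once every value is expressed through the one of highest index, the identity is polynomial. *)
rewrite (gkS k) (gkS k.+1); move: (gk k.+2 _) S.[_] S^`().[_] => w A B.
ring.
Qed.

Lemma continuous_bf S k r y : continuous (bf S k r y).
Proof. exact: (is_derive_continuous (is_derive_bf S k r y)). Qed.

Lemma bf_eq0 S k r y x : 0 < r -> r <= `|x - y| -> bf S k r y x = 0.
Proof.
move=> r0 rx; rewrite /bf gk_le0 ?mulr0// subr_le0.
rewrite -[_ ^+ 2]ger0_norm ?sqr_ge0// normrX exprn_ege1// normrM (gtr0_norm (_ : 0 < r^-1)) ?invr_gt0//.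
by rewrite ler_pdivlMr// mul1r.
Qed.

Lemma integ_compact (f : R -> R) (M : R) : continuous f -> (forall x, M <= `|x| -> f x = 0) ->
  integ lam f /\ \int[lam]_x f x = \int[lam]_(x in `[- M, M]) f x.
Proof.
move=> cf f0.
have E : f = f \_ `[- M, M].
  apply/funext => x; rewrite patchE; case: ifPn => // xM; apply: f0.
  move: xM; rewrite notin_setE/= in_itv/= -ler_norml => /negP; rewrite -ltNge; exact: ltW.
have I : lam.-integrable `[- M, M] (EFin \o f).
  by apply: continuous_compact_integrable; [exact: segment_compact|exact: continuous_subspaceT].
split; last by rewrite [RHS]Rintegral_mkcond -E.
have mI : measurable (`[- M, M]%classic : set (measurableTypeR R)) by exact: measurable_itv.
have := (@integrable_mkcond _ _ R lam _ (EFin \o f) mI).1 I.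
by rewrite restrict_EFin -E.
Qed.

Lemma FTC_compact (f F : R -> R) (M : R) : 0 < M -> continuous f ->
  (forall x : R, is_derive x (1 : R) F (f x)) ->
  (forall x, M <= `|x| -> f x = 0) -> (forall x, M <= `|x| -> F x = 0) ->
  \int[lam]_x f x = 0.
Proof.
move=> M0 cf dF f0 F0; rewrite (integ_compact cf f0).2 /Rintegral.
by rewrite (FTC_itv _ cf dF) ?gtrN//= !F0 ?subrr// ?normrN (gtr0_norm M0).
Qed.

Definition sbump r y : R -> R := bf 1 0 r y.
Definition sbump1 r y : R -> R := bf (bfD 1 0 r) 2 r y.
Definition sbump2 r y : R -> R := bf (bfD (bfD 1 0 r) 2 r) 4 r y.

Lemma integ_bf S k r y : 0 < r -> integ lam (bf S k r y).
Proof.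
move=> r0; apply: (@integ_compact _ (`|y| + r) (@continuous_bf S k r y) _).1 => x xM.
apply: bf_eq0 => //.
have := lerB_dist x y; have := ler_norm (`|x| - `|y|); lra.
Qed.

Definition amp r (t : R) : R := \int[lam]_x (sbump r 0 x * cos (x * t)).

(** Reflection about y/2 carries the bump at y to the bump at 0, whose sine integral vanishes by
    evenness. The result is an amplitude and the phase y t, the form needed by [fourier_tensor]. *)
Lemma bump_fourier r y t : 0 < r ->
  \int[lam]_x (sbump r y x * cos (x * t)) = amp r t * cos (y * t) /\
  \int[lam]_x (sbump r y x * sin (x * t)) = amp r t * sin (y * t).
Proof.
move=> r0; have I := integ_bf 1 0 y r0; have I0 := integ_bf 1 0 0 r0.
have mt : measurable_fun setT (fun x : R => x * t) by exact: measurable_funM.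
have Ic := integ_cos I mt; have Is := integ_sin I mt.
have Ic0 := integ_cos I0 mt; have Is0 := integ_sin I0 mt.
have bE x : sbump r y (y - x) = sbump r 0 x.
  rewrite /sbump /bf !hornerC; congr (_ * gk _ (_ - _)).
  by rewrite (_ : y - x - y = - x) ?subr0 ?mulNr ?sqrrN//; ring.
have bN x : sbump r 0 (- x) = sbump r 0 x.
  by rewrite /sbump /bf !hornerC !subr0 mulNr sqrrN.
have S0 : \int[lam]_x (sbump r 0 x * sin (x * t)) = 0.
  have [_] := integ_opp Is0.
  under eq_Rintegral do rewrite -/(sbump r 0 _) bN mulNr sinN mulrN -mulN1r.
  by rewrite RintegralZl//; lra.
have [_ <-] := integ_reflect y Ic; have [_ <-] := integ_reflect y Is.
split.
- transitivity (\int[lam]_x (cos (y * t) * (sbump r 0 x * cos (x * t)) + sin (y * t) * (sbump r 0 x * sin (x * t)))).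
    by apply: eq_Rintegral => x _; rewrite -/(sbump r y _) bE mulrBl cosB; ring.
  rewrite RintegralD//; [|exact: integZ|exact: integZ].
  by rewrite !RintegralZl// S0 mulr0 addr0 mulrC.
- transitivity (\int[lam]_x (sin (y * t) * (sbump r 0 x * cos (x * t)) - cos (y * t) * (sbump r 0 x * sin (x * t)))).
    by apply: eq_Rintegral => x _; rewrite -/(sbump r y _) bE mulrBl sinB; ring.
  rewrite RintegralB//; [|exact: integZ|exact: integZ].
  by rewrite !RintegralZl// S0 mulr0 subr0 mulrC.
Qed.

(** Two integrations by parts at once: with b the bump, b' u - t b v is a compactly supported
    primitive of b'' u + t^2 b u. The pair (u, v) is (cos, - sin) or (sin, cos) at frequency t. *)
Lemma integral_sbump2 r y (t : R) (u v : R -> R) : 0 < r ->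
  (forall x : R, is_derive x (1 : R) u (t * v x)) ->
  (forall x : R, is_derive x (1 : R) v (- (t * u x))) ->
  integ lam (fun x => sbump r y x * u x) -> integ lam (fun x => sbump2 r y x * u x) ->
  \int[lam]_x (sbump2 r y x * u x) = - t ^+ 2 * \int[lam]_x (sbump r y x * u x).
Proof.
move=> r0 du dv I I2.
have d0 x : is_derive x (1 : R) (sbump r y) (sbump1 r y x) by exact: is_derive_bf.
have d1 x : is_derive x (1 : R) (sbump1 r y) (sbump2 r y x) by exact: is_derive_bf.
have c0 := is_derive_continuous d0; have c2 : continuous (sbump2 r y) by exact: continuous_bf.
have cu := is_derive_continuous du.
have M0 : 0 < `|y| + r by rewrite ltr_wpDl.
have far x : `|y| + r <= `|x| -> r <= `|x - y|.
  have := lerB_dist x y; have := ler_norm (`|x| - `|y|); lra.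
have : \int[lam]_x (sbump2 r y x * u x + t ^+ 2 * (sbump r y x * u x)) = 0.
  apply: (@FTC_compact _ (fun x => sbump1 r y x * u x - t * (sbump r y x * v x)) (`|y| + r)) => //.
  - move=> x; apply: cvgD; first by apply: cvgM; [exact: c2|exact: cu].
    by apply: cvgM; [exact: cvg_cst|apply: cvgM; [exact: c0|exact: cu]].
  - move=> x; have h1 := is_deriveM (d1 x) (du x).
    have h2 := is_deriveZ t (is_deriveM (d0 x) (dv x)).
    apply: (is_derive_congr (is_deriveB h1 h2)); rewrite /GRing.scale/=; ring.
  - by move=> x /far h; rewrite /sbump2 /sbump !bf_eq0// !(mul0r, mulr0) addr0.
  - by move=> x /far h; rewrite /sbump1 /sbump !bf_eq0// !(mul0r, mulr0) subrr.
by rewrite RintegralD//; [rewrite RintegralZl//; lra|exact: integZ].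
Qed.

Lemma bump2_fourier r y t : 0 < r ->
  \int[lam]_x (sbump2 r y x * cos (x * t)) = - t ^+ 2 * amp r t * cos (y * t) /\
  \int[lam]_x (sbump2 r y x * sin (x * t)) = - t ^+ 2 * amp r t * sin (y * t).
Proof.
move=> r0; have I := integ_bf 1 0 y r0.
have I2 := integ_bf (bfD (bfD 1 0 r) 2 r) 4 y r0.
have mt : measurable_fun setT (fun x : R => t * x) by exact: measurable_funM.
have [bc bs] := bump_fourier y t r0.
have E (u h : R -> R) : \int[lam]_x (h x * u (x * t)) = \int[lam]_x (h x * u (t * x)).
  by apply: eq_Rintegral => x _; rewrite (mulrC t).
split; rewrite -mulrA.
- rewrite -bc !(E cos).
  apply: (@integral_sbump2 _ _ t (fun x => cos (t * x)) (fun x => - sin (t * x))) => //.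
  + by move=> x; apply: (is_derive_congr (is_derive_cosM t x)); rewrite mulrN.
  + by move=> x; exact: is_deriveN (is_derive_sinM t x).
  + exact: integ_cos.
  + exact: integ_cos.
- rewrite -bs !(E sin).
  apply: (@integral_sbump2 _ _ t (fun x => sin (t * x)) (fun x => cos (t * x))) => //.
  + exact: is_derive_sinM.
  + exact: is_derive_cosM.
  + exact: integ_sin.
  + exact: integ_sin.
Qed.

(** On the support of the bump |x t| < 1 < pi/2, so the cosine is positive there. This allows
    division by the amplitude at a given frequency once r is small. *)
Lemma amp_gt0 r t : 0 < r -> r * `|t| <= 1 -> 0 < amp r t.
Proof.
move=> r0 rt.
have mt : measurable_fun setT (fun x : R => x * t) by exact: measurable_funM.
have I := integ_cos (integ_bf 1 0 0 r0) mt.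
have pos x : `|x| < r -> 0 < sbump r 0 x * cos (x * t).
  move=> xr; rewrite mulr_gt0//.
    rewrite /sbump /bf hornerC mul1r gk_gt0// subr_gt0 subr0.
    rewrite -[_ ^+ 2]ger0_norm ?sqr_ge0// normrX exprn_ilt1// normrM (gtr0_norm (_ : 0 < r^-1)) ?invr_gt0//.
    by rewrite ltr_pdivrMr// mul1r.
  apply: cos_gt0_pihalf; rewrite -ltr_norml normrM.
  have [->|t0] := eqVneq t 0; first by rewrite normr0 mulr0 (lt_le_trans ltr01)// pihalf_ge1.
  apply: (lt_le_trans _ (pihalf_ge1 R)); apply: lt_le_trans rt.
  by rewrite ltr_pM2r// normr_gt0.
have ge0 x : 0 <= sbump r 0 x * cos (x * t).
  have [/pos/ltW//|xr] := ltP `|x| r.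
  by rewrite /sbump bf_eq0 ?mul0r// subr0.
rewrite lt_neqAle Rintegral_ge0 ?andbT// eq_sym; apply/negP => /eqP.
move=> /(ae_ge0_Rintegral_eq0 I ge0) [N [mN N0 sN]].
pose J : set R := `](- r), r[%classic.
have : (lam J <= lam N)%E.
  apply: le_measure; rewrite ?inE//; first exact: measurable_itv.
  move=> x; rewrite /J/= in_itv/= -ltr_norml => /pos h; apply: sN => /= h0.
  by rewrite h0 ltxx in h.
rewrite N0 /J lebesgue_measure_itv/= lte_fin gtrN// lee_fin; lra.
Qed.

End smooth_bump.

(** * Product bumps and the transform of their Laplacian *)

Section weak_laplacian.
Context (R : realType) (n : nat).
Local Notation lam := (@lebesgue_measure R).
Local Notation V := 'rV[R]_n.
Local Notation mu := (lebesgue_rV R n).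
Local Notation L2 := (Lfun mu 2%:E).

Definition prodf (h : 'I_n -> R -> R) (x : V) : R := \prod_i h i (x ord0 i).

Lemma differentiable_prodf (h : 'I_n -> R -> R) (x : V) :
  (forall i (t : R), derivable (h i) t 1) -> differentiable (prodf h) x.
Proof.
move=> dh; rewrite /prodf.
elim: (index_enum 'I_n) => [|i s IH].
  rewrite (_ : (fun x : V => _) = cst 1); first exact: differentiable_cst.
  by apply/funext => z; rewrite big_nil.
rewrite (_ : (fun x : V => _) = (fun z : V => h i (z ord0 i)) * (fun z : V => \prod_(j <- s) h j (z ord0 j))).
  apply: differentiableM => //.
  apply: (@differentiable_comp _ _ _ _ (fun z : V => z ord0 i) (h i)).
    exact: differentiable_coord.
  exact/derivable1_diffP.
by apply/funext => z; rewrite big_cons.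
Qed.

Definition upd (h : 'I_n -> R -> R) i (g : R -> R) : 'I_n -> R -> R :=
  fun j => if j == i then g else h j.

Lemma partial_prodf (h : 'I_n -> R -> R) (i : 'I_n) (g : R -> R) :
  (forall t : R, is_derive t (1 : R) (h i) (g t)) ->
  partial i (prodf h) = prodf (upd h i g).
Proof.
move=> dh; apply/funext => x; rewrite /partial.
set P := \prod_(j | j != i) h j (x ord0 j).
have -> : 'D_(delta_mx 0 i) (prodf h) x = 'D_1 (fun t => P * h i t) (x ord0 i).
  rewrite /derive; congr (lim _).
  suff -> : (fun u : R => u^-1 *: ((prodf h \o shift x) (u *: delta_mx 0 i) - prodf h x)) =
     (fun u : R => u^-1 *: (((fun t => P * h i t) \o shift (x ord0 i)) (u *: (1 : R)) - P * h i (x ord0 i))) by [].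
  apply/funext => u; congr (_ *: (_ - _)); rewrite /= /prodf (bigD1 i)//= mulrC; last first.
    by [].
  congr (_ * _); last by rewrite !mxE !eqxx /GRing.scale/= mulr1.
  apply: eq_bigr => j ji; congr (h j _).
  by rewrite !mxE eqxx (negbTE ji) mulr0 add0r.
have := @is_deriveZ _ _ _ _ P (x ord0 i) 1 _ (dh (x ord0 i)).
move=> h1; rewrite (@derive_val _ _ _ _ _ _ _ h1) /prodf (bigD1 i)//= /upd eqxx mulrC.
congr (_ * _); apply: eq_bigr => j ji.
by rewrite (negbTE ji).
Qed.

Variables (r : R) (y : V).
Hypothesis r0 : 0 < r.

Definition bfclass (i : 'I_n) : set (R -> R) := [set f | exists S k, f = bf S k r (y ord0 i)].

(** A partial derivative changes one factor and keeps it in [bfclass], so every iterated derivative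
    is again a product of differentiable functions; this is the smoothness of the test function. *)
Lemma iter_partial_prodf (h : 'I_n -> R -> R) (s : seq 'I_n) :
  (forall i, bfclass i (h i)) ->
  exists2 h' : 'I_n -> R -> R, (forall i, bfclass i (h' i)) & foldr (@partial R n) (prodf h) s = prodf h'.
Proof.
move=> ch; elim: s => [|i s [h' ch' E]]; first by exists h.
have [S [k hE]] := ch' i.
exists (upd h' i (bf (bfD S k r) k.+2 r (y ord0 i))).
  move=> j; rewrite /upd; case: eqP => [->|_]; last exact: ch'.
  by exists (bfD S k r), k.+2.
by rewrite /= E; apply: partial_prodf => t; rewrite hE; exact: is_derive_bf.
Qed.

Definition tbump : V -> R := prodf (fun i => sbump r (y ord0 i)).

Lemma test_tbump : test_function tbump.
Proof.
split.
  move=> s x; have [h' ch' ->] := @iter_partial_prodf (fun i => sbump r (y ord0 i)) s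
    (fun i => ex_intro _ 1 (ex_intro _ 0%N erefl)).
  apply: differentiable_prodf => i t; have [S [k ->]] := ch' i.
  by case: (is_derive_bf S k r (y ord0 i) t).
have C : compact [set v : V | forall i, `[y ord0 i - r, y ord0 i + r]%classic (v ord0 i)].
  by apply: (rV_compact (A := fun i => `[y ord0 i - r, y ord0 i + r]%classic)) => i; exact: segment_compact.
apply: (subclosed_compact _ C); first exact: closed_closure.
have HC := compact_closed (@norm_hausdorff _ _) C.
rewrite [X in _ `<=` X](closure_id _).1//.
apply: closure_subset => x /= /eqP chi0 i; rewrite in_itv/=.
have : `|x ord0 i - y ord0 i| < r.
  rewrite ltNge; apply/negP => h; apply: chi0.
  by rewrite /tbump /prodf (bigD1 i)//= /sbump bf_eq0// mul0r.
by rewrite ltr_norml => /andP[h1 h2]; apply/andP; split; lra.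
Qed.

Lemma laplacian_tbump (x : V) : laplacian tbump x =
  \sum_i prodf (upd (fun i => sbump r (y ord0 i)) i (sbump2 r (y ord0 i))) x.
Proof.
rewrite /laplacian; apply: eq_bigr => i _.
have -> : partial i tbump = prodf (upd (fun i => sbump r (y ord0 i)) i (sbump1 r (y ord0 i))).
  by apply: partial_prodf => t; exact: is_derive_bf.
have -> : partial i (prodf (upd (fun i => sbump r (y ord0 i)) i (sbump1 r (y ord0 i)))) =
    prodf (upd (upd (fun i => sbump r (y ord0 i)) i (sbump1 r (y ord0 i))) i (sbump2 r (y ord0 i))).
  by apply: partial_prodf => t; rewrite /upd eqxx; exact: is_derive_bf.
by rewrite /prodf; apply: eq_bigr => j _; rewrite /upd; case: (j == i).
Qed.

Lemma integ_bf_sqr S k c : integ lam (fun x => bf S k r c x ^+ 2).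
Proof.
have -> : (fun x => bf S k r c x ^+ 2) = (fun x => bf S k r c x * bf S k r c x).
  by apply/funext => x; rewrite expr2.
apply: (@integ_compact _ _ (`|c| + r) _ _).1.
- by move=> x; apply: cvgM; exact: continuous_bf.
- move=> x xM; rewrite bf_eq0 ?mulr0//.
  by have := lerB_dist x c; have := ler_norm (`|x| - `|c|); lra.
Qed.

Lemma integ_prodf_bf h : (forall i, bfclass i (h i)) -> integ mu (prodf h) /\ prodf h \in L2.
Proof.
move=> ch.
have I : integ mu (prodf h).
  apply: (@Rintegral_tensor R n h _).1 => i; have [S [k ->]] := ch i.
  exact: integ_bf.
split=> //; apply/L2P; split; first exact: integ_measurable I.
rewrite (_ : (fun x : V => _) = fun x : V => \prod_i (h i (x ord0 i)) ^+ 2); last first.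
  by apply/funext => x; rewrite /prodf prodrXl.
apply: (@Rintegral_tensor R n (fun i t => h i t ^+ 2) _).1 => i; have [S [k ->]] := ch i.
exact: integ_bf_sqr.
Qed.

Definition Wamp (xi : V) : R := \prod_i amp r (xi ord0 i).

Lemma hartley_tensor (g : 'I_n -> R -> R) (xi : V) (A t : 'I_n -> R) :
  (forall i, integ lam (g i)) ->
  (forall i, \int[lam]_a (g i a * cos (a * xi ord0 i)) = A i * cos (t i)) ->
  (forall i, \int[lam]_a (g i a * sin (a * xi ord0 i)) = A i * sin (t i)) ->
  hartley (prodf g) xi = hcst R n * ((\prod_i A i) * cas (\sum_i t i)).
Proof.
move=> Ig Hc Hs; have [I C S] := fourier_tensor Ig Hc Hs.
rewrite /hartley; congr (_ * _); rewrite /cas mulrDr -C -S -RintegralD//.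
- by apply: eq_Rintegral => x _; rewrite mulrDr.
- exact: (integ_cos I (measurable_dotp xi)).
- exact: (integ_sin I (measurable_dotp xi)).
Qed.

Lemma hartley_tbump xi : hartley tbump xi = hcst R n * (Wamp xi * cas (dotp y xi)).
Proof.
apply: hartley_tensor => i.
- exact: integ_bf.
- exact: (bump_fourier (y ord0 i) (xi ord0 i) r0).1.
- exact: (bump_fourier (y ord0 i) (xi ord0 i) r0).2.
Qed.

Lemma hartley_upd i xi : hartley (prodf (upd (fun i => sbump r (y ord0 i)) i (sbump2 r (y ord0 i)))) xi =
  - xi ord0 i ^+ 2 * hartley tbump xi.
Proof.
rewrite hartley_tbump (@hartley_tensor _ _ (fun j => (if j == i then - xi ord0 i ^+ 2 else 1) * amp r (xi ord0 j))
  (fun j => y ord0 j * xi ord0 j)).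
- rewrite big_split/= -big_mkcond/= big_pred1_eq /Wamp -/(dotp y xi); ring.
- by move=> j; rewrite /upd; case: ifP => _; exact: integ_bf.
- move=> j; rewrite /upd; case: eqP => [->|_].
    exact: (bump2_fourier (y ord0 i) (xi ord0 i) r0).1.
  by rewrite mul1r; exact: (bump_fourier (y ord0 j) (xi ord0 j) r0).1.
- move=> j; rewrite /upd; case: eqP => [->|_].
    exact: (bump2_fourier (y ord0 i) (xi ord0 i) r0).2.
  by rewrite mul1r; exact: (bump_fourier (y ord0 j) (xi ord0 j) r0).2.
Qed.

Lemma sum_L2 (I : Type) (s : seq I) (F : I -> V -> R) :
  (forall i, integ mu (F i) /\ F i \in L2) ->
  [/\ integ mu (fun x => \sum_(i <- s) F i x), (fun x => \sum_(i <- s) F i x) \in L2 &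
   forall xi, hartley (fun x => \sum_(i <- s) F i x) xi = \sum_(i <- s) hartley (F i) xi].
Proof.
move=> HF; elim: s => [|i s [I1 I2 E]].
  have -> : (fun x => \sum_(i <- [::]) F i x) = fun=> 0.
    by apply/funext => x; rewrite big_nil.
  split; [exact: integ0|exact: L2_0|move=> xi].
  rewrite big_nil /hartley; under eq_Rintegral do rewrite mul0r.
  by rewrite Rintegral0 mulr0.
have -> : (fun x => \sum_(i <- i :: s) F i x) = fun x => F i x + \sum_(i <- s) F i x.
  by apply/funext => x; rewrite big_cons.
have [Ii Li] := HF i.
split; [exact: integD|exact: L2D|move=> xi].
by rewrite hartleyD// big_cons E.
Qed.

Lemma tbump_L2 : integ mu tbump /\ tbump \in L2.
Proof. by apply: integ_prodf_bf => i; exists 1, 0%N. Qed.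

Lemma laplacian_tbump_L2 :
  [/\ integ mu (laplacian tbump), laplacian tbump \in L2 &
      forall xi, hartley (laplacian tbump) xi = - dotp xi xi * hartley tbump xi].
Proof.
have -> : laplacian tbump = fun x => \sum_i prodf (upd (fun i => sbump r (y ord0 i)) i (sbump2 r (y ord0 i))) x.
  by apply/funext => x; exact: laplacian_tbump.
have [i|I1 I2 E] := @sum_L2 _ (index_enum 'I_n) (fun i => prodf (upd (fun i => sbump r (y ord0 i)) i (sbump2 r (y ord0 i)))) _.
  apply: integ_prodf_bf => j; rewrite /upd; case: eqP => [->|_].
    by exists (bfD (bfD 1 0 r) 2 r), 4.
  by exists 1, 0%N.
split=> // xi; rewrite E; under eq_bigr do rewrite hartley_upd.
rewrite -mulr_suml; by congr (_ * _); rewrite sumrN; congr (- _).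
Qed.

End weak_laplacian.

(** * The weak Laplacian as a multiplier *)

Section weak_laplacian_HT.
Context (R : realType) (n : nat).
Local Notation V := 'rV[R]_n.
Local Notation mu := (lebesgue_rV R n).
Local Notation L2 := (Lfun mu 2%:E).

Lemma HT_plancherel (f h : V -> R) : f \in L2 -> integ mu h -> h \in L2 ->
  dotL2 mu (HT f) (hartley h) = dotL2 mu f h.
Proof.
move=> f2 Ih h2; rewrite -(HT_spec (HT_L2 f2) Ih h2).
apply: ae_eq_Rintegral.
- by apply: measurable_funM; [exact/L2_measurable/HT_L2/HT_L2|exact: integ_measurable Ih].
- by apply: measurable_funM; [exact: L2_measurable f2|exact: integ_measurable Ih].
- by apply: filterS (HT_inv f2) => x ->.
Qed.

(* Testing against the bump centred at y shows that [(HT g + |xi|^2 HT f) Wamp], which is in L1,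
   has a Hartley transform vanishing at y, for every y. *)
Lemma weak_laplacian_HT_step (f g : V -> R) (r : R) : 0 < r -> weak_laplacian f g ->
  {ae mu, forall xi, (HT g xi + dotp xi xi * HT f xi) * Wamp r xi = 0}.
Proof.
move=> r0 [f2 g2 fg]; rewrite /in_L2 in f2 g2.
have [Ib Lb] := @tbump_L2 R n r 0 r0.
have [Il Ll El] := @laplacian_tbump_L2 R n r 0 r0.
have hc := hcst_gt0 R n; have hc0 : hcst R n != 0 by rewrite gt_eqF.
have dotp0 (xi : V) : dotp 0 xi = 0 by rewrite /dotp big1// => i _; rewrite mxE mul0r.
have WE (xi : V) : Wamp r xi = (hcst R n)^-1 * hartley (tbump r 0) xi.
  by rewrite hartley_tbump// dotp0 /cas cos0 sin0 addr0 mulr1 mulKf.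
have aWE (xi : V) : dotp xi xi * Wamp r xi = - (hcst R n)^-1 * hartley (laplacian (tbump r 0)) xi.
  by rewrite El WE; ring.
have mh := measurable_hartley Ib; have mhl := measurable_hartley Il.
have bound (c : R) (h : V -> R) : integ mu h -> exists M : R, forall xi, `|c * hartley h xi| <= M.
  move=> Ih; exists (`|c| * (2 * hcst R n * \int[mu]_x `|h x|)) => xi.
  by rewrite normrM ler_wpM2l// hartley_bound.
have [M1 hM1] := bound (hcst R n)^-1 _ Ib.
have [M2 hM2] := bound (- (hcst R n)^-1) _ Il.
(* [u1] and [u2] are [Wamp r] and |xi|^2 times it. Written as transforms, they are seen to be
   bounded and in L2. *)
pose u1 (xi : V) := (hcst R n)^-1 * hartley (tbump r 0) xi.
pose u2 (xi : V) := - (hcst R n)^-1 * hartley (laplacian (tbump r 0)) xi.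
have mu1 : measurable_fun setT u1 by exact: measurable_funM.
have mu2 : measurable_fun setT u2 by exact: measurable_funM.
have Lu1 : u1 \in L2 by apply: L2Z; have [] := hartley_L2 Ib Lb.
have Lu2 : u2 \in L2 by apply: L2Z; have [] := hartley_L2 Il Ll.
have Hg := HT_L2 g2; have Hf := HT_L2 f2.
pose Phi (xi : V) := u1 xi * HT g xi + u2 xi * HT f xi.
have PhiE (xi : V) : (HT g xi + dotp xi xi * HT f xi) * Wamp r xi = Phi xi.
  by rewrite /Phi /u1 /u2 -WE -aWE; ring.
have IPhi : integ mu Phi by apply: integD; exact: L2M.
have LPhi : Phi \in L2.
  by apply: L2D; [apply: (@L2M_bounded _ _ _ _ M1)|apply: (@L2M_bounded _ _ _ _ M2)].
have H0 (y : V) : hartley Phi y = 0.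
  have [Iby Lby] := @tbump_L2 R n r y r0.
  have [Ily Lly Ely] := @laplacian_tbump_L2 R n r y r0.
  have := fg _ (@test_tbump R n r y r0).
  rewrite -/(dotL2 mu f (laplacian (tbump r y))) -/(dotL2 mu g (tbump r y)).
  rewrite -(HT_plancherel f2 Ily Lly) -(HT_plancherel g2 Iby Lby) => E.
  have hby := (hartley_L2 Iby Lby).1; have hly := (hartley_L2 Ily Lly).1.
  suff : hartley Phi y = dotL2 mu (HT g) (hartley (tbump r y)) - dotL2 mu (HT f) (hartley (laplacian (tbump r y))).
    by rewrite E subrr.
  rewrite {1}/hartley -RintegralB; [|exact: measurableT|exact: L2M|exact: L2M].
  rewrite -(RintegralZl _ measurableT (integ_cas y IPhi)).
  apply: eq_Rintegral => xi _.
  rewrite Ely hartley_tbump// -PhiE (dotpC xi y); ring.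
have HT0 : {ae mu, forall xi, HT Phi xi = 0}.
  by apply: filterS (HT_hartley IPhi LPhi) => xi ->; exact: H0.
have L0 := L2_0 mu.
have HT00 : {ae mu, forall xi, HT (fun=> 0) xi = 0}.
  by apply: filterS (HTZ 0 L0) => xi; under eq_fun do rewrite mul0r; move=> ->; rewrite mul0r.
have h1 := HT_ae (HT_L2 LPhi) L0 HT0.
have h2 := HT_inv LPhi.
apply: filterS3 h1 h2 HT00 => xi e1 e2 e3.
by rewrite PhiE -e2 e1 e3.
Qed.

(** For a fixed radius the amplitude may vanish at some frequencies. With radius 1/(k+1) for all k,
    one of them is small enough at any given xi, and [amp_gt0] permits the division. *)
Lemma weak_laplacian_HT (f g : V -> R) : weak_laplacian f g ->
  {ae mu, forall xi, HT g xi = - dotp xi xi * HT f xi}.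
Proof.
move=> fg.
have H (k : nat) : {ae mu, forall xi, (HT g xi + dotp xi xi * HT f xi) * Wamp (k.+1%:R^-1) xi = 0}.
  by apply: weak_laplacian_HT_step => //; rewrite invr_gt0.
have := ae_foralln H; apply: filterS => xi hxi.
pose N := Num.truncn (\sum_j `|xi ord0 j|).
have hk : \sum_j `|xi ord0 j| < N.+1%:R by exact: truncnS_gt.
have W0 : Wamp (N.+1%:R^-1) xi != 0.
  rewrite gt_eqF//; apply: prodr_gt0 => i _; apply: amp_gt0; rewrite ?invr_gt0//.
  rewrite mulrC ler_pdivrMr// mul1r ltW// (le_lt_trans _ hk)// (bigD1 i)//= lerDl sumr_ge0//.
have /eqP := hxi N; rewrite mulf_eq0 (negbTE W0) orbF addr_eq0 => /eqP ->.
by rewrite mulNr.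
Qed.

End weak_laplacian_HT.

(** * Energy of L2-valued curves *)

Section L2_curves.
Context d (T : measurableType d) (R : realType).
Variable mu : {measure set T -> \bar R}.
Local Notation L2 := (Lfun mu 2%:E).
Local Notation nrm := (nrmL2 mu).
Implicit Types (u v : R -> T -> R) (c : T -> R).

Lemma cvg0_squeeze (F : set_system R) (f g : R -> R) : Filter F ->
  (\forall h \near F, 0 <= f h <= g h) -> g h @[h --> F] --> 0 -> f h @[h --> F] --> 0.
Proof. by move=> FF fg g0; apply: (squeeze_cvgr fg (cvg_cst (0 : R)) g0). Qed.

Lemma near_shift_ge0 (t : R) : 0 < t -> \forall h \near (0 : R)^', 0 <= t + h.
Proof.
move=> t0; near=> h.
have : `|h| < t by near: h; exact: dnbhs0_lt.
by rewrite ltr_norml => /andP[h1 _]; lra.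
Unshelve. all: by end_near. Qed.

Lemma cvg_norm0 : `|h| @[h --> (0 : R)^'] --> (0 : R).
Proof.
have nc := @norm_continuous R R 0; rewrite /continuous_at normr0 in nc.
exact: cvg_within_filter nc.
Qed.

Lemma is_derive_quotient (q : R -> R) (t l : R) :
  h^-1 * (q (t + h) - q t) @[h --> (0 : R)^'] --> l -> is_derive t (1 : R) q l.
Proof.
move=> C.
have C' : h^-1 *: ((q \o shift t) (h *: (1 : R)) - q t) @[h --> (0 : R)^'] --> l.
  move: C; rewrite (_ : (fun h : R => h^-1 * (q (t + h) - q t)) =
    (fun h : R => h^-1 *: ((q \o shift t) (h *: (1 : R)) - q t)))//.
  by apply/funext => h; rewrite /= /GRing.scale/= mulr1 [h + t]addrC.
split; first exact: cvgP C'.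
exact: (cvg_lim (@norm_hausdorff _ _) C').
Qed.

Definition dq u v (t h : R) (x : T) : R := h^-1 * (u (t + h) x - u t x) - v t x.

(** Differentiability is required at positive times and only right continuity at 0. This suffices
    for monotonicity on [0, +oo[, and it allows the derivative to be replaced by means of the
    equation, which holds for t > 0. *)
Definition L2curve u v : Prop :=
  [/\ forall t, 0 <= t -> u t \in L2,
      forall t, 0 < t -> v t \in L2,
      forall t, 0 < t -> nrm (dq u v t h) @[h --> (0 : R)^'] --> (0 : R)
    & nrm (fun x => u h x - u 0 x) @[h --> (0 : R)^'+] --> (0 : R)].

Lemma dq_L2 u v t h : L2curve u v -> 0 < t -> 0 <= t + h -> dq u v t h \in L2.
Proof.
move=> [Lu Lv _ _] t0 th; apply: L2B; last exact: Lv.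
by apply: L2Z; apply: L2B; apply: Lu => //; exact: ltW.
Qed.

Lemma L2curve_ae u v v' : L2curve u v ->
  (forall t, 0 < t -> measurable_fun setT (v' t) /\ {ae mu, forall x, v t x = v' t x}) ->
  L2curve u v'.
Proof.
move=> uv vv'; have [Lu Lv Du Cu] := uv; split=> // t t0.
  by have [m ae] := vv' t t0; exact: L2_ae (Lv t t0) m ae.
apply: cvg0_squeeze (Du t t0); near=> h; rewrite nrmL2_ge0/=.
have th : 0 <= t + h by near: h; exact: near_shift_ge0.
rewrite (@nrmL2_ae _ _ _ mu (dq u v t h) (dq u v' t h))//.
- exact: dq_L2.
- have [m ae] := vv' t t0; apply: measurable_funB => //.
  apply: measurable_funM => //; apply: measurable_funB; apply: L2_measurable; apply: Lu => //.
  exact: ltW.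
- by have [m ae] := vv' t t0; apply: filterS ae => x; rewrite /dq => ->.
Unshelve. all: by end_near. Qed.

Lemma L2curveD u v u' v' : L2curve u v -> L2curve u' v' ->
  L2curve (fun t x => u t x + u' t x) (fun t x => v t x + v' t x).
Proof.
move=> uv uv'; have [Lu Lv Du Cu] := uv; have [Lu' Lv' Du' Cu'] := uv'; split.
- by move=> t t0; apply: L2D; [exact: Lu|exact: Lu'].
- by move=> t t0; apply: L2D; [exact: Lv|exact: Lv'].
- move=> t t0; have C : nrm (dq u v t h) + nrm (dq u' v' t h) @[h --> (0 : R)^'] --> (0 : R) + 0.
    by apply: cvgD; [exact: Du|exact: Du'].
  rewrite addr0 in C.
  apply: cvg0_squeeze C; near=> h; rewrite nrmL2_ge0/=.
  have th : 0 <= t + h by near: h; exact: near_shift_ge0.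
  apply: le_trans (nrmL2D (dq_L2 uv t0 th) (dq_L2 uv' t0 th)).
  by rewrite (_ : dq _ _ _ _ = (fun x => dq u v t h x + dq u' v' t h x))//;
    apply/funext => x; rewrite /dq; ring.
- have C : nrm (fun x => u h x - u 0 x) + nrm (fun x => u' h x - u' 0 x)
      @[h --> (0 : R)^'+] --> (0 : R) + 0 by apply: cvgD.
  rewrite addr0 in C.
  apply: cvg0_squeeze C; near=> h; rewrite nrmL2_ge0/=.
  have h0 : 0 <= h by near: h; exact: nbhs_right_ge.
  apply: le_trans (nrmL2D (L2B (Lu h h0) (Lu 0 (lexx 0))) (L2B (Lu' h h0) (Lu' 0 (lexx 0)))).
  by rewrite (_ : (fun x => _) = (fun x => (u h x - u 0 x) + (u' h x - u' 0 x)))//;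
    apply/funext => x; ring.
Unshelve. all: by end_near. Qed.

Lemma L2curveM c (M : R) u v : measurable_fun setT c -> (forall x, `|c x| <= M) ->
  L2curve u v -> L2curve (fun t x => c x * u t x) (fun t x => c x * v t x).
Proof.
move=> mc cM uv; have [Lu Lv Du Cu] := uv; split.
- by move=> t t0; apply: (L2M_bounded mc cM); exact: Lu.
- by move=> t t0; apply: (L2M_bounded mc cM); exact: Lv.
- move=> t t0; have C : M * nrm (dq u v t h) @[h --> (0 : R)^'] --> M * 0.
    by apply: cvgM; [exact: cvg_cst|exact: Du].
  rewrite mulr0 in C.
  apply: cvg0_squeeze C; near=> h; rewrite nrmL2_ge0/=.
  have th : 0 <= t + h by near: h; exact: near_shift_ge0.
  apply: le_trans (nrmL2_bounded mc cM (dq_L2 uv t0 th)).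
  by rewrite (_ : dq _ _ _ _ = (fun x => c x * dq u v t h x))//;
    apply/funext => x; rewrite /dq; ring.
- have C : M * nrm (fun x => u h x - u 0 x) @[h --> (0 : R)^'+] --> M * 0.
    by apply: cvgM; [exact: cvg_cst|exact: Cu].
  rewrite mulr0 in C.
  apply: cvg0_squeeze C; near=> h; rewrite nrmL2_ge0/=.
  have h0 : 0 <= h by near: h; exact: nbhs_right_ge.
  apply: le_trans (nrmL2_bounded mc cM (L2B (Lu h h0) (Lu 0 (lexx 0)))).
  by rewrite (_ : (fun x => _) = (fun x => c x * (u h x - u 0 x)))//;
    apply/funext => x; ring.
Unshelve. all: by end_near. Qed.

Lemma L2curveZ (k : R) u v : L2curve u v ->
  L2curve (fun t x => k * u t x) (fun t x => k * v t x).
Proof. by move=> uv; apply: (@L2curveM (fun=> k) `|k|). Qed.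

Lemma L2curveB u v u' v' : L2curve u v -> L2curve u' v' ->
  L2curve (fun t x => u t x - u' t x) (fun t x => v t x - v' t x).
Proof.
move=> uv uv'; have := L2curveD uv (L2curveZ (-1) uv').
rewrite (_ : (fun t x => u t x - u' t x) = (fun t x => u t x + -1 * u' t x)); last first.
  by apply/funext => t; apply/funext => x; rewrite mulN1r.
rewrite (_ : (fun t x => v t x - v' t x) = (fun t x => v t x + -1 * v' t x))//.
by apply/funext => t; apply/funext => x; rewrite mulN1r.
Qed.

(** An energy density with its formal time derivative, for which differentiation under the integral
    is legitimate. *)
Definition qcurve (G F : R -> T -> R) : Prop :=
  [/\ forall t, 0 <= t -> integ mu (G t),
      forall t, 0 < t -> integ mu (F t),
      forall t : R, 0 < t -> is_derive t (1 : R) (fun s => \int[mu]_x G s x) (\int[mu]_x F t x)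
    & \int[mu]_x G h x @[h --> (0 : R)^'+] --> \int[mu]_x G 0 x].

Lemma qcurveD G F G' F' : qcurve G F -> qcurve G' F' ->
  qcurve (fun t x => G t x + G' t x) (fun t x => F t x + F' t x).
Proof.
move=> [IG IF DG CG] [IG' IF' DG' CG']; split.
- by move=> t t0; apply: integD; [exact: IG|exact: IG'].
- by move=> t t0; apply: integD; [exact: IF|exact: IF'].
- move=> t t0; rewrite RintegralD//; [|exact: IF|exact: IF'].
  apply: near_eq_is_derive (is_deriveD (DG t t0) (DG' t t0)).
  near=> s; have s0 : 0 <= s by apply: ltW; near: s; exact: lt_nbhsr.
  by rewrite /= RintegralD//; [exact: IG|exact: IG'].
- rewrite RintegralD//; [|exact: IG|exact: IG'].
  have C : \int[mu]_x G h x + \int[mu]_x G' h x @[h --> (0 : R)^'+] -->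
      \int[mu]_x G 0 x + \int[mu]_x G' 0 x by apply: cvgD.
  apply: cvg_trans C; apply: near_eq_cvg.
  near=> s; have s0 : 0 <= s by near: s; exact: nbhs_right_ge.
  by rewrite /= RintegralD//; [exact: IG|exact: IG'].
Unshelve. all: by end_near. Qed.

Lemma qcurve_decreasing G F : qcurve G F ->
  (forall t, 0 < t -> {ae mu, forall x, F t x <= 0}) ->
  forall t, 0 <= t -> \int[mu]_x G t x <= \int[mu]_x G 0 x.
Proof.
move=> [IG IF DG CG] F0 t t0.
apply: (@ler0_derive1_nincry _ (fun s => \int[mu]_x G s x) 0) => //.
- by move=> s; rewrite in_itv/= andbT => s0; case: (DG s s0).
- move=> s; rewrite in_itv/= andbT => s0; rewrite derive1E (@derive_val _ _ _ _ _ _ _ (DG s s0)).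
  rewrite -(Rintegral0 mu); apply: ae_le_Rintegral; [exact: IF|exact: integ0|exact: F0].
- apply/continuous_within_itvcyP; split=> // s; rewrite in_itv/= andbT => s0.
  by apply/differentiable_continuous/derivable1_diffP; case: (DG s s0).
Qed.

Lemma integM3 c (M : R) (f g : T -> R) : measurable_fun setT c -> (forall x, `|c x| <= M) ->
  f \in L2 -> g \in L2 -> integ mu (fun x => c x * (f x * g x)).
Proof. by move=> mc cM f2 g2; apply: (integM_bounded mc cM); exact: L2M. Qed.

Lemma Rintegral_M3_le c (M : R) (f g : T -> R) : measurable_fun setT c -> (forall x, `|c x| <= M) ->
  f \in L2 -> g \in L2 -> `|\int[mu]_x (c x * (f x * g x))| <= M * nrm f * nrm g.
Proof.
move=> mc cM f2 g2.
have -> : \int[mu]_x (c x * (f x * g x)) = dotL2 mu (fun x => c x * f x) g.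
  by apply: eq_Rintegral => x _; rewrite mulrA.
apply: le_trans (cauchy_schwarz (L2M_bounded mc cM f2) g2) _.
by rewrite ler_wpM2r ?nrmL2_ge0// nrmL2_bounded.
Qed.

Lemma quad_expand c (M h : R) (f b : T -> R) : measurable_fun setT c -> (forall x, `|c x| <= M) ->
  f \in L2 -> b \in L2 ->
  \int[mu]_x (c x * (f x + h * b x) ^+ 2) - \int[mu]_x (c x * f x ^+ 2) =
  2 * h * \int[mu]_x (c x * (f x * b x)) + h ^+ 2 * \int[mu]_x (c x * (b x * b x)).
Proof.
move=> mc cM f2 b2.
have I1 := integM3 mc cM f2 f2; have I2 := integM3 mc cM f2 b2; have I3 := integM3 mc cM b2 b2.
have -> : \int[mu]_x (c x * (f x + h * b x) ^+ 2) =
  \int[mu]_x (c x * (f x * f x) + (2 * h * (c x * (f x * b x)) + h ^+ 2 * (c x * (b x * b x)))).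
  by apply: eq_Rintegral => x _; ring.
rewrite (_ : \int[mu]_x (c x * f x ^+ 2) = \int[mu]_x (c x * (f x * f x))); last first.
  by apply: eq_Rintegral => x _; rewrite expr2.
rewrite RintegralD//; last by apply: integD; exact: integZ.
rewrite RintegralD//; [|exact: integZ|exact: integZ].
rewrite (RintegralZl _ measurableT I2) (RintegralZl _ measurableT I3); ring.
Qed.

(** For fixed x nothing is known on t -> u t x. With A the L2 error of the difference quotient, u (t
    + h) = u t + h (v t + A), and expanding the square leaves the error 2 times the integral of c u
    A plus h times that of c (v + A)^2; Cauchy-Schwarz sends both to 0. *)
Lemma qcurve_sqr c (M : R) u v : measurable_fun setT c -> (forall x, `|c x| <= M) ->
  L2curve u v ->
  qcurve (fun t x => c x * u t x ^+ 2) (fun t x => 2 * (c x * (u t x * v t x))).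
Proof.
move=> mc cM uv; have [Lu Lv Du Cu] := uv; split.
- by move=> t t0; under eq_fun do rewrite expr2; apply: (integM3 mc cM); exact: Lu.
- by move=> t t0; apply: integZ; apply: (integM3 mc cM); [apply: Lu; exact: ltW|exact: Lv].
- move=> t t0; have Lut := Lu t (ltW t0); have Lvt := Lv t t0.
  rewrite RintegralZl//; last exact: (integM3 mc cM).
  apply: is_derive_quotient.
  set l := 2 * _.
  suff C : `|h^-1 * (\int[mu]_x (c x * u (t + h) x ^+ 2) - \int[mu]_x (c x * u t x ^+ 2)) - l|
      @[h --> (0 : R)^'] --> (0 : R).
    by apply/cvgrPdist_le => e e0; move/cvgrPdist_le : C => /(_ e e0); apply: filterS => h;
      rewrite sub0r normrN normr_id distrC.
  pose g h := 2 * (M * nrm (u t)) * nrm (dq u v t h) + `|h| * (M * ((nrm (v t) + nrm (dq u v t h)) * (nrm (v t) + nrm (dq u v t h)))).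
  have Cg : g h @[h --> (0 : R)^'] -->
      2 * (M * nrm (u t)) * 0 + 0 * (M * ((nrm (v t) + 0) * (nrm (v t) + 0))).
    have C1 := Du t t0.
    have C2 : nrm (v t) + nrm (dq u v t h) @[h --> (0 : R)^'] --> nrm (v t) + 0.
      by apply: cvgD; [exact: cvg_cst|exact: C1].
    apply: cvgD; first by apply: cvgM; [exact: cvg_cst|exact: C1].
    by apply: cvgM; [exact: cvg_norm0|apply: cvgM; [exact: cvg_cst|exact: cvgM]].
  rewrite mulr0 mul0r addr0 in Cg.
  apply: cvg0_squeeze Cg; near=> h; rewrite normr_ge0/=.
  have th : 0 <= t + h by near: h; exact: near_shift_ge0.
  have h0 : h != 0 by near: h; exact: nbhs_dnbhs_neq.
  set A := dq u v t h; have LA : A \in L2 by exact: dq_L2.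
  have LB : (fun x => v t x + A x) \in L2 by exact: L2D.
  have E x : u (t + h) x = u t x + h * (v t x + A x).
    by rewrite /A /dq; field.
  under [X in h^-1 * (X - _)]eq_Rintegral do rewrite E.
  rewrite (quad_expand h mc cM Lut LB).
  have -> : \int[mu]_x (c x * (u t x * (v t x + A x))) =
     \int[mu]_x (c x * (u t x * v t x)) + \int[mu]_x (c x * (u t x * A x)).
    rewrite -RintegralD//; [|exact: (integM3 mc cM)|exact: (integM3 mc cM)].
    by apply: eq_Rintegral => x _; ring.
  rewrite /l; set I1 := \int[mu]_x (c x * (u t x * v t x)).
  have b2 := Rintegral_M3_le mc cM Lut LA; set I2 := \int[mu]_x (c x * (u t x * A x)) in b2 *.
  have b3 := Rintegral_M3_le mc cM LB LB; set I3 := \int[mu]_x _ in b3 *.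
  have -> : h^-1 * (2 * h * (I1 + I2) + h ^+ 2 * I3) - 2 * I1 = 2 * I2 + h * I3 by field.
  rewrite (le_trans (ler_normD _ _))// !normrM (ger0_norm (ler0n R 2)) /g lerD//.
    by rewrite -mulrA ler_wpM2l.
  rewrite ler_wpM2l// (le_trans b3)// -mulrA.
  have M0 : 0 <= M by rewrite (le_trans _ (cM point)).
  by rewrite ler_wpM2l// ler_pM ?nrmL2_ge0// nrmL2D.
- have Lu0 := Lu 0 (lexx 0).
  suff C : `|\int[mu]_x (c x * u h x ^+ 2) - \int[mu]_x (c x * u 0 x ^+ 2)|
      @[h --> (0 : R)^'+] --> (0 : R).
    by apply/cvgrPdist_le => e e0; move/cvgrPdist_le : C => /(_ e e0); apply: filterS => h;
      rewrite sub0r normrN normr_id distrC.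
  pose N h := nrm (fun x => u h x - u 0 x).
  have Cg : 2 * (M * nrm (u 0)) * N h + M * (N h * N h) @[h --> (0 : R)^'+] -->
      2 * (M * nrm (u 0)) * 0 + M * (0 * 0).
    by apply: cvgD; apply: cvgM => //; (try exact: cvg_cst); exact: cvgM.
  rewrite mul0r !mulr0 addr0 in Cg.
  apply: cvg0_squeeze Cg; near=> h; rewrite normr_ge0/=.
  have h0 : 0 <= h by near: h; exact: nbhs_right_ge.
  set A := fun x => u h x - u 0 x; have LA : A \in L2 by apply: L2B => //; exact: Lu.
  have E x : u h x = u 0 x + 1 * A x by rewrite /A mul1r; ring.
  under [X in `|X - _|]eq_Rintegral do rewrite E.
  rewrite (quad_expand 1 mc cM Lu0 LA) expr1n !mul1r mulr1.
  have b2 := Rintegral_M3_le mc cM Lu0 LA; set I2 := \int[mu]_x (c x * (u 0 x * A x)) in b2 *.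
  have b3 := Rintegral_M3_le mc cM LA LA; set I3 := \int[mu]_x _ in b3 *.
  rewrite (le_trans (ler_normD _ _))// !normrM (ger0_norm (ler0n R 2)) lerD//.
    by rewrite -mulrA ler_wpM2l.
  by rewrite mulrA.
Unshelve. all: by end_near. Qed.

End L2_curves.

(** * The energy inequality *)

Section energy.
Context d (T : measurableType d) (R : realType).
Variable mu : {measure set T -> \bar R}.
Local Notation L2 := (Lfun mu 2%:E).
Implicit Types (u v : R -> T -> R) (c : T -> R).

Definition bddm c : Prop := measurable_fun setT c /\ exists M : R, forall x, `|c x| <= M.

Lemma bddm_cst (k : R) : bddm (fun=> k).
Proof. by split=> //; exists `|k|. Qed.

Lemma bddmM c c' : bddm c -> bddm c' -> bddm (fun x => c x * c' x).
Proof.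
move=> [mc [M cM]] [mc' [M' cM']]; split; first exact: measurable_funM.
by exists (M * M') => x; rewrite normrM ler_pM.
Qed.

Lemma bddmD c c' : bddm c -> bddm c' -> bddm (fun x => c x + c' x).
Proof.
move=> [mc [M cM]] [mc' [M' cM']]; split; first exact: measurable_funD.
by exists (M + M') => x; rewrite (le_trans (ler_normD _ _))// lerD.
Qed.

Lemma bddmX c k : bddm c -> bddm (fun x => c x ^+ k).
Proof.
move=> bc; elim: k => [|k IH]; first by under eq_fun do rewrite expr0; exact: bddm_cst.
by under eq_fun do rewrite exprS; exact: bddmM.
Qed.

Lemma L2_bddm c f : bddm c -> f \in L2 -> (fun x => c x * f x) \in L2.
Proof. by move=> [mc [M cM]]; exact: L2M_bounded mc cM. Qed.

Lemma integ_bddm_sqr c f : bddm c -> f \in L2 -> integ mu (fun x => c x * f x ^+ 2).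
Proof.
by move=> [mc [M cM]] fL; under eq_fun do rewrite expr2; exact: (integM3 mc cM fL fL).
Qed.

Lemma L2curve_bddm c u v : bddm c -> L2curve mu u v ->
  L2curve mu (fun t x => c x * u t x) (fun t x => c x * v t x).
Proof. by move=> [mc [M cM]]; exact: L2curveM mc cM. Qed.

Lemma qcurve_bddm c u v : bddm c -> L2curve mu u v ->
  qcurve mu (fun t x => c x * u t x ^+ 2) (fun t x => 2 * (c x * (u t x * v t x))).
Proof. by move=> [mc [M cM]]; exact: qcurve_sqr mc cM. Qed.

(** Up to the weight m, the left side is the time derivative of the energy density. Completing two
    squares costs tau^2 (y4^2 + y5^2) and half of w1^2; tau <= 1 is used to pass from tau^4 to
    tau^2. *)
Lemma dissipation_le0 (a d0 tau w1 y4 y5 : R) : 0 <= a -> 0 < d0 -> 0 < tau -> tau <= 1 ->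
  d0 * a * (- w1 ^+ 2 + tau * y4 * w1 - tau ^+ 2 * w1 * y5
    - (2 * d0 + 1) * tau ^+ 2 * (y4 ^+ 2 + y5 ^+ 2)) <= 0.
Proof.
move=> a0 d00 t0 t1; rewrite mulr_ge0_le0 ?mulr_ge0 ?(ltW d00)//.
have t2 : tau ^+ 2 <= 1 by rewrite expr_le1 ?(ltW t0).
have h1 : 0 <= (1 - tau ^+ 2) * (tau ^+ 2 * y5 ^+ 2).
  by rewrite mulr_ge0 ?subr_ge0// mulr_ge0 ?sqr_ge0.
have h2 : 0 <= d0 * (tau ^+ 2 * (y4 ^+ 2 + y5 ^+ 2)).
  by rewrite mulr_ge0 ?(ltW d00)// mulr_ge0 ?sqr_ge0// addr_ge0 ?sqr_ge0.
have h3 := sqr_ge0 (2^-1 * w1 - tau * y4); have h4 := sqr_ge0 (2^-1 * w1 + tau ^+ 2 * y5).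
have h5 := sqr_ge0 w1.
rewrite -subr_ge0; set X := (X in 0 <= X).
have -> : X = (2^-1 * w1 - tau * y4) ^+ 2 + (2^-1 * w1 + tau ^+ 2 * y5) ^+ 2 + 2^-1 * w1 ^+ 2
  + (1 - tau ^+ 2) * (tau ^+ 2 * y5 ^+ 2) + 2 * (d0 * (tau ^+ 2 * (y4 ^+ 2 + y5 ^+ 2))).
  by rewrite /X; field.
lra.
Qed.

(** Here w = z2 - tau w1 and w1 = z3 + tau y4, so w is recovered from the squares. In the constant L
    = 4 + 8 / d0, the inequality 4 <= L pays for z2 and 8 <= L d0 for z3. *)
Lemma energy_coercive (a d0 tau w w1 w2 y4 y5 z6 : R) : 0 <= a -> 0 < d0 -> 0 < tau -> tau <= 1 ->
  a * w ^+ 2 <= (4 + 8 / d0) * (2^-1 * (w1 + tau * w2) ^+ 2 + 2^-1 * a * (w + tau * w1) ^+ 2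
    + 2^-1 * d0 * tau * a * (w1 - tau * y4) ^+ 2 - 2^-1 * d0 * tau ^+ 3 * a * y4 ^+ 2
    + (2 * d0 + 1) * tau ^+ 2 * 2^-1 * (y4 ^+ 2 + a * z6 ^+ 2 + y5 ^+ 2 + a * y4 ^+ 2)).
Proof.
move=> a0 d00 t0 t1; set L := 4 + 8 / d0.
have L4 : 4 <= L by rewrite /L lerDl divr_ge0// ltW.
have L0 : 0 <= L by rewrite (le_trans _ L4).
have Ld : 8 <= L * d0 by rewrite /L mulrDl divfK ?gt_eqF// lerDr mulr_ge0// ltW.
have S (x y : R) : (x + y) ^+ 2 <= 2 * x ^+ 2 + 2 * y ^+ 2 by have := sqr_ge0 (x - y); nra.
set z2 := w + tau * w1; set z3 := w1 - tau * y4.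
have E1 : a * w ^+ 2 <= a * (2 * z2 ^+ 2 + 2 * (tau * w1) ^+ 2).
  apply: ler_wpM2l => //; have := S z2 (- (tau * w1)); rewrite sqrrN.
  by rewrite (_ : z2 + _ = w)// /z2; ring.
have E2 : a * w1 ^+ 2 <= a * (2 * z3 ^+ 2 + 2 * (tau * y4) ^+ 2).
  apply: ler_wpM2l => //; have := S z3 (tau * y4).
  by rewrite (_ : z3 + _ = w1)// /z3; ring.
have E3 : 2 * tau ^+ 2 * (a * w1 ^+ 2) <= 2 * tau ^+ 2 * (a * (2 * z3 ^+ 2 + 2 * (tau * y4) ^+ 2)).
  by apply: ler_wpM2l => //; rewrite mulr_ge0// sqr_ge0.
have A2 : 0 <= a * z2 ^+ 2 by rewrite mulr_ge0// sqr_ge0.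
have A3 : 0 <= a * z3 ^+ 2 by rewrite mulr_ge0// sqr_ge0.
have A4 : 0 <= a * y4 ^+ 2 by rewrite mulr_ge0// sqr_ge0.
have t2 : tau ^+ 2 <= tau by rewrite expr2 ler_piMl// ltW.
have tp := ltW t0; have dp := ltW d00; have t20 := sqr_ge0 tau.
have F2 : 4 * (a * z2 ^+ 2) <= L * (a * z2 ^+ 2) by exact: ler_wpM2r.
have F3 : 8 * tau ^+ 2 * (a * z3 ^+ 2) <= L * d0 * tau * (a * z3 ^+ 2).
  by apply: ler_wpM2r => //; rewrite ler_pM// mulr_ge0.
have F4 : 8 * tau ^+ 4 * (a * y4 ^+ 2) <= L * (2 * d0 + 1 - d0 * tau) * tau ^+ 2 * (a * y4 ^+ 2).
  apply: ler_wpM2r => //; rewrite (_ : tau ^+ 4 = tau ^+ 2 * tau ^+ 2); last by ring.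
  rewrite mulrA; apply: ler_wpM2r => //.
  have : d0 * tau <= d0 by rewrite ler_piMr.
  have : 8 * tau ^+ 2 <= 8 by rewrite ler_piMr// expr_le1.
  have : 0 <= L * (d0 - d0 * tau) by rewrite mulr_ge0// subr_ge0 ler_piMr.
  by rewrite (_ : L * (2 * d0 + 1 - d0 * tau) = L * d0 + L + L * (d0 - d0 * tau)); [lra|ring].
have G1 : 0 <= L * (2^-1 * (w1 + tau * w2) ^+ 2) by rewrite mulr_ge0// mulr_ge0 ?sqr_ge0.
have G2 : 0 <= L * ((2 * d0 + 1) * tau ^+ 2 * 2^-1 * (y4 ^+ 2 + a * z6 ^+ 2 + y5 ^+ 2)).
  apply: mulr_ge0 => //; apply: mulr_ge0; first by rewrite !mulr_ge0// addr_ge0// mulr_ge0.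
  by rewrite !addr_ge0 ?sqr_ge0// mulr_ge0// sqr_ge0.
rewrite -subr_ge0; set X := (X in 0 <= X).
have -> : X = L * (2^-1 * (w1 + tau * w2) ^+ 2)
   + L * ((2 * d0 + 1) * tau ^+ 2 * 2^-1 * (y4 ^+ 2 + a * z6 ^+ 2 + y5 ^+ 2))
   + 2^-1 * (L * (a * z2 ^+ 2)) + 2^-1 * (L * d0 * tau * (a * z3 ^+ 2))
   + 2^-1 * (L * (2 * d0 + 1 - d0 * tau) * tau ^+ 2 * (a * y4 ^+ 2)) - a * w ^+ 2.
  by rewrite /X; field.
have E4 : a * (2 * z2 ^+ 2 + 2 * (tau * w1) ^+ 2) = 2 * (a * z2 ^+ 2) + 2 * tau ^+ 2 * (a * w1 ^+ 2) by ring.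
have E5 : 2 * tau ^+ 2 * (a * (2 * z3 ^+ 2 + 2 * (tau * y4) ^+ 2)) =
  4 * tau ^+ 2 * (a * z3 ^+ 2) + 4 * tau ^+ 4 * (a * y4 ^+ 2) by ring.
rewrite E4 in E1; rewrite E5 in E3; lra.
Qed.

(** The first factor is half the weight of the energies of phi, without tau^2; the last one is the
    constant [D] of [energy_initial], the outcome of repeated use of (x + y)^2 <= 2 x^2 + 2 y^2. *)
Definition Cinit (d0 : R) : R :=
  (2 * d0 + 1) * 2^-1 * (3 + 2 * (1 + d0 ^+ 2) * (1 + 2 * d0 ^+ 2)).

(** The left side is the whole energy at time 0. Each of its terms is bounded by a times a
    polynomial of degree at most 3 in a, hence by a multiple of a (1 + a)^3; the factor a is kept
    apart to match the one in [energy_coercive]. *)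
Lemma energy_initial (a d0 tau p q y4 y5 : R) : 0 <= a -> 0 < d0 -> 0 < tau ->
  y4 = - a * p - d0 * a * q -> y5 = - a * q - d0 * a * y4 ->
  (2 * d0 + 1) * tau ^+ 2 * 2^-1 * (y4 ^+ 2 + a * q ^+ 2 + y5 ^+ 2 + a * y4 ^+ 2)
  <= Cinit d0 * tau ^+ 2 * (a * ((1 + a) ^+ 4 * p ^+ 2 + (1 + a) ^+ 3 * q ^+ 2)).
Proof.
move=> a0 d00 t0 y4E y5E.
have [e0 kpos] : 0 <= d0 ^+ 2 /\ 0 <= 2 * d0 + 1 by rewrite sqr_ge0 addr_ge0// mulr_ge0// ltW.
have S (x y : R) : (x + y) ^+ 2 <= 2 * x ^+ 2 + 2 * y ^+ 2 by have := sqr_ge0 (x - y); nra.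
set e := d0 ^+ 2 in e0 *; set b := 1 + a.
have b1 : 1 <= b by rewrite /b lerDl.
have b0 : 0 <= b by rewrite (le_trans _ b1).
have ab : a <= b by rewrite /b lerDr.
have bX k : 1 <= b ^+ k by exact: exprn_ege1.
have [p0 q0] := (sqr_ge0 p, sqr_ge0 q).
have Y4 : y4 ^+ 2 <= a * (a * (2 * p ^+ 2 + 2 * (e * q ^+ 2))).
  have := S p (d0 * q); rewrite exprMn -/e => h.
  rewrite (_ : y4 ^+ 2 = a * (a * (p + d0 * q) ^+ 2)); last by rewrite y4E; ring.
  by rewrite !ler_wpM2l.
have Y5 : y5 ^+ 2 <= a * (a * (2 * q ^+ 2)) + 2 * e * (a ^+ 2 * y4 ^+ 2).
  have := S q (d0 * y4); rewrite exprMn -/e => h.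
  rewrite (_ : y5 ^+ 2 = a * (a * (q + d0 * y4) ^+ 2)); last by rewrite y5E; ring.
  rewrite (_ : _ + _ = a * (a * (2 * q ^+ 2 + 2 * (e * y4 ^+ 2)))); last by ring.
  by rewrite !ler_wpM2l.
pose P := a * b ^+ 3 * p ^+ 2; pose Q := a * b ^+ 3 * q ^+ 2.
have a20 : 0 <= a ^+ 2 by exact: sqr_ge0.
have b3 : b ^+ 3 = 1 + 3 * a + 3 * a ^+ 2 + a ^+ 3 by rewrite /b; ring.
have a30 : 0 <= a ^+ 3 by exact: exprn_ge0.
have b30 : 0 <= b ^+ 3 by exact: exprn_ge0.
have P0 : 0 <= P by rewrite /P mulr_ge0// mulr_ge0.
have Q0 : 0 <= Q by rewrite /Q mulr_ge0// mulr_ge0.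
have H1 : (1 + a + 2 * e * a ^+ 2) * y4 ^+ 2 <= (1 + 2 * e) * (2 * P + 2 * (e * Q)).
  have c0 : 0 <= 1 + a + 2 * e * a ^+ 2 by apply: addr_ge0; [exact: addr_ge0|by rewrite mulr_ge0// mulr_ge0].
  apply: le_trans (ler_wpM2l c0 Y4) _.
  rewrite [leLHS](_ : _ = a * (a * (1 + a + 2 * e * a ^+ 2)) * (2 * p ^+ 2 + 2 * (e * q ^+ 2))); last by ring.
  rewrite [leRHS](_ : _ = a * ((1 + 2 * e) * b ^+ 3) * (2 * p ^+ 2 + 2 * (e * q ^+ 2))); last by rewrite /P /Q; ring.
  apply: ler_wpM2r; first by have := mulr_ge0 e0 q0; lra.
  apply: ler_wpM2l => //; rewrite b3.
  have h1 := mulr_ge0 e0 a0; have h2 := mulr_ge0 e0 a20; have h3 := mulr_ge0 e0 a30.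
  rewrite -subr_ge0 [X in 0 <= X](_ : _ = 1 + 2 * a + 2 * a ^+ 2 + a ^+ 3 + 2 * e + 6 * (e * a) + 6 * (e * a ^+ 2)); last by ring.
  lra.
have H2 : a * q ^+ 2 + a * (a * (2 * q ^+ 2)) <= 3 * Q.
  rewrite (_ : _ + _ = a * ((1 + 2 * a) * q ^+ 2)); last by ring.
  rewrite (_ : 3 * Q = a * ((3 * b ^+ 3) * q ^+ 2)); last by rewrite /Q; ring.
  by rewrite ler_wpM2l// ler_wpM2r// b3; lra.
have H3 : y4 ^+ 2 + a * q ^+ 2 + y5 ^+ 2 + a * y4 ^+ 2 <= (3 + 2 * (1 + e) * (1 + 2 * e)) * (P + Q).
  have := mulr_ge0 e0 P0; have := mulr_ge0 e0 Q0; have := mulr_ge0 e0 (mulr_ge0 e0 P0).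
  have := mulr_ge0 e0 (mulr_ge0 e0 Q0).
  rewrite (_ : (1 + a + 2 * e * a ^+ 2) * y4 ^+ 2 = y4 ^+ 2 + a * y4 ^+ 2 + 2 * e * (a ^+ 2 * y4 ^+ 2)) in H1; last by ring.
  rewrite (_ : (1 + 2 * e) * (2 * P + 2 * (e * Q)) = 2 * P + 4 * (e * P) + 2 * (e * Q) + 4 * (e * (e * Q))) in H1; last by ring.
  rewrite (_ : (3 + 2 * (1 + e) * (1 + 2 * e)) * (P + Q) = 5 * P + 5 * Q + 6 * (e * P) + 6 * (e * Q) + 4 * (e * (e * P)) + 4 * (e * (e * Q))); last by ring.
  lra.
have H4 : P + Q <= a * (b ^+ 4 * p ^+ 2 + b ^+ 3 * q ^+ 2).
  have -> : P + Q = a * (b ^+ 3 * p ^+ 2 + b ^+ 3 * q ^+ 2) by rewrite /P /Q; ring.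
  by rewrite ler_wpM2l// lerD2r ler_wpM2r// [leRHS]exprS ler_peMl.
rewrite /Cinit -/e.
set D := 3 + _ in H3 *.
have D0 : 0 <= D by have := mulr_ge0 e0 e0; rewrite /D; nra.
rewrite [leRHS](_ : _ = (2 * d0 + 1) * tau ^+ 2 * 2^-1 * (D * (a * (b ^+ 4 * p ^+ 2 + b ^+ 3 * q ^+ 2)))); last by ring.
apply: ler_wpM2l; first by rewrite mulr_ge0// mulr_ge0// sqr_ge0.
by apply: le_trans H3 _; rewrite ler_wpM2l.
Qed.

(** In the application [al] is the cut-off |xi|^2, the p_i and f_i are the cut-off transforms of
    psi, phi and their time derivatives, and [m] is an arbitrary weight divided by |xi|^2. *)
Variables (m al : T -> R) (delta tau : R).
Hypotheses (bm : bddm m) (m0 : forall x, 0 <= m x) (bal : bddm al) (al0 : forall x, 0 <= al x).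
Hypotheses (delta0 : 0 < delta) (tau0 : 0 < tau) (tau1 : tau <= 1).
Variables (p0 p1 p2 p3 f0 f1 f2 : R -> T -> R).
Hypotheses (P01 : L2curve mu p0 p1) (P12 : L2curve mu p1 p2) (P23 : L2curve mu p2 p3).
Hypotheses (F01 : L2curve mu f0 f1) (F12 : L2curve mu f1 f2).
Hypothesis peq : forall t : R, 0 < t -> {ae mu, forall x,
  tau * p3 t x + p2 t x + al x * p0 t x + (delta + tau) * (al x * p1 t x) = 0}.
Hypothesis feq : forall t : R, 0 < t -> {ae mu, forall x,
  f2 t x + al x * f0 t x + delta * (al x * f1 t x) = 0}.
Variables p q : T -> R.
Hypotheses (p00 : {ae mu, forall x, p0 0 x = p x}) (f00 : {ae mu, forall x, f0 0 x = p x}).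
Hypotheses (p10 : {ae mu, forall x, p1 0 x = q x}) (f10 : {ae mu, forall x, f1 0 x = q x}).
Hypothesis p20 : {ae mu, forall x, p2 0 x = - al x * p x - delta * al x * q x}.
Hypotheses (pL : p \in L2) (qL : q \in L2).

(** The value of phi_tt given by the equation. Unlike [f2], it is differentiable in time because
    [f0] and [f1] are and [al] is bounded; [y5] and [y6] are the next two derivatives. *)
Let y4 (t : R) (x : T) : R := - al x * f0 t x - delta * al x * f1 t x.
Let y5 (t : R) (x : T) : R := - al x * f1 t x - delta * al x * y4 t x.
Let y6 (t : R) (x : T) : R := - al x * y4 t x - delta * al x * y5 t x.

Let bnal : bddm (fun x => - al x).
Proof. by under eq_fun do rewrite -mulN1r; apply: bddmM => //; exact: bddm_cst. Qed.

Let bdal : bddm (fun x => delta * al x).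
Proof. by apply: bddmM => //; exact: bddm_cst. Qed.

Let L2curve_y u v w : L2curve mu u v -> L2curve mu v w ->
  L2curve mu (fun t x => - al x * u t x - delta * al x * v t x)
             (fun t x => - al x * v t x - delta * al x * w t x).
Proof. by move=> uv vw; apply: L2curveB; exact: L2curve_bddm. Qed.

Let mL2 u v (t : R) : L2curve mu u v -> 0 < t -> measurable_fun setT (u t).
Proof. by move=> [Lu _ _ _] t0; apply: L2_measurable; apply: Lu; exact: ltW. Qed.

Let measurable_y4 (t : R) : 0 < t -> measurable_fun setT (y4 t).
Proof.
move=> t0; have [[mn _] [md _]] := (bnal, bdal).
apply: measurable_funB; apply: measurable_funM => //; first exact: mL2 F01 t0.
exact: mL2 F12 t0.
Qed.

Let Y4 : L2curve mu f1 y4.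
Proof.
apply: (L2curve_ae F12) => t t0; split; first exact: measurable_y4.
by apply: filterS (feq t0) => x; rewrite /y4 => h; lra.
Qed.

Let Y45 : L2curve mu y4 y5. Proof. exact: L2curve_y F01 Y4. Qed.

Let Y56 : L2curve mu y5 y6. Proof. exact: L2curve_y Y4 Y45. Qed.

Let w (t : R) (x : T) : R := p0 t x - f0 t x.
Let w1 (t : R) (x : T) : R := p1 t x - f1 t x.
Let w2 (t : R) (x : T) : R := p2 t x - y4 t x.
Let w3 (t : R) (x : T) : R := p3 t x - y5 t x.
Let z1 (t : R) (x : T) : R := w1 t x + tau * w2 t x.
Let z1' (t : R) (x : T) : R := w2 t x + tau * w3 t x.
Let z2 (t : R) (x : T) : R := w t x + tau * w1 t x.
(** After the first two squares are differentiated, the products w1 w2 and y4 w2 remain, with w2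
    under no control. The derivative of the square of [z3] cancels both and leaves only w1 y5 and y4
    y5. *)
Let z3 (t : R) (x : T) : R := w1 t x - tau * y4 t x.
Let z3' (t : R) (x : T) : R := w2 t x - tau * y5 t x.

Let W01 : L2curve mu w w1. Proof. exact: L2curveB P01 F01. Qed.
Let W12 : L2curve mu w1 w2. Proof. exact: L2curveB P12 Y4. Qed.
Let W23 : L2curve mu w2 w3. Proof. exact: L2curveB P23 Y45. Qed.
Let Z1 : L2curve mu z1 z1'. Proof. exact: (L2curveD W12 (L2curveZ tau W23)). Qed.
Let Z2 : L2curve mu z2 z1. Proof. exact: (L2curveD W01 (L2curveZ tau W12)). Qed.
Let Z3 : L2curve mu z3 z3'. Proof. exact: (L2curveB W12 (L2curveZ tau Y45)). Qed.

(** In 2 * delta + 1, the 1 pays for the cross terms of the dissipation, and 2 * delta keeps the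
    energy coercive in spite of the negative square of [y4]. *)
Let k4 : R := (2 * delta + 1) * tau ^+ 2 * 2^-1.

(* The first three squares control the difference w; the fourth one cancels a cross term of the
   dissipation; those with weight k4 involve phi only and absorb the source terms, all of which
   carry a factor tau. *)
Let G (t : R) (x : T) : R := 2^-1 * m x * z1 t x ^+ 2 + 2^-1 * (m x * al x) * z2 t x ^+ 2
  + 2^-1 * delta * tau * (m x * al x) * z3 t x ^+ 2
  + (- (2^-1 * delta * tau ^+ 3)) * (m x * al x) * y4 t x ^+ 2
  + k4 * m x * y4 t x ^+ 2 + k4 * (m x * al x) * f1 t x ^+ 2
  + k4 * m x * y5 t x ^+ 2 + k4 * (m x * al x) * y4 t x ^+ 2.

Let F (t : R) (x : T) : R := 2 * (2^-1 * m x * (z1 t x * z1' t x)) + 2 * (2^-1 * (m x * al x) * (z2 t x * z1 t x))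
  + 2 * (2^-1 * delta * tau * (m x * al x) * (z3 t x * z3' t x))
  + 2 * ((- (2^-1 * delta * tau ^+ 3)) * (m x * al x) * (y4 t x * y5 t x))
  + 2 * (k4 * m x * (y4 t x * y5 t x)) + 2 * (k4 * (m x * al x) * (f1 t x * y4 t x))
  + 2 * (k4 * m x * (y5 t x * y6 t x)) + 2 * (k4 * (m x * al x) * (y4 t x * y5 t x)).

Let qcurveGF : qcurve mu G F.
Proof.
by repeat apply: qcurveD; apply: qcurve_bddm => //; do ?apply: bddmM => //; exact: bddm_cst.
Qed.

Let F_le0 (t : R) : 0 < t -> {ae mu, forall x, F t x <= 0}.
Proof.
move=> t0; apply: filterS (peq t0) => x h.
(* Subtracting the two equations leaves the source - tau (phi_ttt + al phi_t), which by the
   definition of [y5] equals tau * delta * al * [y4]. *)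
have E : z1' t x = - al x * z2 t x - delta * al x * w1 t x + tau * delta * al x * y4 t x.
  have e3 : tau * p3 t x = - p2 t x - al x * p0 t x - (delta + tau) * (al x * p1 t x) by lra.
  rewrite /z1' /w3 mulrBr e3 /w2 /z2 /w /w1 /y5 /y4; ring.
have := dissipation_le0 (w1 t x) (y4 t x) (y5 t x) (al0 x) delta0 tau0 tau1.
move=> /(ler_wpM2l (m0 x)); rewrite mulr0; apply: le_trans; rewrite le_eqVlt; apply/orP; left; apply/eqP.
rewrite /F E /z1 /z2 /z3 /z3' /y6 /k4.
by have -> : y5 t x = - al x * f1 t x - delta * al x * y4 t x by []; field.
Qed.

Lemma energy_estimate (t : R) : 0 <= t ->
  \int[mu]_x (m x * al x * (p0 t x - f0 t x) ^+ 2) <=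
  (4 + 8 / delta) * Cinit delta * tau ^+ 2 *
    \int[mu]_x (m x * al x * ((1 + al x) ^+ 4 * p x ^+ 2 + (1 + al x) ^+ 3 * q x ^+ 2)).
Proof.
move=> t0; have [IG _ _ _] := qcurveGF.
have L0 : 0 <= 4 + 8 / delta by rewrite addr_ge0// divr_ge0// ltW.
have [Lw _ _ _] := W01.
have I1 : integ mu (fun x => m x * al x * (p0 t x - f0 t x) ^+ 2).
  by apply: integ_bddm_sqr; [exact: bddmM|exact: Lw].
have I2 : integ mu (fun x => m x * al x * ((1 + al x) ^+ 4 * p x ^+ 2 + (1 + al x) ^+ 3 * q x ^+ 2)).
  have b1 : bddm (fun x => 1 + al x) by apply: bddmD => //; exact: bddm_cst.
  have Ip : integ mu (fun x => m x * al x * (1 + al x) ^+ 4 * p x ^+ 2).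
    by apply: integ_bddm_sqr => //; apply: bddmM; [exact: bddmM|exact: bddmX].
  have Iq : integ mu (fun x => m x * al x * (1 + al x) ^+ 3 * q x ^+ 2).
    by apply: integ_bddm_sqr => //; apply: bddmM; [exact: bddmM|exact: bddmX].
  rewrite (_ : (fun x => _) = (fun x => m x * al x * (1 + al x) ^+ 4 * p x ^+ 2 +
    m x * al x * (1 + al x) ^+ 3 * q x ^+ 2)); first exact: integD.
  by apply/funext => x; rewrite mulrDr !mulrA.
apply: (@le_trans _ _ ((4 + 8 / delta) * \int[mu]_x G t x)).
  rewrite -(RintegralZl _ measurableT (IG t t0)); apply: ler_Rintegral => //.
    by apply: integZ; exact: IG.
  move=> x; have := energy_coercive (w t x) (w1 t x) (w2 t x) (y4 t x) (y5 t x) (f1 t x) (al0 x) delta0 tau0 tau1.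
  move=> /(ler_wpM2l (m0 x)); rewrite mulrA => /le_trans; apply.
  by rewrite le_eqVlt; apply/orP; left; apply/eqP; rewrite /G /k4 /z1 /z2 /z3; ring.
rewrite -2![leRHS]mulrA ler_wpM2l// mulrA.
apply: (le_trans (qcurve_decreasing qcurveGF F_le0 t0)).
rewrite -(RintegralZl _ measurableT I2).
apply: ae_le_Rintegral; [exact: IG|exact: integZ|].
apply: filterS3 p00 p10 _; last first.
  apply: filterS3 f00 f10 p20 => x e1 e2 e3; exact: (conj e1 (conj e2 e3)).
move=> x e4 e5 [e1 [e2 e3]].
(* Compatibility: psi_tt and phi_tt agree at time 0, so w, w1 and w2 vanish there. What is left of
   the third square cancels the negative one. *)
have Y : y4 0 x = - al x * p x - delta * al x * q x by rewrite /y4 e1 e2.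
have := energy_initial (al0 x) delta0 tau0 Y erefl.
move=> /(ler_wpM2l (m0 x)) h; apply: le_trans (le_trans _ h) _; rewrite le_eqVlt; apply/orP; left; apply/eqP.
  rewrite /G /z1 /z2 /z3 /w /w1 /w2 /y5 e1 e2 e3 e4 e5 -Y /k4; by field.
ring.
Qed.

End energy.

(** * The difference of the solutions in frequency *)

Section frequency_estimate.
Context (R : realType) (n : nat).
Local Notation V := 'rV[R]_n.
Local Notation mu := (lebesgue_rV R n).
Local Notation L2 := (Lfun mu 2%:E).
Local Notation nrm := (nrmL2 mu).
Implicit Types (f g : V -> R) (u v : R -> V -> R).

(** For t > 0 the restriction 0 <= t + h holds for all small h, so the derivative is two-sided; at t
    = 0 the one-sided derivative yields right continuity. *)
Lemma L2curve_of_derive u v : (forall t : R, 0 <= t -> in_L2 (u t)) ->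
  (forall t : R, 0 <= t -> in_L2 (v t)) ->
  (forall t : R, 0 <= t -> is_L2_derive u v t) -> L2curve mu u v.
Proof.
move=> Lu Lv uv.
have dL (t h : R) : 0 <= t -> 0 <= t + h -> dq u v t h \in L2.
  by move=> t0 th; apply: L2B; [apply: L2Z; apply: L2B; exact: Lu|exact: Lv].
have C (t : R) : 0 <= t -> nrm (dq u v t h) @[h --> within [set h | 0 <= t + h] (0 : R)^'] --> (0 : R).
  move=> t0; have /fine_cvg := uv t t0; apply: cvg_trans; apply: near_eq_cvg.
  near=> h; have th : 0 <= t + h by near: h; exact: withinT.
  by rewrite /= /Lp_norm Lnorm2E//; exact: dL.
split=> //.
- by move=> t t0; apply: Lv; exact: ltW.
- move=> t t0; apply: cvg_trans (C t (ltW t0)); apply: cvg_app => P.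
  rewrite /within/= => PP; near=> h.
  have th : 0 <= t + h by near: h; exact: near_shift_ge0.
  by move: th; near: h.
- have C0 := C 0 (lexx 0).
  (* The increment is h (quotient error + derivative), so its norm is at most |h| times a bounded
     quantity. *)
  have C1 : `|h| * (nrm (dq u v 0 h) + nrm (v 0)) @[h --> (0 : R)^'+] --> 0 * (0 + nrm (v 0)).
    apply: cvgM; last apply: cvgD; last exact: cvg_cst.
      have nc := @norm_continuous R R 0; rewrite /continuous_at normr0 in nc.
      exact: cvg_within_filter nc.
    apply: cvg_trans C0; apply: cvg_app => P.
    rewrite /within/= => PP.
    have PP' : \forall h \near (0 : R), h != 0 -> 0 <= 0 + h -> P h by exact: PP.
    near=> h; have h0 : 0 < h by near: h; exact: nbhs_right_gt.
    have : h != 0 by rewrite gt_eqF.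
    have : 0 <= 0 + h by rewrite add0r ltW.
    near: h; apply: cvg_within; apply: filterS PP' => h PP' h1 h2; exact: PP'.
  rewrite mul0r in C1; apply: cvg0_squeeze C1; near=> h.
  have h0 : 0 < h by near: h; exact: nbhs_right_gt.
  have h1 : 0 <= 0 + h by rewrite add0r ltW.
  have dL0 := dL 0 h (lexx 0) h1; have v0 := Lv 0 (lexx 0).
  rewrite nrmL2_ge0/= (_ : (fun x => u h x - u 0 x) = (fun x => h * (dq u v 0 h x + v 0 x))).
    by rewrite nrmL2Z ?ler_wpM2l ?nrmL2D//; exact: L2D.
  by apply/funext => x; rewrite /dq add0r subrK mulrA mulfV ?mul1r// gt_eqF.
Unshelve. all: by end_near. Qed.

Lemma HT_dq u v (t h : R) : u (t + h) \in L2 -> u t \in L2 -> v t \in L2 ->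
  {ae mu, forall xi, HT (dq u v t h) xi = dq (fun s => HT (u s)) (fun s => HT (v s)) t h xi}.
Proof.
move=> h1 h2 h3; have h4 := L2B h1 h2; have h5 := L2Z h^-1 h4.
apply: filterS3 (HTB h5 h3) (HTZ h^-1 h4) (HTB h1 h2) => xi e1 e2 e3.
by rewrite /dq e1 e2 e3.
Qed.

(** [HT] commutes with difference quotients almost everywhere and does not increase the norm. *)
Lemma L2curve_HT u v : L2curve mu u v -> L2curve mu (fun t => HT (u t)) (fun t => HT (v t)).
Proof.
move=> uv; have [Lu Lv Du Cu] := uv; split.
- by move=> t t0; apply: HT_L2; exact: Lu.
- by move=> t t0; apply: HT_L2; exact: Lv.
- move=> t t0; apply: cvg0_squeeze (Du t t0); near=> h; rewrite nrmL2_ge0/=.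
  have th : 0 <= t + h by near: h; exact: near_shift_ge0.
  have dL := dq_L2 uv t0 th.
  have [h1 h2 h3] : [/\ u (t + h) \in L2, u t \in L2 & v t \in L2].
    by split; [exact: Lu|apply: Lu; exact: ltW|exact: Lv].
  apply: le_trans (HT_contract dL).
  rewrite (nrmL2_ae (HT_L2 dL) _ (HT_dq h1 h2 h3))//.
  by apply: L2_measurable; apply: L2B; [apply: L2Z; apply: L2B|]; exact: HT_L2.
- apply: cvg0_squeeze Cu; near=> h; rewrite nrmL2_ge0/=.
  have h0 : 0 <= h by near: h; exact: nbhs_right_ge.
  have [h1 h2] : u h \in L2 /\ u 0 \in L2 by split; exact: Lu.
  apply: le_trans (HT_contract (L2B h1 h2)).
  rewrite (nrmL2_ae (HT_L2 (L2B h1 h2)) _ (HTB h1 h2))//.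
  by apply: L2_measurable; apply: L2B; exact: HT_L2.
Unshelve. all: by end_near. Qed.

(** The origin is a degenerate box, null as soon as the dimension is positive; in dimension 0 it
    would be the whole space. *)
Lemma ae_dotp_neq0 : (0 < n)%N -> {ae mu, forall xi, dotp xi xi != 0}.
Proof.
move=> n0; exists [set x : V | forall i, [set (0 : R)] (x ord0 i)]; split.
- rewrite (_ : [set x : V | _] = \bigcap_(i in [set: 'I_n]) (coord_rV i @^-1` [set (0 : R)])).
    apply: fin_bigcap_measurable => // i _.
    by rewrite -[X in measurable X]setTI; apply: measurable_coord_rV.
  by apply/seteqP; split => x h i; [move=> _; exact: (h i)|exact: (h i I)].
- apply: (eq_trans (@lebesgue_rV_box R n (fun=> [set 0]) (fun=> measurable_set1 0))); case: n n0 => // k _.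
  by rewrite big_ord_recl lebesgue_measure_set1 mul0e.
- move=> xi /= /negP; rewrite negbK => /eqP h i.
  have : forall j : 'I_n, true -> xi ord0 j * xi ord0 j = 0.
    by apply: psumr_eq0P => // j _; rewrite -expr2 sqr_ge0.
  by move=> /(_ i isT)/eqP; rewrite mulf_eq0 orbb => /eqP.
Qed.

(* On the support of the cutoff both |xi|^2 and its inverse are bounded multipliers, so that the
   energy can be differentiated under the integral although psi is only an L2-valued curve. *)
Definition kap (k : nat) (xi : V) : R :=
  if (k.+1%:R^-1 <= dotp xi xi) && (dotp xi xi <= k.+1%:R) then 1 else 0.

Lemma kapP k xi : kap k xi = 0 \/
  [/\ kap k xi = 1, k.+1%:R^-1 <= dotp xi xi & dotp xi xi <= k.+1%:R].
Proof. by rewrite /kap; case: ifP => [/andP[]|]; [right|left]. Qed.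

Lemma kap_sqr k xi : kap k xi * kap k xi = kap k xi.
Proof. by rewrite /kap; case: ifP; rewrite ?mulr1 ?mulr0. Qed.

Lemma dotp_ge0 (xi : V) : 0 <= dotp xi xi.
Proof. by apply: sumr_ge0 => i _; rewrite -expr2 sqr_ge0. Qed.

Lemma measurable_kap k : measurable_fun setT (kap k).
Proof.
apply: measurable_fun_ifT => //; apply: measurable_and; apply: measurable_fun_ler => //;
  exact: measurable_normsq.
Qed.

Lemma cvg_kap xi : dotp xi xi != 0 -> kap k xi @[k --> \oo] --> (1 : R).
Proof.
move=> x0; have xp : 0 < dotp xi xi by rewrite lt_neqAle eq_sym x0 dotp_ge0.
apply: cvg_near_cst; near=> k.
have h1 : dotp xi xi <= k.+1%:R.
  near: k; exists (Num.truncn (dotp xi xi)).+1 => // j /= hj.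
  by rewrite (le_trans (ltW (truncnS_gt _)))// ler_nat (leq_trans hj).
have h2 : k.+1%:R^-1 <= dotp xi xi.
  near: k; exists (Num.truncn (dotp xi xi)^-1).+1 => // j /= hj.
  rewrite invf_ple ?posrE//.
  by rewrite (le_trans (ltW (truncnS_gt _)))// ler_nat (leq_trans hj).
by rewrite /kap h1 h2.
Unshelve. all: by end_near. Qed.

Lemma bddm_kap k : bddm (kap k).
Proof.
split; first exact: measurable_kap.
by exists 1 => xi; rewrite /kap; case: ifP; rewrite ?normr1 ?normr0.
Qed.

Lemma bddm_kap_dotp k : bddm (fun xi => kap k xi * dotp xi xi).
Proof.
split; first by apply: measurable_funM; [exact: measurable_kap|exact: measurable_normsq].
exists k.+1%:R => xi; have [->|[-> h1 h2]] := kapP k xi; first by rewrite mul0r normr0.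
by rewrite mul1r ger0_norm// dotp_ge0.
Qed.

Lemma bddm_kap_inv k : bddm (fun xi => kap k xi / dotp xi xi).
Proof.
split.
  apply: measurable_funM; first exact: measurable_kap.
  rewrite (_ : (fun xi => _) = (fun xi : V => dotp xi xi `^ (-1))); last first.
    by apply/funext => xi; rewrite powR_inv1 ?dotp_ge0.
  exact: (measurableT_comp (@measurable_powR R (-1)) (@measurable_normsq R n)).
exists k.+1%:R => xi; have [->|[-> h1 h2]] := kapP k xi; first by rewrite mul0r normr0.
rewrite mul1r ger0_norm ?invr_ge0 ?dotp_ge0// invf_ple ?posrE//.
by apply: lt_le_trans h1; rewrite invr_gt0.
Qed.

(** Four terms is the length of the MGT equation; the equation of phi and the compatibility
    condition are obtained with a zero coefficient. *)
Lemma HT_lincomb4 (a b c e : R) (f1 f2 f3 f4 : V -> R) :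
  f1 \in L2 -> f2 \in L2 -> f3 \in L2 -> f4 \in L2 ->
  {ae mu, forall x, a * f1 x + b * f2 x + c * f3 x + e * f4 x = 0} ->
  {ae mu, forall xi, a * HT f1 xi + b * HT f2 xi + c * HT f3 xi + e * HT f4 xi = 0}.
Proof.
move=> h1 h2 h3 h4 E.
have [k1 k2 k3 k4] : [/\ (fun x => a * f1 x) \in L2, (fun x => b * f2 x) \in L2,
  (fun x => c * f3 x) \in L2 & (fun x => e * f4 x) \in L2] by split; exact: L2Z.
have k12 := L2D k1 k2; have k123 := L2D k12 k3; have k1234 := L2D k123 k4.
have H0 := HT_ae k1234 (L2Z 0 h1) (filterS _ E).
have {}H0 : {ae mu, forall xi, HT (fun x => a * f1 x + b * f2 x + c * f3 x + e * f4 x) xi =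
    HT (fun x => 0 * f1 x) xi}.
  by apply: H0 => x ->; rewrite mul0r.
apply: filterS3 H0 (HTZ 0 h1) _; last first.
  apply: filterS3 (HTD k123 k4) (HTD k12 k3) _; last first.
    apply: filterS3 (HTD k1 k2) (HTZ a h1) _; last first.
      apply: filterS3 (HTZ b h2) (HTZ c h3) (HTZ e h4).
      move=> xi e1 e2 e3; exact: (conj e1 (conj e2 e3)).
    move=> xi e1 e2 [e3 [e4 e5]]; exact: (conj e1 (conj e2 (conj e3 (conj e4 e5)))).
  move=> xi e1 e2 [e3 [e4 [e5 [e6 e7]]]].
  exact: (conj e1 (conj e2 (conj e3 (conj e4 (conj e5 (conj e6 e7)))))).
move=> xi e1 e2 [e3 [e4 [e5 [e6 [e7 [e8 e9]]]]]].
by rewrite -e6 -e7 -e8 -e9 -e5 -e4 -e3 e1 e2 mul0r.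
Qed.

(** The exponents 4 and 3 are those of the squared norms of H^4 and H^3. *)
Definition data_weight (p q : V -> R) (xi : V) : R :=
  (1 + dotp xi xi) ^+ 4 * p xi ^+ 2 + (1 + dotp xi xi) ^+ 3 * q xi ^+ 2.

Variables (delta tau : R) (psi0 psi1 psi2 : V -> R) (psi phi : R -> V -> R).
Hypotheses (n_gt0 : (0 < n)%N) (delta0 : 0 < delta) (tau0 : 0 < tau) (tau1 : tau <= 1).
Hypotheses (hpsi2 : compatible_data delta psi0 psi1 psi2)
  (hpsi : MGT_solution tau delta psi0 psi1 psi2 psi)
  (hphi : Kuznetsov_solution delta psi0 psi1 phi).

Let what (t : R) (xi : V) : R := HT (psi t) xi - HT (phi t) xi.

Definition Cfreq : R := (4 + 8 / delta) * Cinit delta.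

Lemma Cfreq_ge0 : 0 <= Cfreq.
Proof.
have d0 := ltW delta0; have d2 := sqr_ge0 delta.
rewrite /Cfreq /Cinit mulr_ge0 ?addr_ge0 ?divr_ge0//.
apply: mulr_ge0; first by apply: mulr_ge0 => //; rewrite addr_ge0// mulr_ge0.
by rewrite addr_ge0// mulr_ge0 ?addr_ge0// ?mulr_ge0// addr_ge0.
Qed.

Lemma frequency_estimate_cut (k : nat) (m : V -> R) (t : R) :
  bddm m -> (forall xi, 0 <= m xi) -> 0 <= t ->
  integ mu (fun xi => kap k xi * m xi * what t xi ^+ 2) /\
  \int[mu]_xi (kap k xi * m xi * what t xi ^+ 2) <= Cfreq * tau ^+ 2 *
    \int[mu]_xi (kap k xi * m xi * data_weight (HT psi0) (HT psi1) xi).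
Proof.
move=> bm m0 t0.
have [psi_t [psi_tt [psi_ttt [lapp [lappt [L D W EQ [I0 I1 I2]]]]]]] := hpsi.
have [phi_t [phi_tt [laph [lapht [L' D' W' EQ' [I0' I1']]]]]] := hphi.
have [lap0 [lap1 [W0 W1 C2]]] := hpsi2.
pose al (xi : V) : R := kap k xi * dotp xi xi.
have al0 xi : 0 <= al xi by rewrite /al mulr_ge0 ?dotp_ge0// /kap; case: ifP.
pose K (u : R -> V -> R) (s : R) (xi : V) : R := kap k xi * HT (u s) xi.
have cur u v : (forall s : R, 0 <= s -> in_L2 (u s)) -> (forall s : R, 0 <= s -> in_L2 (v s)) ->
    (forall s : R, 0 <= s -> is_L2_derive u v s) -> L2curve mu (K u) (K v).
  move=> Lu Lv uv; apply: L2curve_bddm; first exact: bddm_kap.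
  exact/L2curve_HT/L2curve_of_derive.
have P01 : L2curve mu (K psi) (K psi_t).
  by apply: cur => s s0; [case: (L s s0)|case: (L s s0)|case: (D s s0)].
have P12 : L2curve mu (K psi_t) (K psi_tt).
  by apply: cur => s s0; [case: (L s s0)|case: (L s s0)|case: (D s s0)].
have P23 : L2curve mu (K psi_tt) (K psi_ttt).
  by apply: cur => s s0; [case: (L s s0)|case: (L s s0)|case: (D s s0)].
have F01 : L2curve mu (K phi) (K phi_t).
  by apply: cur => s s0; [case: (L' s s0)|case: (L' s s0)|case: (D' s s0)].
have F12 : L2curve mu (K phi_t) (K phi_tt).
  by apply: cur => s s0; [case: (L' s s0)|case: (L' s s0)|case: (D' s s0)].
have peq (s : R) : 0 < s -> {ae mu, forall xi, tau * K psi_ttt s xi + K psi_tt s xi +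
    al xi * K psi s xi + (delta + tau) * (al xi * K psi_t s xi) = 0}.
  move=> s0; have [_ _ L3 L4] := L s (ltW s0); have [w1 w2] := W s s0.
  have := @HT_lincomb4 tau 1 (-1) (- (delta + tau)) _ _ _ _ L4 L3 (let: And3 _ h _ := w1 in h)
    (let: And3 _ h _ := w2 in h).
  move=> /(_ _)/wrap[].
    by apply: filterS (EQ s s0) => x h; lra.
  move=> H; apply: filterS3 H (weak_laplacian_HT w1) (weak_laplacian_HT w2) => xi H e1 e2.
  rewrite /K /al; case: (kapP k xi) => [->|[-> _ _]]; first by ring.
  by rewrite e1 e2 in H; lra.
have feq (s : R) : 0 < s -> {ae mu, forall xi, K phi_tt s xi + al xi * K phi s xi +
    delta * (al xi * K phi_t s xi) = 0}.
  move=> s0; have [_ _ L3] := L' s (ltW s0); have [w1 w2] := W' s s0.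
  have := @HT_lincomb4 1 0 (-1) (- delta) _ _ _ _ L3 L3 (let: And3 _ h _ := w1 in h)
    (let: And3 _ h _ := w2 in h).
  move=> /(_ _)/wrap[].
    by apply: filterS (EQ' s s0) => x h; lra.
  move=> H; apply: filterS3 H (weak_laplacian_HT w1) (weak_laplacian_HT w2) => xi H e1 e2.
  rewrite /K /al; case: (kapP k xi) => [->|[-> _ _]]; first by ring.
  by rewrite e1 e2 in H; lra.
have [p0L p1L p2L p3L] := L 0 (lexx 0); have [f0L f1L f2L] := L' 0 (lexx 0).
have [psi0L lap0L _] := W0; have [psi1L lap1L _] := W1.
pose p xi := kap k xi * HT psi0 xi; pose q xi := kap k xi * HT psi1 xi.
have ini u f : in_L2 (u 0) -> in_L2 f -> {ae mu, forall x, u 0 x = f x} ->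
    {ae mu, forall xi, K u 0 xi = kap k xi * HT f xi}.
  by move=> uL fL uf; apply: filterS (HT_ae uL fL uf) => xi; rewrite /K => ->.
have p00 := ini _ _ p0L psi0L I0; have p10 := ini _ _ p1L psi1L I1.
have f00 := ini _ _ f0L psi0L I0'; have f10 := ini _ _ f1L psi1L I1'.
have p20 : {ae mu, forall xi, K psi_tt 0 xi = - al xi * p xi - delta * al xi * q xi}.
  have := @HT_lincomb4 1 0 (-1) (- delta) _ _ _ _ p2L p2L lap0L lap1L.
  move=> /(_ _)/wrap[].
    by apply: filterS2 I2 C2 => x h1 h2; rewrite h1 h2; ring.
  move=> H; apply: filterS3 H (weak_laplacian_HT W0) (weak_laplacian_HT W1) => xi H e1 e2.
  rewrite /K /al /p /q; case: (kapP k xi) => [->|[-> _ _]]; first by ring.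
  by rewrite e1 e2 in H; lra.
(* On the support of the cutoff the weight is divided by |xi|^2, which removes the factor [al] from
   both sides of [energy_estimate]. *)
pose m' xi := m xi * (kap k xi / dotp xi xi).
have m'0 xi : 0 <= m' xi by rewrite /m' mulr_ge0// divr_ge0 ?dotp_ge0// /kap; case: ifP.
have bm' : bddm m' by apply: bddmM => //; exact: bddm_kap_inv.
have m'al xi : m' xi * al xi = kap k xi * m xi.
  rewrite /m' /al; case: (kapP k xi) => [->|[-> h _]]; first by ring.
  by field; rewrite gt_eqF//; apply: lt_le_trans h; rewrite invr_gt0.
have E1 xi : m' xi * al xi * (K psi t xi - K phi t xi) ^+ 2 = kap k xi * m xi * what t xi ^+ 2.
  by rewrite m'al /K /what; case: (kapP k xi) => [->|[-> _ _]]; ring.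
have E2 xi : m' xi * al xi * ((1 + al xi) ^+ 4 * p xi ^+ 2 + (1 + al xi) ^+ 3 * q xi ^+ 2) =
    kap k xi * m xi * data_weight (HT psi0) (HT psi1) xi.
  by rewrite m'al /data_weight /p /q /al; case: (kapP k xi) => [->|[-> _ _]]; ring.
have pL : p \in L2 by apply: L2_bddm; [exact: bddm_kap|exact: HT_L2].
have qL : q \in L2 by apply: L2_bddm; [exact: bddm_kap|exact: HT_L2].
have h : \int[mu]_xi (m' xi * al xi * (K psi t xi - K phi t xi) ^+ 2) <= Cfreq * tau ^+ 2 *
    \int[mu]_xi (m' xi * al xi * ((1 + al xi) ^+ 4 * p xi ^+ 2 + (1 + al xi) ^+ 3 * q xi ^+ 2)).
  exact: (energy_estimate bm' m'0 (bddm_kap_dotp k) al0 delta0 tau0 tau1 P01 P12 P23 F01 F12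
    peq feq p00 f00 p10 f10 p20 pL qL t0).
split; last first.
  move: h; under eq_Rintegral do rewrite E1.
  by under [X in _ <= _ * X -> _]eq_Rintegral do rewrite E2.
apply: integ_bddm_sqr; first by apply: bddmM => //; exact: bddm_kap.
by apply: L2B; apply: HT_L2; [case: (L t t0)|case: (L' t t0)].
Qed.

(** The weight need only be bounded on the support of each cutoff. The right sides are bounded by
    the full integral, since the cutoffs are at most 1, and Fatou's lemma lets k tend to infinity
    away from the null set xi = 0. *)
Lemma frequency_estimate (m : V -> R) (t : R) : measurable_fun setT m ->
  (forall k, bddm (fun xi => kap k xi * m xi)) -> (forall xi, 0 <= m xi) -> 0 <= t ->
  integ mu (fun xi => m xi * data_weight (HT psi0) (HT psi1) xi) ->
  integ mu (fun xi => m xi * what t xi ^+ 2) /\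
  \int[mu]_xi (m xi * what t xi ^+ 2) <=
    Cfreq * tau ^+ 2 * \int[mu]_xi (m xi * data_weight (HT psi0) (HT psi1) xi).
Proof.
move=> mm bm m0 t0 Iw.
have kap0 k xi : 0 <= kap k xi by rewrite /kap; case: ifP.
have kap1 k xi : kap k xi <= 1 by rewrite /kap; case: ifP.
have bk k : bddm (fun xi => kap k xi * m xi) by exact: bm.
have bk0 k xi : 0 <= kap k xi * m xi by rewrite mulr_ge0.
have F k := frequency_estimate_cut k (bk k) (bk0 k) t0.
have E k (f : V -> R) xi : kap k xi * (kap k xi * m xi) * f xi = kap k xi * (m xi * f xi).
  by rewrite !mulrA kap_sqr.
have dw0 xi : 0 <= data_weight (HT psi0) (HT psi1) xi.
  by rewrite /data_weight addr_ge0// mulr_ge0 ?sqr_ge0// exprn_ge0// addr_ge0 ?dotp_ge0.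
have mw : measurable_fun setT (what t).
  have [? [? [? [? [? [L _ _ _ _]]]]]] := hpsi; have [? [? [? [? [L' _ _ _ _]]]]] := hphi.
  by apply: L2_measurable; apply: L2B; apply: HT_L2; [case: (L t t0)|case: (L' t t0)].
apply: (fatou_le (f_ := fun k xi => kap k xi * (m xi * what t xi ^+ 2))).
- move=> k; have [h _] := F k; move: h; congr (integ mu _).
  by apply/funext => xi; rewrite (E k (fun xi => what t xi ^+ 2)).
- by apply: measurable_funM => //; apply: measurable_funX.
- by move=> k xi; rewrite mulr_ge0// mulr_ge0// sqr_ge0.
- by move=> xi; rewrite mulr_ge0// sqr_ge0.
- apply: filterS (ae_dotp_neq0 n_gt0) => xi /cvg_kap C.
  rewrite -[X in _ --> X]mul1r; apply: cvgM; [exact: C|exact: cvg_cst].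
- move=> k; have [_] := F k.
  under eq_Rintegral do rewrite (E k (fun xi => what t xi ^+ 2)).
  under [X in _ <= _ * X -> _]eq_Rintegral do rewrite E.
  move=> /le_trans; apply; rewrite ler_wpM2l//.
    by rewrite mulr_ge0 ?sqr_ge0// Cfreq_ge0.
  apply: ler_Rintegral => //.
    apply: integM_bounded Iw; first exact: measurable_kap.
    by move=> xi; rewrite ger0_norm; [exact: kap1|exact: kap0].
  by move=> xi; rewrite ler_piMl// mulr_ge0.
Qed.

End frequency_estimate.

Lemma integ_ae d (T : measurableType d) (R : realType) (mu : {measure set T -> \bar R})
  (f g : T -> R) : integ mu f -> measurable_fun setT g -> {ae mu, forall x, f x = g x} ->
  integ mu g.
Proof.
move=> If mg fg; apply/integrableP; split; first exact/measurable_EFinP.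
have /integrableP[_] := If; apply: le_lt_trans.
apply: ae_ge0_le_integral => //.
- by apply: measurableT_comp => //; exact/measurable_EFinP.
- by apply: measurableT_comp => //; apply/measurable_EFinP; exact: integ_measurable If.
- by apply: filterS fg => x e _ /=; rewrite e.
Qed.

(** * Comparison with the Fourier transform and its norms *)

Section hartley_fourier.
Context (R : realType) (n : nat).
Local Notation V := 'rV[R]_n.
Local Notation mu := (lebesgue_rV R n).
Local Notation L2 := (Lfun mu 2%:E).
Local Notation normc := (@ComplexField.Normc.normc R).
Implicit Types (f g : V -> R).

Lemma hartleyE f xi : integ mu f -> hartley f xi =
  hcst R n * (\int[mu]_x (f x * cos (dotp x xi)) + \int[mu]_x (f x * sin (dotp x xi))).
Proof.
move=> If; rewrite /hartley -RintegralD//.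
- by congr (_ * _); apply: eq_Rintegral => x _; rewrite mulrDr.
- by apply: integ_cos => //; exact: measurable_dotp.
- by apply: integ_sin => //; exact: measurable_dotp.
Qed.

Lemma dotpNr (x y : V) : dotp x (- y) = - dotp x y.
Proof. by rewrite /dotp -sumrN; apply: eq_bigr => i _; rewrite mxE mulrN. Qed.

Lemma hartleyNE f xi : integ mu f -> hartley f (- xi) =
  hcst R n * (\int[mu]_x (f x * cos (dotp x xi)) - \int[mu]_x (f x * sin (dotp x xi))).
Proof.
move=> If; rewrite hartleyE//; congr (_ * (_ + _)).
  by apply: eq_Rintegral => x _; rewrite dotpNr cosN.
rewrite -mulN1r -RintegralZl//; last by apply: integ_sin => //; exact: measurable_dotp.
by apply: eq_Rintegral => x _; rewrite dotpNr sinN; ring.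
Qed.

(** If A and B are the cosine and sine transforms, the Hartley transform is A + B at xi and A - B at
    -xi, while the modulus squared is A^2 + B^2. *)
Lemma normc_fourier_sqr f xi : integ mu f ->
  normc (fourier f xi) ^+ 2 = 2^-1 * (hartley f xi ^+ 2 + hartley f (- xi) ^+ 2).
Proof.
move=> If; rewrite hartleyE// hartleyNE// /fourier.
set A := \int[mu]_x _; set B := \int[mu]_x _.
rewrite -/(hcst R n) /= sqr_sqrtr ?addr_ge0 ?sqr_ge0//; by field.
Qed.

(* Since the Hartley transform combines real and imaginary parts of the Fourier transform
   linearly, real multipliers act on both alike. *)
Lemma hartley_bessel (r : R) f g xi : bessel_potential r f g ->
  hartley g xi = japanese_bracket xi `^ r * hartley f xi.
Proof.
move=> [If Ig E]; rewrite !hartleyE//; have := E xi; rewrite /fourier -/(hcst R n).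
move=> [] /=; set A := \int[mu]_x _; set B := \int[mu]_x _.
set A' := \int[mu]_x _; set B' := \int[mu]_x _ => e1 e2.
have {}e1 : hcst R n * A = japanese_bracket xi `^ r * (hcst R n * A') by move: e1; rewrite !mul0r !subr0.
have {}e2 : hcst R n * B = japanese_bracket xi `^ r * (hcst R n * B').
  by move: e2; rewrite !mul0r !addr0 !mulrN => /oppr_inj.
by rewrite mulrDr e1 e2; ring.
Qed.

Lemma japanese_bracket_powR (r : R) (xi : V) :
  japanese_bracket xi `^ r = (1 + dotp xi xi) `^ (r / 2).
Proof.
by rewrite /japanese_bracket -powR12_sqrt ?addr_ge0 ?dotp_ge0// -powRrM mulrC.
Qed.

Lemma japanese_bracketX (k : nat) (xi : V) :
  (japanese_bracket xi `^ k%:R) ^+ 2 = (1 + dotp xi xi) ^+ k.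
Proof.
by rewrite powR_mulrn ?sqrtr_ge0// exprAC sqr_sqrtr// addr_ge0 ?dotp_ge0.
Qed.

Lemma measurable_bracket (r : R) : measurable_fun setT (fun xi : V => (1 + dotp xi xi) `^ r).
Proof.
have m : measurable_fun setT (fun xi : V => 1 + dotp xi xi).
  by apply: measurable_funD => //; exact: measurable_normsq.
exact: (measurableT_comp (@measurable_powR R r) m).
Qed.

Lemma measurable_oppV : measurable_fun setT (fun xi : V => - xi).
Proof.
apply: measurable_fun_coord_rV => i.
rewrite (_ : _ \o _ = fun xi : V => - (xi ord0 i)); last first.
  by apply/funext => xi; rewrite /coord_rV/= mxE.
apply: measurable_funN; exact: measurable_coord.
Qed.

Lemma measurable_normc_fourier f : integ mu f -> measurable_fun setT (fun xi => normc (fourier f xi)).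
Proof.
move=> If; have mh := measurable_hartley If.
have mhN : measurable_fun setT (fun xi : V => hartley f (- xi)) by exact: (measurableT_comp mh measurable_oppV).
rewrite (_ : (fun xi => _) = (fun xi =>
   (2^-1 * (hartley f xi ^+ 2 + hartley f (- xi) ^+ 2)) `^ 2^-1)); last first.
  apply/funext => xi; rewrite -normc_fourier_sqr// powR12_sqrt ?sqr_ge0// sqrtr_sqr ger0_norm//.
  by rewrite /fourier/= sqrtr_ge0.
have m : measurable_fun setT (fun xi => 2^-1 * (hartley f xi ^+ 2 + hartley f (- xi) ^+ 2)).
  by apply: measurable_funM => //; apply: measurable_funD; apply: measurable_funX.
exact: (measurableT_comp (@measurable_powR R 2^-1) m).
Qed.

Lemma Lp_norm1_lty f : measurable_fun setT f -> (Lp_norm 1%:E f < +oo)%E -> integ mu f.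
Proof.
move=> mf h; apply/integrableP; split; first exact/measurable_EFinP.
by rewrite /Lp_norm Lnorm1 in h.
Qed.

Lemma Lp_norm2_lty f : measurable_fun setT f -> (Lp_norm 2%:E f < +oo)%E -> f \in L2.
Proof.
move=> mf h; apply/L2P; split=> //; apply/ge0_integP => //.
- exact: measurable_funX.
- by move=> x; exact: sqr_ge0.
rewrite -Lnorm2_sqr// expe2; move: h; rewrite /Lp_norm.
have := Lnorm_ge0 mu 2%:E (EFin \o f); case: ('N[mu]_2%:E[EFin \o f])%E => // r _ _.
by rewrite -EFinM ltry.
Qed.

Lemma HsL1_norm_ge (s : R) f : (Lp_norm 2%:E (fun xi : V => japanese_bracket xi `^ s * normc (fourier f xi))%R
  <= HsL1_norm s f)%E.
Proof. by rewrite /HsL1_norm leeDl// /Lp_norm Lnorm_ge0. Qed.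

Lemma HsL1_norm_ge0 (s : R) f : (0 <= HsL1_norm s f)%E.
Proof. by rewrite /HsL1_norm adde_ge0// /Lp_norm Lnorm_ge0. Qed.

(** A is the Sobolev part of the norm; the L1 part ensures that the integral transform is meaningful
    and equals [HT f] almost everywhere. The 2 comes from (A + B)^2 <= 2 (A^2 + B^2) in the notation
    of [normc_fourier_sqr]. *)
Lemma HsL1_norm_lty (k : nat) f : f \in L2 -> (HsL1_norm k%:R f < +oo)%E ->
  exists A : R, [/\ 0 <= A, (A%:E <= HsL1_norm k%:R f)%E,
    integ mu (fun xi => (1 + dotp xi xi) ^+ k * HT f xi ^+ 2)
  & \int[mu]_xi ((1 + dotp xi xi) ^+ k * HT f xi ^+ 2) <= 2 * A ^+ 2].
Proof.
move=> fL fin.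
have If : integ mu f.
  apply: Lp_norm1_lty; first exact: L2_measurable fL.
  by apply: le_lt_trans fin; rewrite /HsL1_norm leeDr// /Lp_norm Lnorm_ge0.
pose W (xi : V) : R := japanese_bracket xi `^ k%:R * normc (fourier f xi).
have mW : measurable_fun setT W.
  apply: measurable_funM; last exact: measurable_normc_fourier.
  under eq_fun do rewrite japanese_bracket_powR; exact: measurable_bracket.
have WL : W \in L2 by apply: Lp_norm2_lty => //; exact: le_lt_trans (HsL1_norm_ge _ _) fin.
have W2 xi : W xi ^+ 2 = 2^-1 * ((1 + dotp xi xi) ^+ k * (hartley f xi ^+ 2 + hartley f (- xi) ^+ 2)).
  by rewrite /W exprMn japanese_bracketX normc_fourier_sqr//; ring.
have d0 (xi : V) : 0 <= (1 + dotp xi xi) ^+ k by rewrite exprn_ge0// addr_ge0 ?dotp_ge0.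
have md : measurable_fun setT (fun xi : V => (1 + dotp xi xi) ^+ k).
  by apply: measurable_funX; apply: measurable_funD => //; exact: measurable_normsq.
have hW xi : (1 + dotp xi xi) ^+ k * hartley f xi ^+ 2 <= 2 * W xi ^+ 2.
  by rewrite W2 mulVKf// ler_wpM2l// lerDl sqr_ge0.
have Ih : integ mu (fun xi => (1 + dotp xi xi) ^+ k * hartley f xi ^+ 2).
  apply: (@le_integ _ _ _ _ _ (fun xi => 2 * W xi ^+ 2)).
  - by apply: measurable_funM => //; apply: measurable_funX; exact: measurable_hartley.
  - by move=> xi; rewrite ger0_norm ?hW// mulr_ge0// sqr_ge0.
  - by apply: integZ; exact: L2_sqr.
have mHT : measurable_fun setT (fun xi => (1 + dotp xi xi) ^+ k * HT f xi ^+ 2).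
  by apply: measurable_funM => //; apply: measurable_funX; exact/L2_measurable/HT_L2.
have ae : {ae mu, forall xi, (1 + dotp xi xi) ^+ k * hartley f xi ^+ 2 = (1 + dotp xi xi) ^+ k * HT f xi ^+ 2}.
  by apply: filterS (HT_hartley If fL) => xi ->.
exists (nrmL2 mu W); split.
- exact: nrmL2_ge0.
- by rewrite -(Lnorm2E WL); exact: HsL1_norm_ge.
- exact: integ_ae ae.
- rewrite -(ae_eq_Rintegral (integ_measurable Ih) mHT ae) nrmL2_sqr dotL2_sqr.
  rewrite -RintegralZl//; last exact: L2_sqr.
  by apply: ler_Rintegral => //; apply: integZ; exact: L2_sqr.
Qed.

End hartley_fourier.

(** * The estimate in L2 *)

Section L2_estimate.
Context (R : realType) (n : nat).
Local Notation V := 'rV[R]_n.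
Local Notation mu := (lebesgue_rV R n).
Local Notation L2 := (Lfun mu 2%:E).
Variables (delta tau : R) (psi0 psi1 psi2 : V -> R) (psi phi : R -> V -> R).
Hypotheses (n_gt0 : (0 < n)%N) (delta0 : 0 < delta) (tau0 : 0 < tau) (tau1 : tau <= 1).
Hypotheses (hpsi2 : compatible_data delta psi0 psi1 psi2)
  (hpsi : MGT_solution tau delta psi0 psi1 psi2 psi)
  (hphi : Kuznetsov_solution delta psi0 psi1 phi).

Lemma data_L2 : psi0 \in L2 /\ psi1 \in L2.
Proof. by have [? [? [[? _ _] [? _ _] _]]] := hpsi2. Qed.

Lemma solution_L2 (t : R) : 0 <= t -> psi t \in L2 /\ phi t \in L2.
Proof.
move=> t0; have [? [? [? [? [? [L _ _ _ _]]]]]] := hpsi; have [? [? [? [? [L' _ _ _ _]]]]] := hphi.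
by split; [case: (L t t0)|case: (L' t t0)].
Qed.

(** The factor 2 is that of [HsL1_norm_lty]; the summand 1 makes the constant visibly positive. *)
Definition CL2 : R := Num.sqrt (2 * Cfreq delta) + 1.

Lemma L2_estimate_fin : (HsL1_norm 4 psi0 < +oo)%E -> (HsL1_norm 3 psi1 < +oo)%E ->
  forall t : R, 0 <= t -> (Lp_norm 2%:E (fun x => psi t x - phi t x)%R <=
   (tau * CL2)%:E * (HsL1_norm 4 psi0 + HsL1_norm 3 psi1))%E.
Proof.
move=> fin0 fin1 t t0; have [L0 L1] := data_L2; have [Lp Lf] := solution_L2 t0.
have [A [A0 AH IA EA]] := @HsL1_norm_lty _ _ 4 psi0 L0 fin0.
have [B [B0 BH IB EB]] := @HsL1_norm_lty _ _ 3 psi1 L1 fin1.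
have Lw := L2B Lp Lf.
have C0 : 0 <= Cfreq delta by exact: Cfreq_ge0.
have I : integ mu (fun xi => 1 * data_weight (HT psi0) (HT psi1) xi).
  by under eq_fun do rewrite mul1r; exact: integD.
have bk k : bddm (fun xi : V => kap k xi * 1) by apply: bddmM; [exact: bddm_kap|exact: bddm_cst].
have [I1 E1] := frequency_estimate n_gt0 delta0 tau0 tau1 hpsi2 hpsi hphi (measurable_cst _) bk
  (fun=> ler01) t0 I.
rewrite /Lp_norm Lnorm2E//.
apply: (@le_trans _ _ ((tau * CL2)%:E * (A%:E + B%:E))%E); last first.
  by rewrite lee_pmul2l ?lte_fin// ?leeD// /CL2 mulr_gt0// ltr_wpDl// sqrtr_ge0.
rewrite -EFinD -EFinM lee_fin -(HT_isometry Lw).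
rewrite -(ler_pXn2r (n := 2)) ?nnegrE ?nrmL2_ge0//; last first.
  by rewrite mulr_ge0 ?addr_ge0// mulr_ge0 ?(ltW tau0)// addr_ge0 ?sqrtr_ge0.
rewrite nrmL2_sqr dotL2_sqr.
have e0 : \int[mu]_xi (HT (fun x => psi t x - phi t x) xi ^+ 2) =
   \int[mu]_xi (1 * (HT (psi t) xi - HT (phi t) xi) ^+ 2).
  apply: ae_eq_Rintegral.
  - by apply: measurable_funX; exact/L2_measurable/HT_L2.
  - exact: integ_measurable I1.
  - by apply: filterS (HTB Lp Lf) => xi ->; rewrite mul1r.
rewrite e0; apply: (le_trans E1).
have e1 : \int[mu]_xi (1 * data_weight (HT psi0) (HT psi1) xi) <= 2 * (A + B) ^+ 2.
  under eq_Rintegral do rewrite mul1r.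
  rewrite /data_weight RintegralD//; apply: (le_trans (lerD EA EB)).
  rewrite -subr_ge0 (_ : _ - _ = 4 * (A * B)); last by ring.
  by rewrite !mulr_ge0.
apply: le_trans (ler_wpM2l _ e1) _; first by rewrite mulr_ge0 ?sqr_ge0.
have s0 := sqrtr_ge0 (2 * Cfreq delta).
have s2 : Num.sqrt (2 * Cfreq delta) ^+ 2 = 2 * Cfreq delta by rewrite sqr_sqrtr// mulr_ge0.
rewrite [leLHS](_ : _ = (2 * Cfreq delta) * (tau * (A + B)) ^+ 2); last by ring.
rewrite [leRHS](_ : _ = CL2 ^+ 2 * (tau * (A + B)) ^+ 2); last by ring.
rewrite ler_wpM2r ?sqr_ge0// -s2 /CL2 sqrrD1.
by rewrite -addrA lerDl addr_ge0// mulrn_wge0.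
Qed.

Lemma L2_estimate : (sup_Lp_dist 2%:E psi phi <=
   (tau * CL2)%:E * (HsL1_norm 4 psi0 + HsL1_norm 3 psi1))%E.
Proof.
have Cp : (0 < (tau * CL2)%:E)%E by rewrite lte_fin mulr_gt0// ltr_wpDl// sqrtr_ge0.
have H4 := HsL1_norm_ge0 4 psi0; have H3 := HsL1_norm_ge0 3 psi1.
have [fin|inf] := ltP (HsL1_norm 4 psi0 + HsL1_norm 3 psi1)%E +oo%E; last first.
  by move: inf; rewrite leye_eq => /eqP ->; rewrite gt0_muley// leey.
apply: ge_ereal_sup => _ [t /= t0 <-]; apply: L2_estimate_fin.
- by apply: le_lt_trans fin; rewrite leeDl.
- by apply: le_lt_trans fin; rewrite leeDr.
- by move: t0; rewrite in_itv/= andbT.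
Qed.

End L2_estimate.

(** * The uniform estimate *)

Section bracket_integrability.
Context (R : realType).
Local Notation lam := (@lebesgue_measure R).

Lemma cvg_powRN_y (q : R) : 0 < q -> (1 + x) `^ (- q) @[x --> +oo] --> (0 : R).
Proof.
move=> q0; apply/cvgrPdist_le => e e0; near=> x.
have x1 : e^-1 `^ q^-1 <= 1 + x.
  by rewrite -lerBlDl; near: x; apply: nbhs_pinfty_ge; rewrite num_real.
rewrite sub0r normrN ger0_norm ?powR_ge0// powRN.
have h : e^-1 <= (1 + x) `^ q.
  have -> : e^-1 = (e^-1 `^ q^-1) `^ q by rewrite -powRrM mulVf ?gt_eqF// powRr1// invr_ge0 ltW.
  by apply: ge0_ler_powR => //; rewrite ?nnegrE ?powR_ge0 ?(ltW q0)// (le_trans _ x1)// powR_ge0.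
have ei : 0 < e^-1 by rewrite invr_gt0.
by rewrite -[leRHS]invrK lef_pV2// ?posrE// (lt_le_trans ei).
Unshelve. all: by end_near. Qed.

Lemma is_derive_powR1D (q x : R) : -1 < x ->
  is_derive x (1 : R) (fun x : R => (1 + x) `^ q) (q * (1 + x) `^ (q - 1)).
Proof.
move=> x1; have x0 : 0 < 1 + x by lra.
have h1 : is_derive x (1 : R) (fun x : R => 1 + x) 1.
  have h := @is_deriveD _ _ _ (fun=> 1 : R) id x 1 0 1 (is_derive_cst _ _ _) (is_derive_id _ _).
  by apply: (is_derive_congr h); rewrite add0r.
have := @is_derive1_comp R (fun y => y `^ q) (fun y => 1 + y) x _ _ (is_derive1_powR q x0) h1.
by move=> h; apply: (is_derive_congr h); rewrite mulr1.
Qed.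

Lemma integral_powR_halfline (q : R) : 0 < q ->
  (\int[lam]_(x in `[0%R, +oo[) ((1 + x) `^ (- q - 1))%:E = (q^-1)%:E)%E.
Proof.
move=> q0; pose F (x : R) := - q^-1 * (1 + x) `^ (- q).
have dF (x : R) : -1 < x -> is_derive x (1 : R) F ((1 + x) `^ (- q - 1)).
  move=> x1; have h := @is_deriveZ _ _ _ _ (- q^-1) x 1 _ (is_derive_powR1D (- q) x1).
  by apply: (is_derive_congr h); rewrite /GRing.scale/= mulrA mulrNN mulVf ?mul1r// gt_eqF.
have cpow (r x : R) : -1 < x -> {for x, continuous (fun x : R => (1 + x) `^ r)}.
  by move=> x1; apply/differentiable_continuous/derivable1_diffP; case: (is_derive_powR1D r x1).
have cF (x : R) : -1 < x -> {for x, continuous F}.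
  by move=> x1; apply/differentiable_continuous/derivable1_diffP; case: (dF x x1).
have m10 : (-1 : R) < 0 by lra.
rewrite (@ge0_continuous_FTC2y _ _ F 0 0).
- by rewrite /F addr0 powR1 mulr1 sub0e -EFinN opprK.
- by move=> x _; exact: powR_ge0.
- apply/continuous_within_itvcyP; split.
    by move=> x; rewrite in_itv/= andbT => x0; apply: cpow; exact: lt_trans x0.
  by apply: cvg_at_right_filter; exact: cpow.
- have h : - q^-1 * (1 + x) `^ (- q) @[x --> +oo] --> - q^-1 * 0.
    by apply: cvgM; [exact: cvg_cst|exact: cvg_powRN_y].
  by rewrite mulr0 in h.
- by move=> x x0; case: (dF x (lt_trans m10 x0)).
- by apply: cvg_at_right_filter; exact: cF.
- move=> x; rewrite in_itv/= andbT => x0; rewrite derive1E.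
  exact: (@derive_val _ _ _ _ _ _ _ (dF x (lt_trans m10 x0))).
Qed.

Let g1 (q x : R) : R := if 0 <= x then (1 + x) `^ (- q - 1) else 0.

Lemma integ_powR_halfline (q : R) : 0 < q -> integ lam (g1 q).
Proof.
move=> q0; apply/ge0_integP.
- apply: measurable_fun_ifT => //; first exact: measurable_fun_ler.
  have m : measurable_fun setT (fun x : measurableTypeR R => 1 + x) by exact: measurable_funD.
  exact: (measurableT_comp (@measurable_powR R (- q - 1)) m).
- by move=> x; rewrite /g1; case: ifP => // _; exact: powR_ge0.
- have -> : (\int[lam]_x (g1 q x)%:E = \int[lam]_(x in `[0%R, +oo[) ((1 + x) `^ (- q - 1))%:E)%E.
    rewrite [RHS]integral_mkcond; apply: eq_integral => x _; rewrite /g1 patchE.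
    by rewrite mem_setE in_itv/= andbT; case: ifP.
  by rewrite integral_powR_halfline// ltry.
Qed.

(** As (1 + x)^2 <= 2 (1 + x^2), each half-line is compared with a power of 1 + x, which has an
    explicit primitive. *)
Lemma integ_bracket1 (g : R) : 2^-1 < g -> integ lam (fun x : R => (1 + x ^+ 2) `^ (- g)).
Proof.
move=> g2; have q0 : 0 < 2 * g - 1 by lra.
have I := integ_powR_halfline q0; have [In _] := integ_opp I.
have H (x : R) : 0 <= x -> (1 + x ^+ 2) `^ (- g) <= 2 `^ g * (1 + x) `^ (- (2 * g - 1) - 1).
  move=> x0; rewrite (_ : - (2 * g - 1) - 1 = - (2 * g)); last by ring.
  have x1 : 0 < 1 + x by lra.
  have x2 : 0 < 1 + x ^+ 2 by rewrite ltr_pwDl// sqr_ge0.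
  rewrite !powRN.
  have h : (1 + x) `^ (2 * g) <= 2 `^ g * (1 + x ^+ 2) `^ g.
    rewrite powRrM powR_mulrn ?(ltW x1)// -powRM ?(ltW x2)//.
    apply: ge0_ler_powR; rewrite ?nnegrE; [lra|exact: sqr_ge0|lra|].
    by have := sqr_ge0 (1 - x); nra.
  have p1 : 0 < (1 + x) `^ (2 * g) by exact: powR_gt0.
  have p2 : 0 < (1 + x ^+ 2) `^ g by exact: powR_gt0.
  by rewrite ler_pdivlMr// mulrC ler_pdivrMr.
apply: (@le_integ _ _ _ _ _ (fun x : measurableTypeR R => 2 `^ g * (g1 (2 * g - 1) x + g1 (2 * g - 1) (- (x : R))))).
- have m : measurable_fun setT (fun x : measurableTypeR R => 1 + x ^+ 2).
    by apply: measurable_funD => //; exact: measurable_funX.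
  exact: (measurableT_comp (@measurable_powR R (- g)) m).
- move=> x; rewrite ger0_norm ?powR_ge0//.
  have g10 (y : R) : 0 <= g1 (2 * g - 1) y by rewrite /g1; case: ifP => // _; exact: powR_ge0.
  have [x0|x0] := leP (0 : R) x.
    apply: le_trans (H x x0) _; rewrite ler_wpM2l ?powR_ge0//.
    by rewrite {1}/g1 x0 lerDl.
  have nx0 : 0 <= - (x : R) by lra.
  rewrite -sqrrN; apply: le_trans (H _ nx0) _; rewrite ler_wpM2l ?powR_ge0//.
  by rewrite {2}/g1 nx0 lerDr.
- by apply: integZ; exact: integD.
Qed.

(** Since 1 + |xi|^2 is at least every 1 + xi_i^2, distributing the exponent evenly bounds the
    function by a product of one-dimensional ones with exponent b / n > 1/2; no polar coordinates
    are involved. *)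
Lemma integ_bracket (n : nat) (b : R) : (0 < n)%N -> n%:R / 2 < b ->
  integ (lebesgue_rV R n) (fun xi => (1 + dotp xi xi) `^ (- b)).
Proof.
move=> n0 nb; have n0R : 0 < (n%:R : R) by rewrite ltr0n.
pose g := b / n%:R; have g2 : 2^-1 < g by rewrite /g ltr_pdivlMr// mulrC.
have [I _] := @Rintegral_tensor R n (fun _ x => (1 + x ^+ 2) `^ (- g)) (fun=> integ_bracket1 g2).
apply: le_integ I; first exact: measurable_bracket.
move=> xi; rewrite ger0_norm ?powR_ge0//.
have d0 := dotp_ge0 xi.
have -> : (1 + dotp xi xi) `^ (- b) = \prod_(i < n) (1 + dotp xi xi) `^ (- g).
  rewrite prodr_const card_ord -powR_mulrn ?powR_ge0// -powRrM; congr (_ `^ _).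
  by rewrite /g mulNr divfK// gt_eqF.
apply: ler_prod => i _; rewrite powR_ge0/= !powRN.
have xi0 : 0 < 1 + xi ord0 i ^+ 2 by rewrite ltr_pwDl// sqr_ge0.
have xd : 1 + xi ord0 i ^+ 2 <= 1 + dotp xi xi.
  by rewrite lerD2l /dotp (bigD1 i)//= expr2 lerDl sumr_ge0// => j _; rewrite -expr2 sqr_ge0.
rewrite lef_pV2 ?posrE ?powR_gt0//; last exact: lt_le_trans xd.
by apply: ge0_ler_powR => //; rewrite ?nnegrE; lra.
Qed.

End bracket_integrability.

Section Linfty_estimate.
Context (R : realType) (n : nat).
Local Notation V := 'rV[R]_n.
Local Notation mu := (lebesgue_rV R n).
Local Notation L2 := (Lfun mu 2%:E).
Local Notation hc := (hcst R n).
Lemma Lp_norm_y_le (f : V -> R) (M : R) : 0 <= M -> {ae mu, forall x, `|f x| <= M} ->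
  (Lp_norm +oo f <= M%:E)%E.
Proof.
move=> M0 fM; rewrite /Lp_norm unlock /Lnorm; case: ifP => _; last by rewrite lee_fin.
by apply/ess_supP; apply: filterS fM => x; rewrite /= lee_fin.
Qed.

Lemma bessel_L1_norm_ge0 (r : R) (f : V -> R) : (0 <= bessel_L1_norm r f)%E.
Proof. by apply: le_ereal_inf_tmp => _ [g _ <-]; rewrite /Lp_norm Lnorm_ge0. Qed.

Lemma Lp_norm1E (g : V -> R) : integ mu g -> Lp_norm 1%:E g = (\int[mu]_x `|g x|)%:E.
Proof.
move=> Ig; rewrite /Lp_norm Lnorm1 Rintegral_EFin; last exact: integ_abs.
by apply: eq_integral => x _.
Qed.

Variables (delta s0 : R).
Hypotheses (n_gt0 : (0 < n)%N) (delta0 : 0 < delta) (hs0 : n%:R + 2 < s0).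

(* The exponent that balances the two uses of Cauchy-Schwarz: both the inverse weight and the
   weighted data decay like br (- be), which is integrable as be > n / 2. *)
Let be : R := (s0 - 2) / 2.

Let be0 : 0 <= be.
Proof. by move: hs0 (ler0n R n); rewrite /be; move: (n%:R : R) => N h1 h2; lra. Qed.

Let br (r : R) (xi : V) : R := (1 + dotp xi xi) `^ r.

Let br0 r xi : 0 <= br r xi. Proof. exact: powR_ge0. Qed.

Let dp0 (xi : V) : 0 < 1 + dotp xi xi. Proof. by rewrite ltr_pwDl// dotp_ge0. Qed.

Let brD r s xi : br r xi * br s xi = br (r + s) xi.
Proof. by rewrite /br powRD//; apply/implyP => _; rewrite gt_eqF. Qed.

Let Ibr : integ mu (br (- be)).
Proof. by apply: integ_bracket => //; rewrite /be; move: hs0; move: (n%:R : R) => N h1; lra. Qed.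

Definition bracket_mass : R := \int[mu]_xi br (- be) xi.

Let J := bracket_mass.

Let J0 : 0 <= J. Proof. by apply: Rintegral_ge0 => xi _; exact: br0. Qed.

(** On the support of the cutoff 1 + |xi|^2 is at most (k + 1) + 1, whence [k.+2]. *)
Let bddm_br k : bddm (fun xi => kap k xi * br be xi).
Proof.
split; first by apply: measurable_funM; [exact: measurable_kap|exact: measurable_bracket].
exists (k.+2%:R `^ be) => xi; have [->|[-> _ h]] := kapP k xi.
  by rewrite mul0r normr0 powR_ge0.
rewrite mul1r ger0_norm// /br; apply: ge0_ler_powR; rewrite ?nnegrE//; first exact: ltW.
by rewrite -[k.+2%:R]natr1 addrC lerD2r.
Qed.

(** The transform of g = <D>^s f is bounded by the L1 norm of g. Expressed through it, the squared
    transform of f carries the factor (1 + |xi|^2)^(- s), and the exponents combine to - be, which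
    is integrable. *)
Lemma weighted_data (k : nat) (s : R) (f g : V -> R) : be + k%:R - s = - be ->
  bessel_potential s f g -> f \in L2 ->
  integ mu (fun xi => br be xi * ((1 + dotp xi xi) ^+ k * HT f xi ^+ 2)) /\
  \int[mu]_xi (br be xi * ((1 + dotp xi xi) ^+ k * HT f xi ^+ 2)) <=
    J * (2 * hc * \int[mu]_x `|g x|) ^+ 2.
Proof.
move=> hk bg fL; have [If Ig _] := bg; set G := 2 * hc * _.
have E xi : br be xi * ((1 + dotp xi xi) ^+ k * hartley f xi ^+ 2) = br (- be) xi * hartley g xi ^+ 2.
  rewrite (hartley_bessel xi bg) japanese_bracket_powR -/(br _ xi) [X in _ = _ * X]exprMn.
  rewrite (_ : br (s / 2) xi ^+ 2 = br s xi); last by rewrite expr2 brD -splitr.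
  by rewrite mulrA -[(1 + dotp xi xi) ^+ k]powR_mulrn ?(ltW (dp0 _))// -/(br _ xi) [RHS]mulrA !brD;
    congr (br _ xi * _); rewrite -hk; ring.
have hG xi : br (- be) xi * hartley g xi ^+ 2 <= G ^+ 2 * br (- be) xi.
  rewrite mulrC ler_wpM2r// -real_normK ?num_real//.
  by rewrite lerXn2r ?nnegrE//; [exact: le_trans (hartley_bound xi Ig)|exact: hartley_bound].
have mH : measurable_fun setT (fun xi => br (- be) xi * hartley g xi ^+ 2).
  by apply: measurable_funM; [exact: measurable_bracket|apply: measurable_funX; exact: measurable_hartley].
have IH : integ mu (fun xi => br (- be) xi * hartley g xi ^+ 2).
  apply: (@le_integ _ _ _ _ _ (fun xi => G ^+ 2 * br (- be) xi)) => //.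
  - by move=> xi; rewrite ger0_norm// mulr_ge0// sqr_ge0.
  - exact: integZ.
have mHT : measurable_fun setT (fun xi => br be xi * ((1 + dotp xi xi) ^+ k * HT f xi ^+ 2)).
  apply: measurable_funM; first exact: measurable_bracket.
  apply: measurable_funM; first by apply: measurable_funX; apply: measurable_funD => //; exact: measurable_normsq.
  by apply: measurable_funX; exact/L2_measurable/HT_L2.
have ae : {ae mu, forall xi, br (- be) xi * hartley g xi ^+ 2 =
    br be xi * ((1 + dotp xi xi) ^+ k * HT f xi ^+ 2)}.
  by apply: filterS (HT_hartley If fL) => xi ->; rewrite E.
split; first exact: integ_ae ae.
rewrite -(ae_eq_Rintegral mH mHT ae) mulrC /J /bracket_mass -RintegralZl//.
by apply: ler_Rintegral => //; exact: integZ.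
Qed.

Variables (tau : R) (psi0 psi1 psi2 : V -> R) (psi phi : R -> V -> R).
Hypotheses (tau0 : 0 < tau) (tau1 : tau <= 1).
Hypotheses (hpsi2 : compatible_data delta psi0 psi1 psi2)
  (hpsi : MGT_solution tau delta psi0 psi1 psi2 psi)
  (hphi : Kuznetsov_solution delta psi0 psi1 phi).

(** One factor 2 * [hc] comes from the bound on the transforms of the data, another from inverting
    the transform of w, and [bracket_mass] from the two uses of the integrable weight. *)
Definition CLinf : R := 4 * hc ^+ 2 * bracket_mass * Num.sqrt (Cfreq delta) + 1.

Lemma CLinf_gt0 : 0 < CLinf.
Proof.
by rewrite /CLinf ltr_wpDl// mulr_ge0 ?sqrtr_ge0// mulr_ge0// mulr_ge0// sqr_ge0.
Qed.

Lemma Linfty_ae (g0 g1 : V -> R) (t : R) :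
  bessel_potential (s0 + 2) psi0 g0 -> bessel_potential (s0 + 1) psi1 g1 -> 0 <= t ->
  {ae mu, forall x, `|psi t x - phi t x| <=
     tau * CLinf * (\int[mu]_x `|g0 x| + \int[mu]_x `|g1 x|)}.
Proof.
move=> b0 b1 t0; have [L0 L1] := data_L2 hpsi2.
have [Lp Lf] := solution_L2 hpsi hphi t0; have Lw := L2B Lp Lf.
have e0 : be + 4 - (s0 + 2) = - be by rewrite /be; field.
have e1 : be + 3 - (s0 + 1) = - be by rewrite /be; field.
have [I0 E0] := @weighted_data 4 _ _ _ e0 b0 L0.
have [I1 E1] := @weighted_data 3 _ _ _ e1 b1 L1.
set G0 := \int[mu]_x `|g0 x| in E0 *; set G1 := \int[mu]_x `|g1 x| in E1 *.
have G00 : 0 <= G0 by exact: Rintegral_ge0.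
have G10 : 0 <= G1 by exact: Rintegral_ge0.
have hc0 : 0 <= hc by exact/ltW/hcst_gt0.
have Idw : integ mu (fun xi => br be xi * data_weight (HT psi0) (HT psi1) xi).
  by rewrite /data_weight; under eq_fun do rewrite mulrDr; exact: integD.
have Edw : \int[mu]_xi (br be xi * data_weight (HT psi0) (HT psi1) xi) <=
    J * (2 * hc) ^+ 2 * (G0 + G1) ^+ 2.
  rewrite /data_weight; under eq_Rintegral do rewrite mulrDr.
  rewrite RintegralD//; apply: (le_trans (lerD E0 E1)).
  rewrite -subr_ge0 (_ : _ - _ = J * (2 * hc) ^+ 2 * (2 * (G0 * G1))); last by ring.
  by rewrite !mulr_ge0// sqr_ge0.
have [IW EW] := frequency_estimate n_gt0 delta0 tau0 tau1 hpsi2 hpsi hphi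
  (measurable_bracket be) bddm_br (br0 be) t0 Idw.
set W := fun xi => HT (psi t) xi - HT (phi t) xi.
have mW : measurable_fun setT W by apply: L2_measurable; apply: L2B; exact: HT_L2.
(* |W| is the product of u and v; the square of u is the integrable weight, and the square of v is
   what the frequency estimate controls. *)
pose u := br (- be / 2); pose v xi := br (be / 2) xi * `|W xi|.
have u2 xi : u xi ^+ 2 = br (- be) xi by rewrite /u expr2 brD -splitr.
have v2 xi : v xi ^+ 2 = br be xi * W xi ^+ 2.
  by rewrite /v exprMn expr2 brD -splitr real_normK ?num_real.
have uL : u \in L2.
  by apply/L2P; split; [exact: measurable_bracket|under eq_fun do rewrite u2].
have vL : v \in L2.
  apply/L2P; split; last by under eq_fun do rewrite v2.
  by apply: measurable_funM; [exact: measurable_bracket|exact: measurableT_comp].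
have uv xi : u xi * v xi = `|W xi|.
  by rewrite /u /v mulrA brD mulNr addNr /br powRr0 mul1r.
have IaW : integ mu (fun xi => `|W xi|).
  by have := L2M uL vL; congr (integ mu _); apply/funext => xi.
have C0 : 0 <= Cfreq delta by exact: Cfreq_ge0.
set D := 2 * hc * J * Num.sqrt (Cfreq delta) * tau * (G0 + G1).
have D0 : 0 <= D by rewrite /D !mulr_ge0 ?sqrtr_ge0 ?addr_ge0// ltW.
have W1 : \int[mu]_xi `|W xi| <= D.
  have -> : \int[mu]_xi `|W xi| = dotL2 mu u v by apply: eq_Rintegral => xi _; rewrite uv.
  apply: (le_trans (ler_norm _)); apply: (le_trans (cauchy_schwarz uL vL)).
  rewrite -(ler_pXn2r (n := 2)) ?nnegrE//; last by rewrite mulr_ge0 ?nrmL2_ge0.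
  rewrite exprMn !nrmL2_sqr !dotL2_sqr.
  under eq_Rintegral do rewrite u2.
  under [X in _ * X]eq_Rintegral do rewrite v2.
  rewrite -/bracket_mass -/J.
  apply: (@le_trans _ _ (J * (Cfreq delta * tau ^+ 2 * (J * (2 * hc) ^+ 2 * (G0 + G1) ^+ 2)))).
    rewrite ler_wpM2l//; apply: (le_trans EW).
    by rewrite ler_wpM2l// mulr_ge0// sqr_ge0.
  rewrite le_eqVlt; apply/orP; left; apply/eqP.
  by rewrite /D -[in LHS](sqr_sqrtr C0); ring.
have HW := HTB Lp Lf.
have HL := HT_L2 Lw.
have IHw : integ mu (HT (fun x => psi t x - phi t x)).
  apply: (@integ_ae _ _ _ _ W); first last.
  - by apply: filterS HW => xi ->.
  - exact: (L2_measurable HL).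
  - apply: (@le_integ _ _ _ _ _ (fun xi => `|W xi|)) => //.
have EHw : \int[mu]_xi `|HT (fun x => psi t x - phi t x) xi| <= D.
  apply: le_trans W1; rewrite le_eqVlt; apply/orP; left; apply/eqP.
  apply: ae_eq_Rintegral.
  - by apply: measurableT_comp => //; exact: (L2_measurable HL).
  - exact: measurableT_comp.
  - by apply: filterS HW => xi ->.
(* The transform of w is integrable, so w, being the transform of its transform, is given almost
   everywhere by a convergent integral and inherits the sup bound. *)
apply: filterS2 (HT_inv Lw) (HT_hartley IHw HL) => x h1 h2.
rewrite -h1 h2; apply: le_trans (hartley_bound x IHw) _.
apply: (@le_trans _ _ (2 * hc * D)); first by rewrite ler_wpM2l// mulr_ge0.
rewrite -subr_ge0 /CLinf -/J (_ : _ - _ = tau * (G0 + G1)); last by rewrite /D; ring.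
by rewrite mulr_ge0 ?addr_ge0// ltW.
Qed.

Lemma Linfty_estimate_fin (t : R) : 0 <= t -> (bessel_L1_norm (s0 + 2) psi0 < +oo)%E ->
  (bessel_L1_norm (s0 + 1) psi1 < +oo)%E ->
  (Lp_norm +oo (fun x => psi t x - phi t x)%R <=
   (tau * CLinf)%:E * (bessel_L1_norm (s0 + 2) psi0 + bessel_L1_norm (s0 + 1) psi1))%E.
Proof.
move=> t0; have := bessel_L1_norm_ge0 (s0 + 2) psi0; have := bessel_L1_norm_ge0 (s0 + 1) psi1.
case E0 : (bessel_L1_norm (s0 + 2) psi0) => [B0||]//; case E1 : (bessel_L1_norm (s0 + 1) psi1) => [B1||]// B10 B00 _ _.
have K0 : 0 < tau * CLinf by rewrite mulr_gt0// CLinf_gt0.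
rewrite -EFinD -EFinM; apply/lee_addgt0Pr => e e0.
(* The infima defining the norms need not be attained; each is approached within h, chosen so that
   the two excesses contribute exactly e. *)
set h := e / (2 * (tau * CLinf)); have h0 : 0 < h by rewrite divr_gt0// mulr_gt0.
have [_ [g0 b0 <-] H0] : exists2 y, [set Lp_norm 1%:E g | g in [set g | bessel_potential (s0 + 2) psi0 g]] y &
    (y < (B0 + h)%:E)%E.
  by apply: ereal_inf_lt; rewrite -/(bessel_L1_norm _ _) E0 lte_fin ltrDl.
have [_ [g1 b1 <-] H1] : exists2 y, [set Lp_norm 1%:E g | g in [set g | bessel_potential (s0 + 1) psi1 g]] y &
    (y < (B1 + h)%:E)%E.
  by apply: ereal_inf_lt; rewrite -/(bessel_L1_norm _ _) E1 lte_fin ltrDl.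
move: H0 H1; have [_ Ig0 _] := b0; have [_ Ig1 _] := b1; rewrite !Lp_norm1E// !lte_fin => H0 H1.
have := Linfty_ae b0 b1 t0; set G0 := \int[mu]_x `|g0 x| in H0 *; set G1 := \int[mu]_x `|g1 x| in H1 *.
move=> /Lp_norm_y_le => /(_ _)/wrap[].
  by rewrite mulr_ge0 ?(ltW K0)// addr_ge0//; exact: Rintegral_ge0.
move=> /le_trans; apply; rewrite -EFinD lee_fin.
rewrite (_ : _ + e = tau * CLinf * ((B0 + h) + (B1 + h))).
  by rewrite ler_wpM2l ?(ltW K0)// lerD// ltW.
rewrite /h; field.
by rewrite !gt_eqF// CLinf_gt0.
Qed.

Lemma Linfty_estimate : (sup_Lp_dist +oo psi phi <=
  (tau * CLinf)%:E * (bessel_L1_norm (s0 + 2) psi0 + bessel_L1_norm (s0 + 1) psi1))%E.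
Proof.
have Cp : (0 < (tau * CLinf)%:E)%E by rewrite lte_fin mulr_gt0// CLinf_gt0.
have H0 := bessel_L1_norm_ge0 (s0 + 2) psi0; have H1 := bessel_L1_norm_ge0 (s0 + 1) psi1.
have [fin|inf] := ltP (bessel_L1_norm (s0 + 2) psi0 + bessel_L1_norm (s0 + 1) psi1)%E +oo%E; last first.
  by move: inf; rewrite leye_eq => /eqP ->; rewrite gt0_muley// leey.
apply: ge_ereal_sup => _ [t /= t0 <-]; apply: Linfty_estimate_fin.
- by move: t0; rewrite in_itv/= andbT.
- by apply: le_lt_trans fin; rewrite leeDl.
- by apply: le_lt_trans fin; rewrite leeDr.
Qed.

End Linfty_estimate.

(** * Interpolation and conclusion *)

Section Lp_interpolation.
Context (R : realType) (n : nat).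
Local Notation V := 'rV[R]_n.
Local Notation mu := (lebesgue_rV R n).
Local Notation L2 := (Lfun mu 2%:E).

(** For finite r one has |f|^r <= M^(r - 2) f^2 almost everywhere. Using the same M for both
    endpoint norms, the bound M is preserved for every exponent. *)
Lemma Lp_norm_interpolation (f : V -> R) (M : R) (p : \bar R) : (2%:E <= p)%E -> f \in L2 ->
  0 < M -> nrmL2 mu f <= M -> {ae mu, forall x, `|f x| <= M} -> (Lp_norm p f <= M%:E)%E.
Proof.
have powR_split (a r : R) : 0 <= a -> 0 < r -> a `^ r = a `^ (r - 2) * a ^+ 2.
  move=> a0 r0; rewrite -powR_mulrn// -powRD ?subrK//.
  by rewrite gt_eqF.
case: p => [r||] //; last by move=> _ _ M0 _; exact/Lp_norm_y_le/ltW.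
rewrite lee_fin => r2 fL M0 nM fM; have r0 : 0 < r by exact: lt_le_trans r2.
have H : (\int[mu]_x (`|f x| `^ r)%:E <= (M `^ r)%:E)%E.
  apply: (@le_trans _ _ (\int[mu]_x (M `^ (r - 2) * f x ^+ 2)%:E)%E).
    apply: ae_ge0_le_integral => //.
    - apply/measurable_EFinP; apply: (measurableT_comp (@measurable_powR R r)).
      by apply: measurableT_comp => //; exact: (L2_measurable fL).
    - by move=> x _; rewrite lee_fin mulr_ge0 ?powR_ge0 ?sqr_ge0.
    - apply/measurable_EFinP; apply: measurable_funM => //; apply: measurable_funX.
      exact: (L2_measurable fL).
    - apply: filterS fM => x h _; rewrite lee_fin.
      rewrite powR_split// real_normK ?num_real//.
      rewrite ler_wpM2r ?sqr_ge0//; apply: ge0_ler_powR; rewrite ?nnegrE ?subr_ge0//.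
      exact: ltW.
  rewrite -Rintegral_EFin; last by apply: integZ; exact: L2_sqr.
  rewrite lee_fin RintegralZl//; last exact: L2_sqr.
  rewrite -dotL2_sqr -nrmL2_sqr [leRHS](powR_split _ _ (ltW M0) r0) ler_wpM2l ?powR_ge0//.
  by rewrite lerXn2r ?nnegrE ?nrmL2_ge0// ltW.
rewrite /Lp_norm unlock /Lnorm.
have -> : M%:E = ((M `^ r)%:E `^ r^-1)%E.
  by rewrite poweR_EFin -powRrM mulfV ?gt_eqF// powRr1// ltW.
apply: gt0_ler_poweR => //.
- by rewrite invr_ge0 ltW.
- by rewrite in_itv/= leey andbT; apply: integral_ge0 => x _; rewrite lee_fin powR_ge0.
- by rewrite in_itv/= leey andbT lee_fin powR_ge0.
Qed.

Lemma sup_Lp_dist_ge0 (p : \bar R) (u v : R -> V -> R) : (0 <= sup_Lp_dist p u v)%E.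
Proof.
apply: (@le_trans _ _ (Lp_norm p (fun x => u 0 x - v 0 x))).
  by rewrite /Lp_norm Lnorm_ge0.
by apply: ereal_sup_ubound; exists 0 => //=; rewrite in_itv/= lexx.
Qed.

End Lp_interpolation.

Theorem mainTheorem7 (R : realType) (n : nat) (hn : (1 <= n)%N)
    (delta : R) (hdelta : 0 < delta) :
  exists tau0 : R, 0 < tau0 /\
  [/\ exists C : R, 0 < C /\
        forall (psi0 psi1 psi2 : 'rV[R]_n -> R) (tau : R)
               (psi phi : R -> 'rV[R]_n -> R),
          0 < tau <= tau0 ->
          compatible_data delta psi0 psi1 psi2 ->
          MGT_solution tau delta psi0 psi1 psi2 psi ->
          Kuznetsov_solution delta psi0 psi1 phi ->
          (sup_Lp_dist 2%:E psi phi
           <= (tau * C)%:E * (HsL1_norm 4 psi0 + HsL1_norm 3 psi1))%E,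
      forall s0 : R, n%:R + 2 < s0 ->
        exists C : R, 0 < C /\
        forall (psi0 psi1 psi2 : 'rV[R]_n -> R) (tau : R)
               (psi phi : R -> 'rV[R]_n -> R),
          0 < tau <= tau0 ->
          compatible_data delta psi0 psi1 psi2 ->
          MGT_solution tau delta psi0 psi1 psi2 psi ->
          Kuznetsov_solution delta psi0 psi1 phi ->
          (sup_Lp_dist +oo psi phi
           <= (tau * C)%:E * (bessel_L1_norm (s0 + 2) psi0
                              + bessel_L1_norm (s0 + 1) psi1))%E
    & forall (s0 : R), n%:R + 2 < s0 ->
        forall (psi0 psi1 psi2 : 'rV[R]_n -> R)
               (psi : R -> R -> 'rV[R]_n -> R) (phi : R -> 'rV[R]_n -> R),
          compatible_data delta psi0 psi1 psi2 ->
          (forall tau, 0 < tau <= tau0 ->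
             MGT_solution tau delta psi0 psi1 psi2 (psi tau)) ->
          Kuznetsov_solution delta psi0 psi1 phi ->
          (HsL1_norm 4 psi0 + HsL1_norm 3 psi1 < +oo)%E ->
          (bessel_L1_norm (s0 + 2) psi0 + bessel_L1_norm (s0 + 1) psi1
           < +oo)%E ->
          forall p : \bar R, (2%:E <= p)%E ->
            sup_Lp_dist p (psi tau) phi @[tau --> 0^'+] --> 0%E /\
            exists K : R, 0 < K /\
              forall tau, 0 < tau <= tau0 ->
                (sup_Lp_dist p (psi tau) phi <= (tau * K)%:E)%E].
Proof.
(* The energy argument asks only for tau <= 1. *)
exists 1; split=> //; split.
- exists (CL2 delta); split; first by rewrite /CL2 ltr_wpDl// sqrtr_ge0.
  move=> psi0 psi1 psi2 tau psi phi /andP[tau0 tau1] hpsi2 hpsi hphi.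
  exact: L2_estimate hpsi2 hpsi hphi.
- move=> s0 hs0; exists (CLinf n delta s0); split; first exact: CLinf_gt0.
  move=> psi0 psi1 psi2 tau psi phi /andP[tau0 tau1] hpsi2 hpsi hphi.
  exact: Linfty_estimate hpsi2 hpsi hphi.
move=> s0 hs0 psi0 psi1 psi2 psi phi hpsi2 hpsi hphi finH finB p p2.
suff [K [K0 HK]] : exists K : R, 0 < K /\
    forall tau, 0 < tau <= 1 -> (sup_Lp_dist p (psi tau) phi <= (tau * K)%:E)%E.
  split; last by exists K.
  have C : (tau * K)%:E @[tau --> 0^'+] --> (0 * K)%:E.
    apply: cvg_EFin; first by near=> tau.
    apply: cvgM; last exact: cvg_cst.
    by apply: cvg_at_right_filter; exact: cvg_id.
  rewrite mul0r in C.
  apply: (squeeze_cvge _ (cvg_cst 0%E) C); near=> tau.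
  rewrite sup_Lp_dist_ge0 HK//; apply/andP; split.
    by near: tau; exact: nbhs_right_gt.
  by near: tau; apply: nbhs_right_le.
have H4 := HsL1_norm_ge0 4 psi0; have H3 := HsL1_norm_ge0 3 psi1.
have h4 : (HsL1_norm 4 psi0 < +oo)%E by apply: le_lt_trans finH; rewrite leeDl.
have h3 : (HsL1_norm 3 psi1 < +oo)%E by apply: le_lt_trans finH; rewrite leeDr.
have B0 := bessel_L1_norm_ge0 (s0 + 2) psi0; have B1 := bessel_L1_norm_ge0 (s0 + 1) psi1.
(* Finiteness of the infimum only serves to provide some <D>^s psi0 in L1: the constant K may depend
   on the data, so no near-optimal choice is made. *)
have [_ [g0 b0 _] _] : exists2 y, [set Lp_norm 1%:E g | g in [set g | bessel_potential (s0 + 2) psi0 g]] y &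
    (y < +oo)%E.
  by apply: ereal_inf_lt; apply: le_lt_trans finB; rewrite leeDl.
have [_ [g1 b1 _] _] : exists2 y, [set Lp_norm 1%:E g | g in [set g | bessel_potential (s0 + 1) psi1 g]] y &
    (y < +oo)%E.
  by apply: ereal_inf_lt; apply: le_lt_trans finB; rewrite leeDr.
set S := (HsL1_norm 4 psi0 + HsL1_norm 3 psi1)%E in finH.
have S0 : (0 <= S)%E by exact: adde_ge0.
have SE : S = (fine S)%:E by rewrite fineK// ge0_fin_numE.
set G := \int[lebesgue_rV R n]_x `|g0 x| + \int[lebesgue_rV R n]_x `|g1 x|.
have G0 : 0 <= G by apply: addr_ge0; exact: Rintegral_ge0.
have C20 : 0 <= CL2 delta by rewrite /CL2 addr_ge0 ?sqrtr_ge0.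
have Ci0 := ltW (CLinf_gt0 n delta s0).
have K20 : 0 <= CL2 delta * fine S by rewrite mulr_ge0// fine_ge0.
have Ki0 : 0 <= CLinf n delta s0 * G by exact: mulr_ge0.
(* Adding the two endpoint constants gives a common bound for the L2 and sup norms, as the
   interpolation requires; the 1 makes it positive. *)
exists (CL2 delta * fine S + CLinf n delta s0 * G + 1); split.
  by rewrite ltr_wpDl// addr_ge0.
move=> tau tau01; have /andP[tau0 tau1] := tau01; have hpsit := hpsi tau tau01.
apply: ge_ereal_sup => _ [t /= + <-]; rewrite in_itv/= andbT => t0.
have [Lp Lf] := solution_L2 hpsit hphi t0; have Lw := L2B Lp Lf.
apply: Lp_norm_interpolation => //.
- by rewrite mulr_gt0// ltr_wpDl// addr_ge0.
- have := L2_estimate_fin hn hdelta tau0 tau1 hpsi2 hpsit hphi h4 h3 t0.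
  rewrite /Lp_norm Lnorm2E// -/S SE -EFinM lee_fin => /le_trans; apply.
  by rewrite -mulrA ler_wpM2l ?(ltW tau0)// -addrA lerDl addr_ge0.
- apply: filterS (Linfty_ae hn hdelta hs0 tau0 tau1 hpsi2 hpsit hphi b0 b1 t0) => x.
  move=> /le_trans; apply; rewrite -mulrA ler_wpM2l ?(ltW tau0)// -/G.
  by rewrite addrAC lerDr addr_ge0.
Unshelve. all: by end_near. Qed.
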